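(* (1) There are scattered C*-subalgebras of $\mathcal{B}(\ell_2(\omega_2))$ of density $\omega_2$ which are not AF. (2) There are scattered C*-subalgebras of $\mathcal{B}(\ell_2(2^\omega))$ of density bigger than $2^\omega$ which are not AF. (3) If there exists a Canadian tree, then there are scattered C*-subalgebras of $\mathcal{B}(\ell_2(\omega_1))$ of density bigger than $\omega_1$ which are not AF. (4) If there exist a Canadian tree and a Boolean embedding $E:\wp(\omega_1)\rightarrow\wp(\mathbb{N})/\mathrm{Fin}$, then there are scattered C*-subalgebras of $\mathcal{B}(\ell_2)$ of density bigger than $\omega_1$ which are not AF.
   Context: The theorem is in ZFC. $\omega_1,\omega_2$ are the first and second uncountable cardinals and $2^\omega$ is the cardinality of the continuum. $\ell_2(\kappa)$ is the Hilbert space of square summable functions on $\kappa$, $\ell_2=\ell_2(\mathbb{N})$, and $\mathcal{B}(H)$ is the C*-algebra of bounded operators on $H$. The density of a Banach space is the minimum cardinality of a norm dense subset. $\wp(\mathbb{N})/\mathrm{Fin}$ is the Boolean algebra of subsets of $\mathbb{N}$ modulo finite sets; a Boolean embedding is an injective homomorphism of Boolean algebras. A C*-algebra $A$ is scattered if every nonzero quotient $B$ of $A$ contains a nonzero minimal projection, i.e. a nonzero projection $p$ with $pBp=\mathbb{C}p$ (equivalently, every self-adjoint element of $A$ has countable spectrum). $A$ is AF if it has a family of finite-dimensional C*-subalgebras, directed under inclusion, with dense union. A tree is a set $T$ with a strict partial order $\prec$ such that $\{t:t\prec s\}$ is well-ordered for all $s\in T$; the height of $s$ is the order type of this set, the $\alpha$-th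 level is the set of elements of height $\alpha$, the height of $T$ (and of a subset $S\subseteq T$) is the supremum of $\mathrm{ht}(s)+1$ over its elements $s$, and a branch is a maximal linearly ordered subset. A Canadian tree (weak Kurepa tree) is a tree of height $\omega_1$ with each level of cardinality at most $\omega_1$ and with more than $\omega_1$ uncountable branches (i.e. branches of height $\omega_1$). *)

(* Defs.v *)
From HB Require Import structures.
From mathcomp Require Import all_boot all_order all_algebra.
From mathcomp Require Import generic_quotient complex ring lra.
From mathcomp Require Import mathcomp_extra boolp classical_sets functions.
From mathcomp Require Import cardinality fsbigop wochoice reals ereal numfun.
From mathcomp Require Import esum.

Set Implicit Arguments.
Unset Strict Implicit.
Unset Printing Implicit Defensive.

Import Order.TTheory GRing.Theory Num.Theory.
Local Open Scope classical_set_scope.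
Local Open Scope card_scope.
Local Open Scope quotient_scope.
Local Open Scope ring_scope.

(** * Cardinals *)

Definition well_ordered {T : Type} (lt : T -> T -> Prop) (A : set T) : Prop :=
  [/\ forall x, A x -> ~ lt x x,
      forall x y z, A x -> A y -> A z -> lt x y -> lt y z -> lt x z,
      forall x y, A x -> A y -> [\/ lt x y, x = y | lt y x]
    & forall B, B `<=` A -> B !=set0 ->
        exists2 m, B m & forall x, B x -> x = m \/ lt m x].

Definition card_lt {T U : Type} (A : set T) (B : set U) : Prop :=
  (A #<= B) /\ ~ (B #<= A).

Section CardinalSuccessor.
Variable X : Type.

(* A fixed well-ordering (in reflexive form) of the powerset of X. *)
Definition pow_le : rel (set X) := projT1 (well_ordering_principle (set X)).

Definition pow_lt (a b : set X) : Prop := pow_le a b /\ a <> b.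

(* The elements with at most |X| predecessors in a well-order of size > |X|:
   an initial segment whose order type is the initial ordinal |X|^+
   (see succ_lt_wo, card_succ_segment and card_succ_gt). *)
Definition card_succ_set : set (set X) :=
  [set a | [set b | pow_lt b a] #<= [set: X]].

Definition card_succ : Type := card_succ_set.

HB.instance Definition _ := Choice.on card_succ.

Definition succ_lt (a b : card_succ) : Prop := pow_lt (val a) (val b).

Lemma pow_le_wo : well_order pow_le.
Proof. exact: projT2 (well_ordering_principle (set X)). Qed.

Lemma pow_le_min (B : set (set X)) : B !=set0 ->
  exists2 m, B m & forall x, B x -> pow_le m x.
Proof.
move=> [b Bb]; pose P : {pred set X} := fun x => `[< B x >].
have P0 : wochoice.nonempty P by exists b; apply/asboolP.
have [m [[mB mle] _]] := pow_le_wo P0.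
by exists m => [|x Bx]; [exact/asboolP|apply: mle; apply/asboolP].
Qed.

Lemma pow_le_total x y : pow_le x y \/ pow_le y x.
Proof.
have [|m [] -> mle] := @pow_le_min [set x; y]; first by exists x; left.
  by left; apply: mle; right.
by right; apply: mle; left.
Qed.

Lemma pow_le_anti x y : pow_le x y -> pow_le y x -> x = y.
Proof.
move=> xy yx; have refl z : pow_le z z by case: (pow_le_total z z).
pose P : {pred set X} := pred2 x y.
have P0 : wochoice.nonempty P by exists x; rewrite inE eqxx.
have [m [_ mP]] := pow_le_wo P0.
rewrite -(mP x) ?(mP y)//; split; rewrite ?inE ?eqxx ?orbT//.
  by move=> z; rewrite inE => /orP[]/eqP ->.
by move=> z; rewrite inE => /orP[]/eqP ->.
Qed.

Lemma pow_lt_wo (A : set (set X)) : well_ordered pow_lt A.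
Proof.
have tr x y z : pow_le x y -> pow_le y z -> pow_le x z.
  move=> xy yz.
  have [|m mB mle] := @pow_le_min [set x; y; z]; first by exists x; left; left.
  case: mB mle => [[]|] -> mle.
  - by apply: mle; right.
  - have yx := mle x (or_introl (or_introl erefl)).
    by rewrite (pow_le_anti xy yx).
  - have zx := mle x (or_introl (or_introl erefl)).
    have zy := mle y (or_introl (or_intror erefl)).
    by rewrite -(pow_le_anti yz zy).
split=> [x _ [_ /(_ erefl)]//|x y z _ _ _ [xy nxy] [yz nyz]|x y _ _|B _ B0].
- split; first exact: tr xy yz.
  by move=> xz; apply: nxy; apply: pow_le_anti => //; rewrite xz.
- have [->|/eqP xy] := eqVneq x y; first by constructor 2.
  case: (pow_le_total x y) => le; [constructor 1|constructor 3]; split=> //.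
  exact/nesym.
- have [m Bm mle] := pow_le_min B0; exists m => // x Bx.
  have [->|/eqP xm] := eqVneq x m; [by left|right]; split; [exact: mle|].
  exact/nesym.
Qed.

Lemma succ_lt_wo : well_ordered succ_lt [set: card_succ].
Proof.
have [ir tr tri mi] := pow_lt_wo card_succ_set.
have mem (x : card_succ) : card_succ_set (val x) := set_mem (valP x).
split=> [x _|x y z _ _ _|x y _ _|B _ [b Bb]].
- exact: ir (mem x).
- exact: tr (mem x) (mem y) (mem z).
- case: (tri _ _ (mem x) (mem y)) => [xy|/val_inj xy|yx].
  + by constructor 1.
  + by constructor 2.
  + by constructor 3.
- have [||_ [m Bm <-] mB] := mi (val @` B).
  + by move=> _ [x _ <-].
  + by exists (val b); exists b.
  + exists m => // x Bx.
    have [/val_inj ->|mx] : val x = val m \/ pow_lt (val m) (val x).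
    * by apply: mB; exists x.
    * by left.
    * by right.
Qed.

Lemma card_succ_segment (a : card_succ) :
  [set b | succ_lt b a] #<= [set: X].
Proof.
apply: card_le_trans (set_mem (valP a)).
rewrite -(card_le_eql (@inj_card_eq _ _ _ val _)); last first.
  by move=> x y _ _; exact: val_inj.
by apply: subset_card_le => _ [b ba <-].
Qed.

Lemma card_succ_gt : ~ ([set: card_succ] #<= [set: X]).
Proof.
rewrite (card_le_eql (card_setT card_succ_set)) => leSX.
have [ST|nST] := pselect (card_succ_set = setT).
  move: leSX; rewrite ST => /card_leP[f].
  pose D : set X := [set x | exists2 A, val (f A) = x & ~ (val A : set X) x].
  have fI : injective f by move=> A A' fAA'; apply: (@inj _ _ setT f); rewrite ?inE.
  pose D' : [set: set X] := to_setT D.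
  have nD : ~ D (val (f D')).
    by move=> [A /val_inj/fI -> nD]; apply: (nD); exists D'.
  by apply: (nD); exists D'.
have [|a nSa amin] := @pow_le_min (~` card_succ_set).
  by apply/set0P/eqP => /(congr1 setC); rewrite setCK setC0.
apply: nSa; apply: card_le_trans leSX; apply: subset_card_le => b [ba nba].
apply: contrapT => nSb; apply: nba; apply: pow_le_anti => //; exact: amin.
Qed.

End CardinalSuccessor.

Definition omega1 : Type := card_succ nat.
HB.instance Definition _ := Choice.on omega1.

Definition omega2 : Type := card_succ omega1.
HB.instance Definition _ := Choice.on omega2.

Definition omega1_lt : omega1 -> omega1 -> Prop := @succ_lt nat.

(** * Trees *)

Section Trees.
Variables (T : Type) (prec : T -> T -> Prop).

Definition is_tree : Prop :=
  [/\ forall s, ~ prec s s,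
      forall s t u, prec s t -> prec t u -> prec s u
    & forall s, well_ordered prec [set t | prec t s]].

(* ht(s) = a, where a : omega1 stands for the ordinal of its predecessors. *)
Definition has_ht (s : T) (a : omega1) : Prop :=
  exists2 f : T -> omega1,
    set_bij [set t | prec t s] [set b | omega1_lt b a] f
    & forall t u, prec t s -> prec u s ->
        (prec t u <-> omega1_lt (f t) (f u)).

Definition tree_level (a : omega1) : set T := [set s | has_ht s a].

(* sup of ht(s) + 1 over all s equals omega1. *)
Definition height_omega1 : Prop :=
  (forall s, exists a, has_ht s a) /\
  (forall b, exists s a, has_ht s a /\ (b = a \/ omega1_lt b a)).

Definition linearly_ordered (S : set T) : Prop :=
  forall s t, S s -> S t -> [\/ prec s t, s = t | prec t s].

Definition is_branch (S : set T) : Prop :=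
  linearly_ordered S /\
  forall S', linearly_ordered S' -> S `<=` S' -> S' = S.

Definition is_Canadian_tree : Prop :=
  [/\ is_tree, height_omega1,
      forall a, tree_level a #<= [set: omega1]
    & card_lt [set: omega1] [set S | is_branch S /\ ~ countable S]].

End Trees.

(** * The Boolean algebra P(N)/Fin *)

Definition eq_mod_fin : rel (set nat) :=
  fun A B => `[< finite_set (A `+` B) >].

Lemma eq_mod_fin_refl : reflexive eq_mod_fin.
Proof. by move=> A; apply/asboolP; rewrite setYK. Qed.

Lemma eq_mod_fin_sym : symmetric eq_mod_fin.
Proof. by move=> A B; rewrite /eq_mod_fin setYC. Qed.

Lemma eq_mod_fin_trans : transitive eq_mod_fin.
Proof.
move=> B A C /asboolP fAB /asboolP fBC; apply/asboolP.
apply: (@sub_finite_set _ _ ((A `+` B) `|` (B `+` C))); last first.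
  by rewrite finite_setU.
move=> n; rewrite /setY /setD /=.
by have [Bn|Bn] := pselect (B n); tauto.
Qed.

Canonical eq_mod_fin_equiv :=
  EquivRel eq_mod_fin eq_mod_fin_refl eq_mod_fin_sym eq_mod_fin_trans.

Definition PN_mod_Fin : Type := {eq_quot eq_mod_fin}%qT.
HB.instance Definition _ := Choice.on PN_mod_Fin.
HB.instance Definition _ := EqQuotient.on PN_mod_Fin.

Definition qjoin (x y : PN_mod_Fin) : PN_mod_Fin :=
  \pi_PN_mod_Fin (repr x `|` repr y).
Definition qmeet (x y : PN_mod_Fin) : PN_mod_Fin :=
  \pi_PN_mod_Fin (repr x `&` repr y).
Definition qcompl (x : PN_mod_Fin) : PN_mod_Fin := \pi_PN_mod_Fin (~` repr x).
Definition qbot : PN_mod_Fin := \pi_PN_mod_Fin set0.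
Definition qtop : PN_mod_Fin := \pi_PN_mod_Fin setT.

Lemma pi_eqE (A B : set nat) :
  \pi_PN_mod_Fin A = \pi_PN_mod_Fin B <-> finite_set (A `+` B).
Proof.
split=> [/eqP|fAB]; first by rewrite eqmodE => /asboolP.
by apply/eqP; rewrite eqmodE; apply/asboolP.
Qed.

Lemma repr_pi_fin (A : set nat) :
  finite_set (repr (\pi_PN_mod_Fin A) `+` A).
Proof. by apply/pi_eqE; rewrite reprK. Qed.

Lemma qjoinE (A B : set nat) :
  qjoin (\pi_PN_mod_Fin A) (\pi_PN_mod_Fin B) = \pi_PN_mod_Fin (A `|` B).
Proof.
apply/pi_eqE; apply: (@sub_finite_set _ _
  ((repr (\pi_PN_mod_Fin A) `+` A) `|` (repr (\pi_PN_mod_Fin B) `+` B))).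
  by move=> n; rewrite /setY /setD /=; tauto.
by rewrite finite_setU; split; exact: repr_pi_fin.
Qed.

Lemma qmeetE (A B : set nat) :
  qmeet (\pi_PN_mod_Fin A) (\pi_PN_mod_Fin B) = \pi_PN_mod_Fin (A `&` B).
Proof.
apply/pi_eqE; apply: (@sub_finite_set _ _
  ((repr (\pi_PN_mod_Fin A) `+` A) `|` (repr (\pi_PN_mod_Fin B) `+` B))).
  move=> n; rewrite /setY /setD /=.
  have [An|An] := pselect (A n); have [Bn|Bn] := pselect (B n);
  have [rA|rA] := pselect (repr (\pi_PN_mod_Fin A) n);
  have [rB|rB] := pselect (repr (\pi_PN_mod_Fin B) n); tauto.
by rewrite finite_setU; split; exact: repr_pi_fin.
Qed.

Lemma qcomplE (A : set nat) :
  qcompl (\pi_PN_mod_Fin A) = \pi_PN_mod_Fin (~` A).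
Proof.
apply/pi_eqE.
apply: (@sub_finite_set _ _ (repr (\pi_PN_mod_Fin A) `+` A)).
  move=> n; rewrite /setY /setD /=.
  have [An|An] := pselect (A n);
  by have [rA|rA] := pselect (repr (\pi_PN_mod_Fin A) n); tauto.
exact: repr_pi_fin.
Qed.

Definition Boolean_embedding (K : Type) (E : set K -> PN_mod_Fin) : Prop :=
  [/\ injective E,
      E set0 = qbot /\ E setT = qtop,
      forall A B, E (A `|` B) = qjoin (E A) (E B),
      forall A B, E (A `&` B) = qmeet (E A) (E B)
    & forall A, E (~` A) = qcompl (E A)].

(** * The Hilbert space l2(I) *)

Section Ell2.
Variables (R : realType) (I : choiceType).
Local Notation C := (R[i])%type.

Definition sqmod (z : C) : R := complex.Re z ^+ 2 + complex.Im z ^+ 2.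

Lemma sqmod_ge0 z : 0 <= sqmod z.
Proof. by rewrite addr_ge0 ?sqr_ge0. Qed.

Lemma sqmodM z w : sqmod (z * w) = sqmod z * sqmod w.
Proof. case: z w => [a b] [c d]; rewrite /sqmod/=. ring. Qed.

Lemma sqmodD_le z w : sqmod (z + w) <= 2 * (sqmod z + sqmod w).
Proof.
case: z w => [a b] [c d]; rewrite /sqmod/= -subr_ge0.
have -> : 2 * (a ^+ 2 + b ^+ 2 + (c ^+ 2 + d ^+ 2)) -
    ((a + c) ^+ 2 + (b + d) ^+ 2) = (a - c) ^+ 2 + (b - d) ^+ 2 by ring.
by rewrite addr_ge0 ?sqr_ge0.
Qed.

Definition sqsum (f : I -> C) : \bar R :=
  (\esum_(i in [set: I]) (sqmod (f i))%:E)%E.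

Lemma sqsum_ge0 f : (0 <= sqsum f)%E.
Proof. by apply: esum_ge0 => i _; rewrite lee_fin sqmod_ge0. Qed.

Definition ell2_pred : {pred I -> C} := fun f => `[< (sqsum f < +oo)%E >].

Record ell2 := Ell2 { ell2_fun :> I -> C; _ : ell2_fun \in ell2_pred }.

HB.instance Definition _ := [isSub for ell2_fun].
HB.instance Definition _ := [Choice of ell2 by <:].

Lemma ell2P (f : ell2) : (sqsum f < +oo)%E.
Proof. exact/asboolP/(valP f). Qed.

Lemma sqsumZ_le (a : C) (f : I -> C) : (sqsum (a *: f)%R <= (sqmod a)%:E * sqsum f)%E.
Proof.
apply: ge_ereal_sup => _ [A [finA _] <-].
under eq_fsbigr do rewrite /= sqmodM EFinM.
rewrite -ge0_mule_fsumr; last by move=> i; rewrite lee_fin sqmod_ge0.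
apply: lee_wpmul2l; first by rewrite lee_fin sqmod_ge0.
by apply: ereal_sup_ubound; exists A.
Qed.

Lemma sqsumD_le (f g : I -> C) : (sqsum (f + g)%R <= 2%:E * (sqsum f + sqsum g))%E.
Proof.
rewrite -esumD; [|by move=> i _; rewrite lee_fin sqmod_ge0..].
apply: ge_ereal_sup => _ [A [finA _] <-].
apply: (@le_trans _ _
    (2%:E * \sum_(i \in A) ((sqmod (f i))%:E + (sqmod (g i))%:E))%E).
  rewrite ge0_mule_fsumr; last first.
    by move=> i; rewrite -EFinD lee_fin addr_ge0 ?sqmod_ge0.
  apply: lee_fsum => // i _.
  by rewrite -EFinD -EFinM lee_fin sqmodD_le.
apply: lee_wpmul2l; first by rewrite lee_fin.
by apply: ereal_sup_ubound; exists A.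
Qed.

Lemma ell2_submod_closed : GRing.subsemimod_closed ell2_pred.
Proof.
split; last first.
  move=> a f /asboolP fP; apply/asboolP.
  apply: (le_lt_trans (sqsumZ_le a f)).
  have := sqsum_ge0 f; case: (sqsum f) fP => [r| |]//= _ _.
  by rewrite -EFinM ltry.
split.
  apply/asboolP; rewrite /sqsum.
  under eq_esum do rewrite /sqmod /= expr0n addr0.
  by rewrite esum1// ltry.
move=> f g /asboolP fP /asboolP gP; apply/asboolP.
apply: (le_lt_trans (sqsumD_le f g)).
have := sqsum_ge0 f; have := sqsum_ge0 g.
case: (sqsum f) fP => [r| |]//= _; case: (sqsum g) gP => [s| |]//= _ _ _.
by rewrite -EFinD -EFinM ltry.
Qed.

HB.instance Definition _ :=
  GRing.isSubmodClosed.Build C (I -> C) ell2_pred ell2_submod_closed.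
HB.instance Definition _ := [SubChoice_isSubLmodule of ell2 by <:].

Lemma ell2DE (f g : ell2) : f + g = (f : I -> C) + g :> (I -> C).
Proof. exact: (raddfD (val : ell2 -> I -> C)). Qed.

Lemma ell2ZE (a : C) (f : ell2) : a *: f = a *: (f : I -> C) :> (I -> C).
Proof. by []. Qed.

Definition l2norm (f : ell2) : R := Num.sqrt (fine (sqsum f)).

(* The sum of an absolutely summable family. *)
Definition rsum (h : I -> R) : R :=
  fine (\esum_(i in [set: I]) (EFin \o h)^\+ i
        - \esum_(i in [set: I]) (EFin \o h)^\- i)%E.

Definition csum (h : I -> C) : C :=
  Complex (rsum (fun i => complex.Re (h i))) (rsum (fun i => complex.Im (h i))).

Definition inner (f g : ell2) : C := csum (fun i => f i * (g i)^*%C).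

End Ell2.

(** * The algebra B(l2(I)) of bounded operators *)

Section BoundedOperators.
Variables (R : realType) (I : choiceType).
Local Notation C := (R[i])%type.
Local Notation H := (ell2 R I).

Lemma l2norm_ge0 (f : H) : 0 <= l2norm f.
Proof. exact: sqrtr_ge0. Qed.

Lemma l2normD_le (f g : H) : l2norm (f + g) <= 2 * (l2norm f + l2norm g).
Proof.
have sq (h : H) : l2norm h ^+ 2 = fine (sqsum h).
  by rewrite sqr_sqrtr// fine_ge0// sqsum_ge0.
have fin (h : H) : sqsum h \is a fin_num.
  by rewrite ge0_fin_numE ?sqsum_ge0 ?ell2P.
have le2 : l2norm (f + g) ^+ 2 <= 2 * (l2norm f ^+ 2 + l2norm g ^+ 2).
  rewrite !sq -lee_fin EFinM [X in (_ * X)%E]EFinD !(fineK (fin _)).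
  by rewrite ell2DE; exact: sqsumD_le.
have := l2norm_ge0 f; have := l2norm_ge0 g => g0 f0.
rewrite -(@ler_pXn2r _ 2) ?nnegrE ?l2norm_ge0 ?mulr_ge0 ?addr_ge0//.
apply: (le_trans le2); nra.
Qed.

Lemma l2normZ_le (a : C) (f : H) :
  l2norm (a *: f) <= Num.sqrt (sqmod a) * l2norm f.
Proof.
have fin (h : H) : sqsum h \is a fin_num.
  by rewrite ge0_fin_numE ?sqsum_ge0 ?ell2P.
rewrite /l2norm -sqrtrM ?sqmod_ge0// ler_wsqrtr// -lee_fin EFinM !(fineK (fin _)).
by rewrite ell2ZE; exact: sqsumZ_le.
Qed.

Definition bop_pred : {pred H -> H} := fun T =>
  `[< linear T /\ exists M : R, forall f, l2norm (T f) <= M * l2norm f >].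

Record bop := Bop { bop_fun :> H -> H; _ : bop_fun \in bop_pred }.

HB.instance Definition _ := [isSub for bop_fun].
HB.instance Definition _ := [Choice of bop by <:].

Lemma bop_linear (T : bop) : linear T.
Proof. by have /asboolP[] := valP T. Qed.

Lemma bop_bounded (T : bop) :
  exists2 M : R, 0 <= M & forall f, l2norm (T f) <= M * l2norm f.
Proof.
have /asboolP[_ [M TM]] := valP T; exists (Num.max M 0).
  by rewrite le_max lexx orbT.
move=> f; apply: (le_trans (TM f)).
by rewrite ler_wpM2r ?l2norm_ge0// le_max lexx.
Qed.

HB.instance Definition _ (T : bop) :=
  GRing.isLinear.Build C H H *:%R (bop_fun T) (bop_linear T).

Lemma bop_submod_closed : GRing.subsemimod_closed bop_pred.
Proof.
split; last first.
  move=> a T TP; pose T' := Bop TP; apply/asboolP; split.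
    move=> b f g.
    change (a *: T' (b *: f + g) = b *: (a *: T' f) + a *: T' g).
    by rewrite linearP scalerDr !scalerA mulrC.
  have [M M0 TM] := bop_bounded T'.
  exists (Num.sqrt (sqmod a) * M) => f.
  apply: (le_trans (l2normZ_le _ _)); rewrite -mulrA.
  by rewrite ler_wpM2l ?sqrtr_ge0//; exact: TM.
split.
  apply/asboolP; split=> [a f g|].
    by change ((0 : H) = a *: (0 : H) + (0 : H)); rewrite scaler0 addr0.
  exists 0 => f; rewrite mul0r; change (l2norm (0 : H) <= 0).
  have := l2normZ_le 0 (0 : H); rewrite scale0r => /le_trans; apply.
  by rewrite /sqmod/= expr0n addr0 sqrtr0 mul0r.
move=> S T SP TP; pose S' := Bop SP; pose T' := Bop TP.
apply/asboolP; split.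
  move=> a f g.
  change (S' (a *: f + g) + T' (a *: f + g) =
          a *: (S' f + T' f) + (S' g + T' g)).
  by rewrite !linearP scalerDr addrACA.
have [M M0 SM] := bop_bounded S'; have [N N0 TN] := bop_bounded T'.
exists (2 * (M + N)) => f; apply: (le_trans (l2normD_le _ _)).
by rewrite -mulrA ler_pM2l// mulrDl lerD//.
Qed.

HB.instance Definition _ :=
  GRing.isSubmodClosed.Build C (H -> H) bop_pred bop_submod_closed.
HB.instance Definition _ := [SubChoice_isSubLmodule of bop by <:].

Lemma bop_id_subproof : (idfun : H -> H) \in bop_pred.
Proof. by apply/asboolP; split=> //; exists 1 => f; rewrite mul1r. Qed.
Definition bop_id : bop := Bop bop_id_subproof.

Lemma bop_comp_subproof (S T : bop) : (S \o T : H -> H) \in bop_pred.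
Proof.
apply/asboolP; split=> [a f g|]; first by rewrite /comp !linearP.
have [M M0 SM] := bop_bounded S; have [N N0 TN] := bop_bounded T.
exists (M * N) => f; apply: (le_trans (SM _)); rewrite -mulrA.
by rewrite ler_wpM2l.
Qed.
Definition bop_comp (S T : bop) : bop := Bop (bop_comp_subproof S T).

Lemma bopP (S T : bop) : (forall f, S f = T f) -> S = T.
Proof. by move=> ST; apply/val_inj/funext. Qed.

Lemma bop_compA : associative bop_comp.
Proof. by move=> S T U; apply: bopP. Qed.
Lemma bop_comp1l : left_id bop_id bop_comp.
Proof. by move=> S; apply: bopP. Qed.
Lemma bop_comp1r : right_id bop_id bop_comp.
Proof. by move=> S; apply: bopP. Qed.
Lemma bop_compDl : left_distributive bop_comp +%R.
Proof. by move=> S T U; apply: bopP. Qed.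
Lemma bop_compDr : right_distributive bop_comp +%R.
Proof. by move=> S T U; apply: bopP => f; exact: (linearD S). Qed.

HB.instance Definition _ := GRing.Zmodule_isPzRing.Build bop
  bop_compA bop_comp1l bop_comp1r bop_compDl bop_compDr.

Lemma bop_mulE (S T : bop) f : (S * T) f = S (T f).
Proof. by []. Qed.

Lemma bop_scaleAl (a : C) (S T : bop) : a *: S * T = a *: (S * T).
Proof. exact: bopP. Qed.

Lemma bop_scaleAr (a : C) (S T : bop) : S * (a *: T) = a *: (S * T).
Proof.
apply: bopP => f; change (S (a *: T f) = a *: S (T f)).
by rewrite linearZ.
Qed.

Definition opnorm (T : bop) : R :=
  sup [set l2norm (T f) | f in [set f | l2norm f <= 1]].

Definition is_adjoint (T S : bop) : Prop :=
  forall f g, inner (T f) g = inner f (S g).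

End BoundedOperators.

(** * C*-subalgebras of B(l2(I)) *)

Section CstarSubalgebras.
Variables (R : realType) (I : choiceType).
Local Notation C := (R[i])%type.
Local Notation B := (bop R I).
Implicit Types (A J D : set B).

Definition norm_closed A : Prop :=
  forall T, (forall e : R, 0 < e -> exists2 S, A S & opnorm (T - S) < e) -> A T.

Definition norm_dense_in A D : Prop :=
  D `<=` A /\
  forall T, A T -> forall e : R, 0 < e -> exists2 S, D S & opnorm (T - S) < e.

Record Cstar_subalgebra A : Prop := {
  cstar0 : A 0;
  cstarD : forall S T, A S -> A T -> A (S + T);
  cstarZ : forall (a : C) T, A T -> A (a *: T);
  cstarM : forall S T, A S -> A T -> A (S * T);
  cstar_adj : forall T, A T -> exists2 S, A S & is_adjoint T S;
  cstar_closed : norm_closed A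
}.

Record closed_ideal A J : Prop := {
  ideal_sub : J `<=` A;
  ideal0 : J 0;
  idealD : forall S T, J S -> J T -> J (S + T);
  idealZ : forall (a : C) T, J T -> J (a *: T);
  idealMl : forall S T, A S -> J T -> J (S * T);
  idealMr : forall S T, A S -> J T -> J (T * S);
  ideal_closed : norm_closed J
}.

(* The image of T in the quotient by J. *)
Definition coset J (T : B) : set B := [set S | J (S - T)].

(* The image of p in A/J is a nonzero projection with p(A/J)p = Cp. *)
Definition minimal_projection_mod A J (p : B) : Prop :=
  [/\ A p,
      coset J p <> coset J 0,
      coset J (p * p) = coset J p,
      exists2 q, is_adjoint p q & coset J q = coset J p
    & [set coset J (p * T * p) | T in A]
      = [set coset J (a *: p) | a in [set: C]]].

Definition scattered A : Prop :=
  forall J, closed_ideal A J -> J <> A ->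
    exists p, minimal_projection_mod A J p.

Definition finite_dim A : Prop :=
  exists n (b : 'I_n -> B),
    A = [set T | exists c : 'I_n -> C, T = \sum_(i < n) c i *: b i].

Definition AF A : Prop :=
  exists F : set (set B),
    [/\ forall D, F D -> [/\ Cstar_subalgebra D, D `<=` A & finite_dim D],
        F !=set0,
        forall D1 D2, F D1 -> F D2 ->
          exists D3, [/\ F D3, D1 `<=` D3 & D2 `<=` D3]
      & norm_dense_in A (\bigcup_(D in F) D)].

(* K stands for the cardinal |K|. *)
Definition has_density A (K : Type) : Prop :=
  (exists2 D, norm_dense_in A D & D #= [set: K]) /\
  (forall D, norm_dense_in A D -> [set: K] #<= D).

(* The minimum cardinality of a dense subset exceeds |K| iff the cardinality of
   every dense subset does. *)
Definition density_gt A (K : Type) : Prop :=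
  forall D, norm_dense_in A D -> card_lt [set: K] D.

End CstarSubalgebras.

(* Main.v *)
(* All the algebras consist of bounded functions from a set [Z] to the 2 x 2
   complex matrices, acting on [ell2] block-diagonally. Let [r x] be the
   projection onto the line of (1, x). A set [b] of points, with labels in
   P(nat), gives the projection-valued function [p_b] on [b x nat] which equals
   [r (1 / k)] at [(y, n)], where [k > n] codes the first [n] bits of the label
   of [y]; so [r (1 / k)] tends to [r 0] as [n] grows. When two sets carry
   different labels at a common point [y], the projections [p_b] and [p_b']
   differ on [{y} x nat] but are asymptotically equal there. If the sets [b]
   form a well-founded meet-semilattice whose labels agree, up to finite sets,
   on intersections, then modulo the functions concentrated on small sets
   [p_b p_b' = p_(b /\ b')]; minimality produces a minimal projection in every
   nonzero quotient, and the closed algebra generated is scattered.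
   If the algebra were AF, its finite-dimensional subalgebras would contain
   [T_b] close to [p_b], and [T_b] is a scalar multiple of [p_b] outside
   countably many points and smaller sets. When [b], [b'] meet, with different
   labels, at a point avoiding these exceptions, [T_b T_b' T_b] takes there the
   values [c <r (1 / k), r (1 / k')> r (1 / k)] with infinitely many distinct
   overlaps tending to 1, although it lies in a finite-dimensional algebra.
   For (1) the sets are the rows and columns of the grid [omega1 x omega2]; for
   (2) and (3) they are the branches of a tree with more branches than nodes
   and of height of uncountable cofinality. For (4) the same algebra is lifted
   to functions on nat through the embedding in P(nat)/Fin, modulo finite
   sets. *)

(* One construction serves all four cases. Sets of points are carried to sets of indices by a map
   [E] which is a Boolean homomorphism only up to finite sets and sends each point to an infinite
   set: [A] goes to [A x nat] in the first three cases, and to a representative of its image under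
   the given embedding in the last. Functions therefore cannot be evaluated at a point [x]; their
   limit along [E [set x]] takes that role, and finite errors are absorbed by functions of finite
   support, which lie in the algebra. The obstacle that dictates the sizes: an element of the
   algebra is a norm limit of finite combinations of generators, so it involves countably many of
   them, and an AF structure may perturb each projection through its own countable set of
   exceptions. The family of sets must be so rich that no choice of countable exceptions, one for
   every set, removes all clashes of labels. A clash refutes finite dimension through polynomials:
   dependent powers of one element give a polynomial without constant term, and every overlap yields
   a nonzero root of it. *)
Require Import Defs.
From mathcomp Require Import all_boot all_order all_algebra.
From mathcomp Require Import complex ring lra zify.
From mathcomp Require Import mathcomp_extra boolp classical_sets functions.
From mathcomp Require Import cardinality reals ereal numfun esum.

Set Implicit Arguments.
Unset Strict Implicit.
Unset Printing Implicit Defensive.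

Import Order.TTheory GRing.Theory Num.Theory Normc.
Local Open Scope classical_set_scope.
Local Open Scope card_scope.
Local Open Scope ring_scope.

(** * Complex 2 x 2 matrices *)

Section Norms.
Variable R : realType.
Local Notation C := (R[i])%type.
Implicit Types (x y : R) (z w : C) (m : 'M[C]_2).

Lemma normc_ge0 z : 0 <= normc z.
Proof. by case: z => a b /=; exact: sqrtr_ge0. Qed.

Lemma normc_le0 z : normc z <= 0 -> z = 0.
Proof. by move=> z0; apply: eq0_normc; apply/le_anti; rewrite z0 normc_ge0. Qed.

Lemma normc_real x : normc (x%:C)%C = `|x|.
Proof. by rewrite /= expr0n/= addr0 sqrtr_sqr. Qed.

Lemma normc_sqmod z : Num.sqrt (sqmod z) = normc z.
Proof. by case: z. Qed.

Lemma normc_Re z : `|complex.Re z| <= normc z.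
Proof. by case: z => a b /=; rewrite -sqrtr_sqr ler_wsqrtr// lerDl sqr_ge0. Qed.

Lemma normc_Im z : `|complex.Im z| <= normc z.
Proof. by case: z => a b /=; rewrite -sqrtr_sqr ler_wsqrtr// lerDr sqr_ge0. Qed.

Lemma normc_le_ReIm z : normc z <= `|complex.Re z| + `|complex.Im z|.
Proof.
case: z => a b /=; rewrite -(@ler_pXn2r _ 2)// ?nnegrE ?sqrtr_ge0 ?addr_ge0//.
rewrite sqr_sqrtr ?addr_ge0 ?sqr_ge0// sqrrD !real_normK ?num_real//.
by rewrite lerD2r lerDl mulrn_wge0// mulr_ge0.
Qed.

Definition mbnd m (e : R) := forall j k, normc (m j k) <= e.

Lemma mbnd_le m e e' : e <= e' -> mbnd m e -> mbnd m e'.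
Proof. by move=> ee' me j k; exact: le_trans (me j k) ee'. Qed.

Lemma mbnd0 e : 0 <= e -> mbnd 0 e.
Proof. by move=> e0 j k; rewrite mxE normc0. Qed.

Lemma mbndN m e : mbnd m e -> mbnd (- m) e.
Proof. by move=> me j k; rewrite mxE normcN. Qed.

Lemma mbndBC m m' e : mbnd (m - m') e -> mbnd (m' - m) e.
Proof. by move=> /mbndN; rewrite opprB. Qed.

Lemma mbndD m m' e e' : mbnd m e -> mbnd m' e' -> mbnd (m + m') (e + e').
Proof.
move=> me me' j k; rewrite mxE; apply: le_trans (le_normcD _ _) _.
by rewrite lerD.
Qed.

Lemma mbndB m m' e e' : mbnd m e -> mbnd m' e' -> mbnd (m - m') (e + e').
Proof. by move=> me /mbndN; exact: mbndD. Qed.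

Lemma mbndZ z m e : mbnd m e -> mbnd (z *: m) (normc z * e).
Proof. by move=> me j k; rewrite mxE normcM ler_wpM2l ?normc_ge0. Qed.

Lemma mulmx2E m m' j k : (m * m') j k = m j 0 * m' 0 k + m j 1 * m' 1 k.
Proof.
rewrite mxE !big_ord_recl big_ord0 addr0.
by rewrite (_ : lift ord0 ord0 = 1)//; exact: val_inj.
Qed.

Lemma mbndM m m' e e' : mbnd m e -> mbnd m' e' -> mbnd (m * m') (2 * (e * e')).
Proof.
move=> me me' j k; rewrite mulmx2E; apply: le_trans (le_normcD _ _) _.
rewrite !normcM mulr_natl mulr2n.
by apply: lerD; apply: ler_pM; rewrite ?normc_ge0.
Qed.

Lemma mbnd_tri m m' m'' e e' :
  mbnd (m - m') e -> mbnd (m' - m'') e' -> mbnd (m - m'') (e + e').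
Proof. by move=> h h'; rewrite -(subrKA m'); exact: mbndD. Qed.

Lemma mbndMB m m' n n' M e e' : mbnd m M -> mbnd n' M ->
  mbnd (m - m') e -> mbnd (n - n') e' ->
  mbnd (m * n - m' * n') (2 * (M * (e + e'))).
Proof.
move=> mM nM me ne.
have -> : m * n - m' * n' = m * (n - n') + (m - m') * n'.
  by rewrite mulrBr mulrBl addrA subrK.
have -> : 2 * (M * (e + e')) = 2 * (M * e') + 2 * (e * M) by ring.
by apply: mbndD; apply: mbndM.
Qed.

Lemma mbnd_small_eq0 m : (forall e, 0 < e -> mbnd m e) -> m = 0.
Proof.
move=> h; apply/matrixP => j k; rewrite mxE; apply: normc_le0.
by apply/ler_addgt0Pr => e e0; rewrite add0r; exact: h.
Qed.

Definition mstar m : 'M[C]_2 := \matrix_(j, k) conjc (m k j).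

Lemma normcJ_eq z : normc (conjc z) = normc z.
Proof. by case: z => a b /=; rewrite sqrrN. Qed.

Lemma mbnd_star m e : mbnd m e -> mbnd (mstar m) e.
Proof. by move=> me j k; rewrite mxE normcJ_eq. Qed.

Lemma mstarB m m' : mstar (m - m') = mstar m - mstar m'.
Proof. by apply/matrixP => j k; rewrite !mxE rmorphB. Qed.

(* The orthogonal projection onto the line spanned by (1, x). *)
Definition rproj x : 'M[C]_2 := \matrix_(j, k)
  ((1 + x ^+ 2)^-1 * (if j == 0 then 1 else x) * (if k == 0 then 1 else x))%:C%C.

Lemma one_sqr_gt0 x : 0 < 1 + x ^+ 2.
Proof. by rewrite ltr_wpDr ?sqr_ge0. Qed.

(** The squared cosine of the angle between (1, x) and (1, y), that is, the trace of
    [rproj x * rproj y]. *)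
Definition overlap x y : R := (1 + x * y) ^+ 2 / ((1 + x ^+ 2) * (1 + y ^+ 2)).

Lemma rproj_star x : mstar (rproj x) = rproj x.
Proof.
apply/matrixP => j k; rewrite !mxE conjc_real; congr (_)%:C%C; exact: mulrAC.
Qed.

Lemma rproj_sandwich x y : rproj x * rproj y * rproj x = (overlap x y)%:C%C *: rproj x.
Proof.
have x0 := one_sqr_gt0 x; have y0 := one_sqr_gt0 y.
apply/matrixP => j k; rewrite !mulmx2E !mxE/= -!(rmorphM, rmorphD)/=.
congr (real_complex_def _ _).
by rewrite /overlap; case: (j == 0); case: (k == 0) => /=; field;
  rewrite ?(gt_eqF x0) ?(gt_eqF y0).
Qed.

Lemma rproj_sandwichZ z w x y : (z *: rproj x) * (w *: rproj y) * (z *: rproj x) =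
  (z * w * z * (overlap x y)%:C%C) *: rproj x.
Proof.
by rewrite -!(scalerAl, scalerAr) rproj_sandwich !scalerA (mulrC z (z * w)).
Qed.

Lemma rproj_idem x : rproj x * rproj x = rproj x.
Proof.
have x0 := one_sqr_gt0 x.
apply/matrixP => j k; rewrite !mulmx2E !mxE/= -!(rmorphM, rmorphD)/=.
congr (real_complex_def _ _).
by case: (j == 0); case: (k == 0) => /=; field; rewrite ?(gt_eqF x0).
Qed.

(** A corner entry bounded below uniformly in [x] lets the scalar in a multiple of [rproj x] be
    recovered from one entry. The threshold 1 / 4 used later lies below this bound. *)
Lemma rproj00 x : 0 <= x <= 1 -> 1 / 2 <= normc (rproj x 0 0).
Proof.
move=> /andP[x0 x1]; rewrite mxE eqxx !mulr1 normc_real ger0_norm ?invr_ge0 ?addr_ge0 ?sqr_ge0//.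
by rewrite div1r lef_pV2 ?posrE ?one_sqr_gt0//; nra.
Qed.

Lemma rproj_bnd1 x : mbnd (rproj x) 1.
Proof.
have x0 := one_sqr_gt0 x.
move=> j k; rewrite mxE normc_real.
have -> a b c : a^-1 * b * c = (b * c) / a :> R by rewrite -mulrA mulrC.
rewrite normrM [X in _ * X]ger0_norm ?invr_ge0 ?(ltW x0)// ler_pdivrMr// mul1r.
rewrite ler_norml; case: (j == 0); case: (k == 0) => /=; apply/andP; split; nra.
Qed.

Lemma rproj_sub0 x : 0 <= x <= 1 -> mbnd (rproj x - rproj 0) x.
Proof.
move=> /andP[x0 x1]; have xp := one_sqr_gt0 x.
move=> j k; rewrite !mxE -rmorphB normc_real.
have -> a b c e f : a^-1 * b * c - (1 + 0 ^+ 2)^-1 * e * f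
    = (b * c - a * (e * f)) / a + (a / a - 1) * (e * f) :> R.
  by rewrite expr0n/= addr0 invr1; ring.
have xx : (1 + x ^+ 2) / (1 + x ^+ 2) - 1 = 0 by rewrite divff ?gt_eqF// subrr.
rewrite xx mul0r addr0 normrM [X in _ * X]ger0_norm ?invr_ge0 ?(ltW xp)// ler_pdivrMr//.
by rewrite ler_norml; case: (j == 0); case: (k == 0) => /=; apply/andP; split; nra.
Qed.

(** By Lagrange's identity the overlap falls short of 1 by the squared difference divided by a
    number at least 1. Hence overlaps tend to 1 when both arguments tend to 0. *)
Lemma overlap_ge x y : 0 <= x <= 1 -> 0 <= y <= 1 ->
  1 - (x - y) ^+ 2 <= overlap x y.
Proof.
move=> /andP[x0 x1] /andP[y0 y1].
have xp := one_sqr_gt0 x; have yp := one_sqr_gt0 y.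
rewrite ler_pdivlMr ?mulr_gt0//.
have -> : (1 + x * y) ^+ 2 = (1 + x ^+ 2) * (1 + y ^+ 2) - (x - y) ^+ 2 by ring.
rewrite mulrBl mul1r lerD2l lerN2 ler_peMr ?sqr_ge0//.
have := sqr_ge0 x; have := sqr_ge0 y; nra.
Qed.

Lemma overlap_lt1 x y : x != y -> overlap x y < 1.
Proof.
move=> xy; have xp := one_sqr_gt0 x; have yp := one_sqr_gt0 y.
rewrite ltr_pdivrMr ?mulr_gt0// mul1r.
have -> : (1 + x * y) ^+ 2 = (1 + x ^+ 2) * (1 + y ^+ 2) - (x - y) ^+ 2 by ring.
by rewrite ltrBlDr ltrDl lt0r sqr_ge0 andbT expf_neq0// subr_eq0.
Qed.

Lemma overlap_gt0 x y : 0 <= x -> 0 <= y -> 0 < overlap x y.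
Proof.
move=> x0 y0; rewrite /overlap divr_gt0 ?mulr_gt0 ?one_sqr_gt0//.
all: by rewrite ltr_wpDr ?mulr_ge0.
Qed.

(** On [0, 1] a squared difference is at most the absolute difference, which is here below 1 - M. *)
Lemma sqr_sub_lt x y M : 0 <= x <= 1 -> 0 <= y <= 1 -> x < 1 - M -> y < 1 - M ->
  M < 1 - (x - y) ^+ 2.
Proof.
move=> /andP[x0 x1] /andP[y0 y1] xM yM.
have [xy|yx] := leP x y.
  have : 0 <= (y - x) * (1 - (y - x)) by apply: mulr_ge0; lra.
  nra.
have : 0 <= (x - y) * (1 - (x - y)) by apply: mulr_ge0; lra.
nra.
Qed.

Lemma half_lt (e : R) : 0 < e -> exists n, 2^-1 ^+ n < e.
Proof.
move=> e0; exists (Num.bound e^-1); rewrite exprVn -[ltRHS]invrK.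
by rewrite ltf_pV2 ?posrE ?exprn_gt0 ?invr_gt0//; exact: upper_nthrootP.
Qed.

(** The limit is the supremum of the lower estimates [u k - M / 2 ^ k], each of which lies below
    every upper estimate [u l + M / 2 ^ l]. *)
Lemma cauchy_limit_real (u : nat -> R) (M : R) :
  (forall k l, `|u k - u l| <= M * (2^-1 ^+ k + 2^-1 ^+ l)) ->
  exists c, forall k, `|u k - c| <= M * 2^-1 ^+ k.
Proof.
move=> uC; pose S := [set u k - M * 2^-1 ^+ k | k in [set: nat]].
have ub l : ubound S (u l + M * 2^-1 ^+ l).
  move=> _ [k _ <-]; rewrite lerBlDr -addrA -mulrDr (addrC (2^-1 ^+ l)) -lerBlDl.
  by apply: le_trans (uC k l); rewrite ler_norm.
have S0 : S !=set0 by exists (u 0%N - M * 2^-1 ^+ 0), 0%N.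
exists (sup S) => k; rewrite ler_norml; apply/andP; split.
  by rewrite lerBrDl lerBlDr; exact: ge_sup.
rewrite lerBlDr -lerBlDl; apply: ub_le_sup; last by exists k.
by exists (u 0%N + M * 2^-1 ^+ 0); exact: ub.
Qed.

Lemma cauchy_limit (u : nat -> C) (M : R) :
  (forall k l, normc (u k - u l) <= M * (2^-1 ^+ k + 2^-1 ^+ l)) ->
  exists c, forall k, normc (u k - c) <= 2 * M * 2^-1 ^+ k.
Proof.
move=> uC.
have [|a ha] := @cauchy_limit_real (fun k => complex.Re (u k)) M.
  move=> k l; apply: le_trans (uC k l); apply: le_trans (normc_Re _).
  by rewrite raddfB.
have [|b hb] := @cauchy_limit_real (fun k => complex.Im (u k)) M.
  move=> k l; apply: le_trans (uC k l); apply: le_trans (normc_Im _).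
  by rewrite raddfB.
exists (a +i* b)%C => k; apply: le_trans (normc_le_ReIm _) _.
rewrite 2!raddfB/= -mulrA mulr_natl mulr2n lerD//.
Qed.

End Norms.

(** * Block-diagonal operators on ell2 *)

Section Sums.
Variables (R : realType) (I : choiceType).
Local Notation C := (R[i])%type.

Local Notation rsummable h := (summable [set: I] (EFin \o h)).

Lemma rsumD (h1 h2 : I -> R) : rsummable h1 -> rsummable h2 ->
  rsum (fun i => h1 i + h2 i) = rsum h1 + rsum h2.
Proof.
move=> s1 s2; rewrite /rsum.
have p1 := summable_funepos s1; have p2 := summable_funepos s2.
have n1 := summable_funeneg s1; have n2 := summable_funeneg s2.
have ge0 (f : I -> \bar R) i : [set: I] i -> (0 <= f^\+ i)%E by rewrite funepos_ge0.
have ge0' (f : I -> \bar R) i : [set: I] i -> (0 <= f^\- i)%E by rewrite funeneg_ge0.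
have fin (f : I -> \bar R) : (forall i, [set: I] i -> 0 <= f i)%E -> summable [set: I] f ->
    (\esum_(i in [set: I]) f i \is a fin_num)%E.
  by move=> f0; rewrite summableE; under eq_esum do rewrite gee0_abs ?f0//.
(* Positive and negative parts are not additive, but [esumB] accepts any difference of nonnegative
   summable families: here the two positive parts together minus the two negative parts together. *)
have := @esumB _ _ setT _ _ (summableD p1 p2) (summableD n1 n2).
have -> : (((EFin \o h1)^\+ \+ (EFin \o h2)^\+) \- ((EFin \o h1)^\- \+ (EFin \o h2)^\-))%E
    = EFin \o (fun i => h1 i + h2 i) :> (I -> \bar R).
  apply/funext => i; rewrite /= funeposE funenegE funeposE funenegE/=.
  rewrite -!EFin_max -!EFinD; congr EFin; rewrite /Num.max.
  by repeat case: ifP => ?; lra.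
move=> ->; [|by move=> i _ /=; rewrite adde_ge0 ?ge0 ?ge0'..].
rewrite !esumD//; try by move=> i; rewrite ?ge0 ?ge0'.
rewrite -[in LHS](fineK (fin _ (ge0 _) p1)) -[in LHS](fineK (fin _ (ge0 _) p2)).
rewrite -[in LHS](fineK (fin _ (ge0' _) n1)) -[in LHS](fineK (fin _ (ge0' _) n2)).
rewrite -[in RHS](fineK (fin _ (ge0 _) p1)) -[in RHS](fineK (fin _ (ge0 _) p2)).
rewrite -[in RHS](fineK (fin _ (ge0' _) n1)) -[in RHS](fineK (fin _ (ge0' _) n2)) /=.
ring.
Qed.

Lemma rsum_reindex (h : I -> R) (s : I -> I) : bijective s ->
  rsum (h \o s) = rsum h.
Proof.
move=> bs; rewrite /rsum.
have sb : set_bij [set: I] [set: I] s by rewrite setTT_bijective.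
rewrite (reindex_esum [set: I] [set: I] s (EFin \o h)^\+%E sb).
rewrite (reindex_esum [set: I] [set: I] s (EFin \o h)^\-%E sb).
by congr (fine (_ - _)%E); apply: eq_esum => i _; rewrite ?funeposE ?funenegE.
Qed.

Definition csummable (h : I -> C) :=
  (\esum_(i in [set: I]) (normc (h i))%:E < +oo)%E.

Lemma csummable_Re h : csummable h -> rsummable (fun i => complex.Re (h i)).
Proof.
by apply: le_lt_trans; apply: le_esum => i _ /=; rewrite lee_fin normc_Re.
Qed.

Lemma csummable_Im h : csummable h -> rsummable (fun i => complex.Im (h i)).
Proof.
by apply: le_lt_trans; apply: le_esum => i _ /=; rewrite lee_fin normc_Im.
Qed.

Lemma csumD h1 h2 : csummable h1 -> csummable h2 ->
  csum (fun i => h1 i + h2 i) = csum h1 + csum h2.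
Proof.
move=> s1 s2; rewrite /csum.
have -> : (fun i => complex.Re (h1 i + h2 i)) =
  (fun i => complex.Re (h1 i) + complex.Re (h2 i)).
  by apply/funext => i; rewrite raddfD.
have -> : (fun i => complex.Im (h1 i + h2 i)) =
  (fun i => complex.Im (h1 i) + complex.Im (h2 i)).
  by apply/funext => i; rewrite raddfD.
rewrite (rsumD (csummable_Re s1) (csummable_Re s2)).
by rewrite (rsumD (csummable_Im s1) (csummable_Im s2)).
Qed.

Lemma csum_reindex (h : I -> C) (s : I -> I) : bijective s ->
  csum (h \o s) = csum h.
Proof.
move=> bs; rewrite /csum; congr Complex.
  exact: (rsum_reindex (fun i => complex.Re (h i)) bs).
exact: (rsum_reindex (fun i => complex.Im (h i)) bs).
Qed.

Lemma normc_sq (z : C) : normc z ^+ 2 = sqmod z.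
Proof. by rewrite -normc_sqmod sqr_sqrtr// sqmod_ge0. Qed.

Lemma csummable_mul (f g : I -> C) : (sqsum f < +oo)%E -> (sqsum g < +oo)%E ->
  csummable (fun i => f i * (g i)^*%C).
Proof.
move=> sf sg; apply: (@le_lt_trans _ _ (sqsum f + sqsum g)%E); last first.
  exact: lte_add_pinfty.
rewrite -esumD; [|by move=> i _; rewrite lee_fin sqmod_ge0..].
apply: le_esum => i _; rewrite -EFinD lee_fin normcM normcJ_eq -!normc_sq.
by have := normc_ge0 (f i); have := normc_ge0 (g i); nra.
Qed.

End Sums.

(** * Norm estimates for vectors and operators *)

Section Ell2Facts.
Variables (R : realType) (I : choiceType).
Local Notation C := (R[i])%type.
Local Notation H := (ell2 R I).
Local Notation B := (bop R I).
Implicit Types (f g : H) (T : B).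

Lemma sqsum_fin f : sqsum f \is a fin_num.
Proof. by rewrite ge0_fin_numE ?sqsum_ge0 ?ell2P. Qed.

Lemma l2norm_sq f : l2norm f ^+ 2 = fine (sqsum f).
Proof. by rewrite sqr_sqrtr// fine_ge0// sqsum_ge0. Qed.

Lemma l2norm_le f (M : R) : 0 <= M -> (sqsum f <= (M ^+ 2)%:E)%E -> l2norm f <= M.
Proof.
move=> M0 h; rewrite -(@ler_pXn2r _ 2)// ?nnegrE ?l2norm_ge0//.
by rewrite l2norm_sq -lee_fin fineK// sqsum_fin.
Qed.

Lemma l2norm_coord f i : normc (f i) <= l2norm f.
Proof.
rewrite -(@ler_pXn2r _ 2)// ?nnegrE ?l2norm_ge0 ?normc_ge0//.
rewrite l2norm_sq normc_sq -lee_fin fineK ?sqsum_fin//.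
rewrite -(@esum_set1 R I i (fun i => (sqmod (f i))%:E)) ?lee_fin ?sqmod_ge0//.
rewrite esum_mkcond; apply: le_esum => j _.
by case: ifP => // _; rewrite lee_fin sqmod_ge0.
Qed.

Lemma l2norm_eq0 f : l2norm f <= 0 -> f = 0.
Proof.
move=> f0; apply/val_inj/funext => i; apply: normc_le0.
exact: le_trans (l2norm_coord f i) f0.
Qed.

Definition delta_fun (i : I) : I -> C := fun k => if k == i then 1 else 0.

Lemma delta_sqsum i : sqsum (delta_fun i) = 1%E.
Proof.
rewrite -(@esum_set1 R I i (fun=> 1%E))// esum_mkcond; apply: eq_esum => j _.
rewrite /delta_fun; case: (eqVneq j i) => [->|ji].
  by rewrite mem_set//= /sqmod/= expr1n expr0n addr0.
by rewrite memNset//=; [rewrite /sqmod/= expr0n addr0|exact/eqP].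
Qed.

Lemma delta_subproof i : delta_fun i \in @ell2_pred R I.
Proof. by apply/asboolP; rewrite delta_sqsum ltry. Qed.
Definition delta i : H := Ell2 (delta_subproof i).

Lemma l2norm_delta i : l2norm (delta i) <= 1.
Proof. by apply: l2norm_le => //; rewrite delta_sqsum expr1n. Qed.

Lemma opnorm_ub1 T f : l2norm f <= 1 -> l2norm (T f) <= opnorm T.
Proof.
move=> f1; apply: ub_le_sup; last by exists f.
have [M M0 TM] := bop_bounded T; exists M => _ [g /= g1 <-].
by apply: le_trans (TM g) _; rewrite ler_piMr.
Qed.

Lemma opnorm_ge0 T : 0 <= opnorm T.
Proof.
apply: le_trans (l2norm_ge0 (T 0)) _; apply: opnorm_ub1.
by apply: l2norm_le => //; rewrite /sqsum esum1// => i _; rewrite /sqmod/= expr0n addr0.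
Qed.

Lemma opnorm_ub T f : l2norm (T f) <= opnorm T * l2norm f.
Proof.
have := l2norm_ge0 f; rewrite le_eqVlt => /predU1P[f0|f0].
  have [M M0 TM] := bop_bounded T; apply: le_trans (TM f) _.
  by rewrite -f0 !mulr0.
have nf : normc ((l2norm f)%:C%C) = l2norm f by rewrite normc_real ger0_norm ?ltW.
have nf' : normc ((l2norm f)%:C%C^-1) = (l2norm f)^-1 by rewrite normcV nf.
pose g := (l2norm f)%:C%C^-1 *: f.
have fE : f = (l2norm f)%:C%C *: g.
  rewrite /g scalerA divff ?scale1r//.
  by apply/eqP => h0; move: nf; rewrite h0 normc0 => h1; rewrite -h1 ltxx in f0.
have g1 : l2norm g <= 1.
  apply: le_trans (l2normZ_le _ _) _.
  by rewrite normc_sqmod nf' mulVf// gt_eqF.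
rewrite {1}fE linearZ; apply: le_trans (l2normZ_le _ _) _.
rewrite normc_sqmod nf mulrC; apply: ler_wpM2r; first exact: ltW.
exact: opnorm_ub1.
Qed.

Lemma opnorm_le T M : 0 <= M -> (forall f, l2norm (T f) <= M * l2norm f) ->
  opnorm T <= M.
Proof.
move=> M0 TM; apply: ge_sup.
  by exists (l2norm (T 0)), 0 => //=; apply: l2norm_le => //;
    rewrite /sqsum esum1// => i _; rewrite /sqmod/= expr0n addr0.
by move=> _ [f /= f1 <-]; apply: le_trans (TM f) _; rewrite ler_piMr.
Qed.

(** The factor 2 comes from [l2normD_le]; with the factor 2 of [op_norm] it explains the fractions
    of [e] chosen in later estimates. *)
Lemma opnormD S T : opnorm (S + T : B) <= 2 * (opnorm S + opnorm T).
Proof.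
apply: opnorm_le => [|f]; first by rewrite mulr_ge0// addr_ge0 ?opnorm_ge0.
apply: le_trans (l2normD_le (S f) (T f)) _.
by rewrite -mulrA ler_wpM2l// mulrDl lerD// opnorm_ub.
Qed.

Lemma opnorm_eq0 T : (forall e, 0 < e -> opnorm T <= e) -> T = 0.
Proof.
move=> T0; apply: bopP => f; apply: l2norm_eq0; apply/ler_addgt0Pr => e e0.
rewrite add0r; apply: le_trans (opnorm_ub T f) _.
have l0 : 0 < l2norm f + 1 by rewrite ltr_wpDl ?l2norm_ge0.
apply: (@le_trans _ _ (e / (l2norm f + 1) * l2norm f)).
  by rewrite ler_wpM2r ?l2norm_ge0// T0// divr_gt0.
by rewrite -mulrA ler_piMr ?(ltW e0)// mulrC ler_pdivrMr// mul1r lerDl.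
Qed.

End Ell2Facts.

(** * The block-diagonal operator of a bounded matrix-valued function *)

Section BlockOperators.
Variables (R : realType) (I : choiceType) (Z : Type) (phi : Z * 'I_2 -> I).
Hypothesis phi_inj : injective phi.
Local Notation C := (R[i])%type.
Local Notation H := (ell2 R I).
Local Notation B := (bop R I).
Local Notation M2 := ('M[C]_2).
Local Notation V := (Z -> M2).
Implicit Types (f g : H) (T : B) (a b : V) (e : R).

Definition bnd a e := forall z, mbnd (a z) e.
Definition bounded a := exists e, bnd a e.
Definition vstar a : V := fun z => mstar (a z).

Lemma bnd_le a e e' : e <= e' -> bnd a e -> bnd a e'.
Proof. by move=> ee' ae z; apply: mbnd_le (ae z). Qed.

Lemma bndD a b e e' : bnd a e -> bnd b e' -> bnd (a + b) (e + e').
Proof. by move=> ae be z; apply: mbndD. Qed.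

Lemma bndZ c a e : bnd a e -> bnd (c *: a) (normc c * e).
Proof. by move=> ae z; apply: mbndZ. Qed.

Lemma bndN a e : bnd a e -> bnd (- a) e.
Proof. by move=> ae z; apply: mbndN. Qed.

Lemma bndM a b e e' : bnd a e -> bnd b e' -> bnd (a * b) (2 * (e * e')).
Proof. by move=> ae be z; apply: mbndM. Qed.

Lemma bnd_star a e : bnd a e -> bnd (vstar a) e.
Proof. by move=> ae z; apply: mbnd_star. Qed.

Lemma bnd0 e : 0 <= e -> bnd 0 e.
Proof. by move=> e0 z; apply: mbnd0. Qed.

Lemma bndBC a b e : bnd (a - b) e -> bnd (b - a) e.
Proof. by move=> h z; apply: mbndBC; apply: h. Qed.

Lemma bnd_tri a b c e e' :
  bnd (a - b) e -> bnd (b - c) e' -> bnd (a - c) (e + e').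
Proof. by move=> ha hb z; apply: mbnd_tri (ha z) (hb z). Qed.

Lemma boundedD a b : bounded a -> bounded b -> bounded (a + b).
Proof. by move=> [e ae] [e' be]; exists (e + e'); apply: bndD. Qed.

Lemma boundedZ c a : bounded a -> bounded (c *: a).
Proof. by move=> [e ae]; exists (normc c * e); apply: bndZ. Qed.

Lemma boundedN a : bounded a -> bounded (- a).
Proof. by move=> [e ae]; exists e; apply: bndN. Qed.

Lemma boundedM a b : bounded a -> bounded b -> bounded (a * b).
Proof. by move=> [e ae] [e' be]; exists (2 * (e * e')); apply: bndM. Qed.

Lemma bounded_star a : bounded a -> bounded (vstar a).
Proof. by move=> [e ae]; exists e; apply: bnd_star. Qed.

Lemma bounded0 : bounded 0.
Proof. by exists 0; apply: bnd0. Qed.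

Lemma bounded_pos a : bounded a -> exists2 e, 0 < e & bnd a e.
Proof.
move=> [e ae]; exists (Num.max e 1); first by rewrite lt_max ltr01 orbT.
by apply: bnd_le ae; rewrite le_max lexx.
Qed.

Definition decode (i : I) : option (Z * 'I_2) :=
  if pselect (exists p, phi p = i) is left h then Some (projT1 (cid h)) else None.

Lemma decodeK p : decode (phi p) = Some p.
Proof.
rewrite /decode; case: pselect => [h|[]]; last by exists p.
by congr Some; apply: phi_inj; case: (cid h).
Qed.

Lemma decodeP i p : decode i = Some p -> i = phi p.
Proof. by rewrite /decode; case: pselect => // h [<-]; case: (cid h). Qed.

(** A 2 x 2 block acts by its diagonal entries plus its off-diagonal entries after an exchange of
    the two coordinates. Block-diagonal operators are thus built from multiplications and one
    involution of the index set, which preserves [sqsum]. *)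
Definition flip (i : I) : I :=
  if decode i is Some (z, j) then phi (z, rev_ord j) else i.

Lemma flipK : involutive flip.
Proof.
move=> i; rewrite {2}/flip; case E: (decode i) => [[z j]|].
  by rewrite /flip decodeK rev_ordK (decodeP E).
by rewrite /flip E.
Qed.

Lemma flip_bij : bijective flip.
Proof. by exists flip; exact: flipK. Qed.

Definition diag a i : C := if decode i is Some (z, j) then a z j j else 0.
Definition offdiag a i : C :=
  if decode i is Some (z, j) then a z j (rev_ord j) else 0.

Lemma normc_diag a e i : bnd a e -> 0 <= e -> normc (diag a i) <= e.
Proof. by move=> ae e0; rewrite /diag; case: decode => [[z j]|]; rewrite ?normc0//; apply: ae. Qed.

Lemma normc_offdiag a e i : bnd a e -> 0 <= e -> normc (offdiag a i) <= e.
Proof.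
by move=> ae e0; rewrite /offdiag; case: decode => [[z j]|]; rewrite ?normc0//; apply: ae.
Qed.

Lemma sqsum_mul_le (u h : I -> C) e : 0 <= e -> (forall i, normc (u i) <= e) ->
  (sqsum (fun i => u i * h i)%R <= (e ^+ 2)%:E * sqsum h)%E.
Proof.
move=> e0 ue; have := sqsumZ_le (e%:C)%C h.
rewrite -(normc_sq (e%:C)%C) normc_real real_normK ?num_real//; apply: le_trans.
apply: le_esum => i _; rewrite lee_fin -!normc_sq !normcM normc_real.
rewrite ler_pXn2r ?nnegrE ?mulr_ge0 ?normc_ge0//.
by rewrite ler_wpM2r ?normc_ge0// ger0_norm.
Qed.

Lemma sqsum_flip (h : I -> C) : sqsum (h \o flip) = sqsum h.
Proof.
have sb : set_bij [set: I] [set: I] flip by rewrite setTT_bijective; exact: flip_bij.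
by rewrite /sqsum (reindex_esum [set: I] [set: I] flip (fun i => (sqmod (h i))%:E) sb).
Qed.

Definition opf a (h : I -> C) : I -> C :=
  fun i => diag a i * h i + offdiag a i * h (flip i).

Lemma opf_sqsum a e (h : I -> C) : bnd a e -> 0 <= e ->
  (sqsum (opf a h) <= (4 * e ^+ 2)%:E * sqsum h)%E.
Proof.
move=> ae e0; apply: le_trans (sqsumD_le (fun i => diag a i * h i)
  (fun i => offdiag a i * h (flip i))) _.
have h1 := @sqsum_mul_le (diag a) h e e0 (fun i => normc_diag i ae e0).
have h2 := @sqsum_mul_le (offdiag a) (h \o flip) e e0 (fun i => normc_offdiag i ae e0).
rewrite sqsum_flip in h2.
have -> : ((4 * e ^+ 2)%:E * sqsum h = 2%:E * ((e ^+ 2)%:E * sqsum h + (e ^+ 2)%:E * sqsum h))%E.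
  rewrite -ge0_muleDl ?lee_fin ?sqr_ge0// -EFinD muleA -EFinM; congr (_%:E * _)%E.
  ring.
by apply: lee_wpmul2l; rewrite ?lee_fin// leeD.
Qed.

Lemma opf_subproof a f : bounded a -> opf a f \in @ell2_pred R I.
Proof.
move=> /bounded_pos[e e0 ae]; apply/asboolP.
apply: le_lt_trans (opf_sqsum f ae (ltW e0)) _.
by rewrite -(fineK (sqsum_fin f)) -EFinM ltry.
Qed.

Definition opl a (h : bounded a) f : H := Ell2 (opf_subproof f h).

Lemma opl_norm a (h : bounded a) e f : bnd a e -> 0 <= e ->
  l2norm (opl h f) <= 2 * e * l2norm f.
Proof.
move=> ae e0; apply: l2norm_le; first by rewrite !mulr_ge0// l2norm_ge0.
apply: le_trans (opf_sqsum f ae e0) _.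
rewrite exprMn l2norm_sq [in leRHS]EFinM fineK ?sqsum_fin//.
by rewrite exprMn -natrX.
Qed.

Lemma opl_subproof a (h : bounded a) : (opl h : H -> H) \in @bop_pred R I.
Proof.
apply/asboolP; split=> [c f g|].
  apply/val_inj/funext => i.
  change (diag a i * (c * f i + g i) + offdiag a i * (c * f (flip i) + g (flip i)) =
    c * (diag a i * f i + offdiag a i * f (flip i)) + (diag a i * g i + offdiag a i * g (flip i))).
  ring.
have [e e0 ae] := bounded_pos h.
by exists (2 * e) => f; apply: opl_norm => //; exact: ltW.
Qed.

Definition op a : B :=
  if pselect (bounded a) is left h then Bop (opl_subproof h) else 0.

Lemma opE a f i : bounded a -> op a f i = opf a f i.
Proof. by rewrite /op; case: pselect. Qed.

Lemma op_norm a e : bnd a e -> 0 <= e -> opnorm (op a) <= 2 * e.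
Proof.
move=> ae e0; rewrite /op; case: pselect => [h|[]]; last by exists e.
apply: opnorm_le; first by rewrite mulr_ge0.
by move=> f; apply: opl_norm.
Qed.

Lemma op_ext T a : bounded a -> (forall f i, T f i = opf a f i) -> T = op a.
Proof.
move=> ba h; apply: bopP => f; apply/val_inj/funext => i.
by rewrite -[RHS]/(op a f i) opE//; exact: h.
Qed.

Lemma opD a b : bounded a -> bounded b -> op (a + b) = op a + op b.
Proof.
move=> ba bb; symmetry; apply: op_ext; first exact: boundedD.
move=> f i; change (((op a f) + (op b f) : H) i = opf (a + b) f i).
rewrite ell2DE fctE !opE// /opf /diag /offdiag.
case: (decode i) => [[z j]|]; last by rewrite !mul0r !addr0.
rewrite !fctE !mxE; ring.
Qed.

Lemma opZ c a : bounded a -> op (c *: a) = c *: op a.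
Proof.
move=> ba; symmetry; apply: op_ext; first exact: boundedZ.
move=> f i; change (c * (op a f) i = opf (c *: a) f i).
rewrite !opE// /opf /diag /offdiag.
case: (decode i) => [[z j]|]; last by rewrite !mul0r !addr0 mulr0.
rewrite !fctE !mxE; ring.
Qed.

Lemma op0 : op 0 = 0.
Proof. by rewrite -(scale0r (0 : V)) opZ ?scale0r//; exact: bounded0. Qed.

Lemma opN a : bounded a -> op (- a) = - op a.
Proof. by move=> ba; rewrite -scaleN1r opZ// scaleN1r. Qed.

Lemma opB a b : bounded a -> bounded b -> op (a - b) = op a - op b.
Proof. by move=> ba bb; rewrite opD ?opN//; exact: boundedN. Qed.

Lemma ord2P (P : 'I_2 -> Prop) : P 0 -> P 1 -> forall j, P j.
Proof.
by move=> P0 P1 [[|[|//]] h]; [have -> : Ordinal h = 0 by exact: val_inj|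
  have -> : Ordinal h = 1 by exact: val_inj].
Qed.

Lemma rev_ord2_0 : rev_ord (0 : 'I_2) = 1. Proof. exact: val_inj. Qed.
Lemma rev_ord2_1 : rev_ord (1 : 'I_2) = 0. Proof. exact: val_inj. Qed.

Lemma opM a b : bounded a -> bounded b -> op (a * b) = op a * op b.
Proof.
move=> ba bb; symmetry; apply: op_ext; first exact: boundedM.
move=> f i; change (op a (op b f) i = opf (a * b) f i).
rewrite opE// /opf !opE// /opf /diag /offdiag flipK.
rewrite /flip; case: (decode i) => [[z j]|]; last by rewrite !mul0r !addr0.
rewrite decodeK !fctE; move: j; apply: ord2P; rewrite !(rev_ord2_0, rev_ord2_1) !mulmx2E; ring.
Qed.

Lemma op_entry a (z : Z) (j k : 'I_2) : bounded a ->
  op a (delta R (phi (z, k))) (phi (z, j)) = a z j k.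
Proof.
move=> ba; rewrite opE// /opf /diag /offdiag /flip decodeK /= /delta_fun.
have eqE j' k' : (phi (z, j') == phi (z, k')) = (j' == k').
  by apply/eqP/eqP => [/phi_inj[]|->].
rewrite !eqE; move: j k; do 2!apply: ord2P;
  by rewrite ?(rev_ord2_0, rev_ord2_1) /= ?mulr0 ?mulr1 ?addr0 ?add0r.
Qed.

(** Together with [op_norm] this makes the operator norm equivalent to the entrywise bound [bnd], so
    closures and distances can be computed with functions. *)
Lemma op_lb a e : bounded a -> opnorm (op a) <= e -> bnd a e.
Proof.
move=> ba ae z j k; rewrite -(op_entry z j k ba).
apply: le_trans (l2norm_coord _ _) _; apply: le_trans ae.
by apply: opnorm_ub1; exact: l2norm_delta.
Qed.

Lemma op_inj a b : bounded a -> bounded b -> op a = op b -> a = b.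
Proof.
move=> ba bb ab; apply/funext => z; apply/matrixP => j k.
by rewrite -(op_entry z j k ba) ab op_entry.
Qed.

(** The limit function is read off from the matrix entries of [T] at basis vectors; it is then shown
    to represent [T]. *)
Lemma op_limit T (A : set V) : A `<=` bounded ->
  (forall e, 0 < e -> exists2 a, A a & opnorm (T - op a) < e) ->
  exists b, [/\ bounded b, T = op b &
    forall e, 0 < e -> exists2 a, A a & bnd (b - a) e].
Proof.
move=> Ab TA.
pose b : V := fun z => \matrix_(j, k) T (delta R (phi (z, k))) (phi (z, j)).
have bE a e : A a -> opnorm (T - op a) < e -> bnd (b - a) e.
  move=> Aa ae z j k; rewrite !fctE !mxE -(op_entry z j k (Ab _ Aa)).
  apply: le_trans (ltW ae); apply: le_trans (opnorm_ub1 _ (l2norm_delta R (phi (z, k)))).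
  exact: (l2norm_coord ((T - op a) (delta R (phi (z, k)))) (phi (z, j))).
have bA e : 0 < e -> exists2 a, A a & bnd (b - a) e.
  by move=> /TA[a Aa ae]; exists a => //; exact: bE.
have bb : bounded b.
  have [a Aa ba] := bA 1 ltr01; have [e ae] := Ab _ Aa.
  by exists (1 + e); rewrite -(subrK a b); exact: bndD.
exists b; split=> //; apply/eqP; rewrite -subr_eq0; apply/eqP.
apply: opnorm_eq0 => e e0.
have e6 : 0 < e / 6 by rewrite divr_gt0.
have [a Aa ae] := TA _ e6.
have -> : T - op b = (T - op a) + op (a - b).
  by rewrite opB ?addrA ?subrK//; exact: Ab.
apply: le_trans (opnormD _ _) _.
have h : opnorm (op (a - b)) <= 2 * (e / 6).
  by apply: op_norm; rewrite ?(ltW e6)//; apply: bndBC; exact: bE.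
have := ltW ae; lra.
Qed.

Lemma op_adjoint a : bounded a -> is_adjoint (op a) (op (vstar a)).
Proof.
move=> ba f g; rewrite /inner.
have bs := bounded_star ba.
have [e e0 ae] := bounded_pos ba.
have fin (h : H) := ell2P h.
have sm (u h : I -> C) : (forall i, normc (u i) <= e) -> (sqsum h < +oo)%E ->
    (sqsum (fun i => u i * h i)%R < +oo)%E.
  move=> ue hf; apply: le_lt_trans (sqsum_mul_le _ (ltW e0) ue) _.
  have := sqsum_ge0 h; case: (sqsum h) hf => [r| |]//= _ _.
  by rewrite -EFinM ltry.
have ff : (sqsum (f \o flip) < +oo)%E by rewrite sqsum_flip.
have gf : (sqsum (g \o flip) < +oo)%E by rewrite sqsum_flip.
have se := bnd_star ae.
transitivity (csum (fun i => (diag a i * f i) * (g i)^*%C) +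
              csum (fun i => (offdiag a i * f (flip i)) * (g i)^*%C)).
  rewrite -csumD; last 2 first.
  - apply: (@csummable_mul R I (fun i => diag a i * f i)) => //.
    by apply: sm => // i; exact: normc_diag ae (ltW e0).
  - apply: (@csummable_mul R I (fun i => offdiag a i * f (flip i))) => //.
    by apply: (sm _ (f \o flip)) => // i; exact: normc_offdiag ae (ltW e0).
  by congr csum; apply/funext => i; rewrite opE// /opf mulrDl.
(* Reindexing by [flip] moves the exchange of coordinates from [f] to [g]. *)
rewrite -(csum_reindex (fun i => (offdiag a i * f (flip i)) * (g i)^*%C) flip_bij).
rewrite -csumD; last 2 first.
- apply: (@csummable_mul R I (fun i => diag a i * f i)) => //.
  by apply: sm => // i; exact: normc_diag ae (ltW e0).
- have -> : (fun i => (offdiag a i * f (flip i)) * (g i)^*%C) \o flip =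
    (fun i => (offdiag a (flip i) * f i) * ((g \o flip) i)^*%C).
    by apply/funext => i /=; rewrite flipK.
  apply: (@csummable_mul R I (fun i => offdiag a (flip i) * f i)) => //.
  by apply: sm => // i; exact: normc_offdiag ae (ltW e0).
congr csum; apply/funext => i /=; rewrite opE// /opf flipK rmorphD !rmorphM.
rewrite mulrDr; congr (_ + _).
  rewrite /diag; case: (decode i) => [[z j]|]; last by rewrite rmorph0 !mul0r mulr0.
  by rewrite mxE /= conjcK mulrCA mulrA.
rewrite /offdiag /flip; case E: (decode i) => [[z j]|].
  by rewrite decodeK mxE /= conjcK rev_ordK mulrCA mulrA.
by rewrite E rmorph0 !mul0r mulr0.
Qed.

End BlockOperators.

(** * From algebras of functions to algebras of operators *)

Section FunctionAlgebras.
Variables (R : realType) (I : choiceType) (Z : Type) (phi : Z * 'I_2 -> I).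
Hypothesis phi_inj : injective phi.
Local Notation C := (R[i])%type.
Local Notation B := (bop R I).
Local Notation V := (Z -> 'M[C]_2).
Local Notation op := (op phi_inj).
Implicit Types (a b p : V) (A : set V).

Record fun_alg A : Prop := {
  fa_bounded : A `<=` @bounded R Z;
  fa0 : A 0;
  faD : forall a b, A a -> A b -> A (a + b);
  faZ : forall (c : C) a, A a -> A (c *: a);
  faM : forall a b, A a -> A b -> A (a * b);
  fa_star : forall a, A a -> A (vstar a);
  fa_closed : forall a, (forall e, 0 < e -> exists2 b, A b & bnd (a - b) e) -> A a
}.

Record fun_ideal A (J : set V) : Prop := {
  fi_sub : J `<=` A;
  fi0 : J 0;
  fiD : forall a b, J a -> J b -> J (a + b);
  fiZ : forall (c : C) a, J a -> J (c *: a);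
  fiMl : forall a b, A a -> J b -> J (a * b);
  fiMr : forall a b, A a -> J b -> J (b * a);
  fi_closed : forall a, A a ->
    (forall e, 0 < e -> exists2 b, J b & bnd (a - b) e) -> J a
}.

Lemma fun_alg_Cstar A : fun_alg A -> Cstar_subalgebra (op @` A).
Proof.
move=> [Ab A0 AD AZ AM As Ac]; split.
- by exists 0 => //; exact: op0.
- move=> _ _ [a Aa <-] [b Ab' <-]; exists (a + b); first exact: AD.
  by apply: opD; exact: Ab.
- move=> c _ [a Aa <-]; exists (c *: a); first exact: AZ.
  by apply: opZ; exact: Ab.
- move=> _ _ [a Aa <-] [b Ab' <-]; exists (a * b); first exact: AM.
  by apply: opM; exact: Ab.
- move=> _ [a Aa <-]; exists (op (vstar a)); first by exists (vstar a) => //; exact: As.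
  by apply: op_adjoint; exact: Ab.
- move=> T TA; have [|b [bb -> bA]] := op_limit (phi_inj := phi_inj) (T := T) Ab.
    by move=> e /TA[_ [a Aa <-] ae]; exists a.
  by exists b => //; exact: Ac.
Qed.

Lemma coset_eq (J : set B) (S T : B) :
  (forall U W, J U -> J W -> J (U + W)) -> (forall (c : C) U, J U -> J (c *: U)) ->
  J (S - T) -> coset J S = coset J T.
Proof.
move=> JD JZ ST.
have JN U : J U -> J (- U) by rewrite -scaleN1r; exact: JZ.
apply/seteqP; split=> U; rewrite /coset /=.
  by move=> US; rewrite -(subrKA S); exact: JD.
by move=> UT; rewrite -(subrKA T) -(opprB S T); apply: JD => //; exact: JN.
Qed.

(** An ideal of operators pulls back along [op] to an ideal of functions, and the minimal projection
    of the quotient is obtained from a genuine projection of the function algebra. *)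
Lemma fun_alg_scattered A : fun_alg A ->
  (forall J, fun_ideal A J -> (exists2 a, A a & ~ J a) ->
    exists p, [/\ A p, p * p = p, vstar p = p, ~ J p &
      forall a, A a -> exists c : C, J (p * a * p - c *: p)]) ->
  scattered (op @` A).
Proof.
move=> AA h J [Jsub J0 JD JZ JMl JMr Jc] JneA.
have [Ab A0 AD AZ AM As Ac] := AA.
pose j : set V := fun a => A a /\ J (op a).
have [||p [Ap pp ps nJp pap]] := h j.
- split.
  + by move=> a [].
  + by split=> //; rewrite op0.
  + by move=> a b [Aa Ja] [Ab' Jb]; split; [exact: AD|rewrite opD; [exact: JD|exact: Ab|exact: Ab]].
  + by move=> c a [Aa Ja]; split; [exact: AZ|rewrite opZ; [exact: JZ|exact: Ab]].
  + move=> a b Aa [Ab' Jb]; split; first exact: AM.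
    by rewrite opM; [apply: JMl => //; exists a|exact: Ab|exact: Ab].
  + move=> a b Aa [Ab' Jb]; split; first exact: AM.
    by rewrite opM; [apply: JMr => //; exists a|exact: Ab|exact: Ab].
  + move=> a Aa aJ; split=> //; apply: Jc => e e0.
    have e4 : 0 < e / 4 by rewrite divr_gt0.
    have [b [Ab' Jb] ab] := aJ _ e4; exists (op b) => //.
    rewrite -opB; [|exact: Ab|exact: Ab].
    by apply: le_lt_trans (op_norm phi_inj ab (ltW e4)) _; lra.
- apply: contrapT => nA; apply: JneA; apply/seteqP; split => // _ [a Aa <-].
  by apply: contrapT => nJ; apply: nA; exists a => // -[].
have bp : bounded p := Ab _ Ap.
have nJ : ~ J (op p) by move=> Jp; apply: nJp.
exists (op p); split.
- by exists p.
- by move=> E; have : coset J 0 (op p);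
    [rewrite -E /coset /= subrr|rewrite /coset /= subr0].
- by rewrite -opM// pp.
- by exists (op p) => //; rewrite -{2}ps; exact: op_adjoint.
apply/seteqP; split=> [_ [_ [a Aa <-] <-]|_ [c _ <-]].
  have ba := Ab _ Aa.
  have [c [_ Jc']] := pap _ Aa; exists c => //; apply/esym/coset_eq => //.
  rewrite -opM// -opM//; last exact: boundedM.
  rewrite -opZ// -opB//; [exact: boundedM (boundedM bp ba) bp|exact: boundedZ].
exists (c *: op p); first by exists (c *: p); [exact: AZ|exact: opZ].
by rewrite bop_scaleAr bop_scaleAl -opM// pp -opM// pp.
Qed.

(** The [n + 1] powers lie in the span of [n] elements, so their coefficient rows are dependent.
    Powers start at the first because [D] may lack the identity. *)
Lemma finite_dim_dependent (D : set B) (g : B) :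
  (forall S T, D S -> D T -> D (S * T)) -> finite_dim D -> D g ->
  exists N (d : 'I_N -> C), (exists j, d j != 0) /\
    \sum_j d j *: g ^+ j.+1 = 0.
Proof.
move=> DM [n [b DE]] Dg.
have Dj j : D (g ^+ j.+1).
  by elim: j => [|j IH]; [rewrite expr1|rewrite exprS; exact: DM].
have cP (j : 'I_n.+1) : {c : 'I_n -> C | g ^+ j.+1 = \sum_(i < n) c i *: b i}.
  by apply: cid; have := Dj j; rewrite DE.
pose M : 'M[C]_(n.+1, n) := \matrix_(j, i) sval (cP j) i.
have : kermx M != 0.
  by rewrite kermx_eq0 /row_free neq_ltn ltnS rank_leq_col.
move=> /rowV0Pn[v /sub_kermxP vM v0].
exists n.+1, (fun j => v 0 j); split.
  by apply: contrapT => nex; move/eqP: v0; apply; apply/rowP => j; rewrite mxE;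
    apply: contrapT => /eqP vj; apply: nex; exists j.
transitivity (\sum_(j < n.+1) \sum_(i < n) (v 0 j * M j i) *: b i).
  apply: eq_bigr => j _; rewrite (svalP (cP j)) scaler_sumr.
  by apply: eq_bigr => i _; rewrite scalerA mxE.
rewrite exchange_big big1// => i _; rewrite -scaler_suml.
by have /rowP/(_ i) := vM; rewrite !mxE => ->; rewrite scale0r.
Qed.

Lemma bounded_exp a n : bounded a -> bounded (a ^+ n.+1).
Proof. by move=> ba; elim: n => [|n IH]; [rewrite expr1|rewrite exprS; exact: boundedM]. Qed.

(** Only positive exponents: [op 1] is the projection onto the coordinates in the range of [phi], in
    general not the identity. *)
Lemma opX a n : bounded a -> op (a ^+ n.+1) = op a ^+ n.+1.
Proof.
move=> ba; elim: n => [|n IH]; first by rewrite !expr1.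
by rewrite exprS opM// ?IH -?exprS//; exact: bounded_exp.
Qed.

Lemma bounded_sum N (F : 'I_N -> V) : (forall j, bounded (F j)) -> bounded (\sum_j F j).
Proof.
by move=> Fb; elim/big_ind: _ => //; [exact: bounded0|exact: boundedD].
Qed.

Lemma op_sum N (F : 'I_N -> V) : (forall j, bounded (F j)) ->
  op (\sum_j F j) = \sum_j op (F j).
Proof.
move=> Fb; suff [] : bounded (\sum_j F j) /\ op (\sum_j F j) = \sum_j op (F j) by [].
elim/big_ind2: _ => [|x1 x2 y1 y2 [b1 <-] [b2 <-]|i _]; last by [].
- by split; [exact: bounded0|exact: op0].
- by split; [exact: boundedD|rewrite opD].
Qed.

(** The approximants are chosen once for every index, before any pair is considered, so that their
    exceptional sets depend on one index only. Directedness then puts any two of them into one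
    finite-dimensional algebra. *)
Lemma AF_dependent A (L : Type) (p : L -> V) (e : R) : fun_alg A ->
  (forall u, A (p u)) -> 0 < e -> AF (op @` A) ->
  exists a : L -> V, (forall u, A (a u) /\ bnd (a u - p u) e) /\
    forall u v, exists N (d : 'I_N -> C), (exists j, d j != 0) /\
      \sum_j d j *: (a u * a v * a u) ^+ j.+1 = 0.
Proof.
move=> AA Ap e0 [F [FD F0 Fdir [_ Fdense]]].
have [Ab A0 AD AZ AM As Ac] := AA.
have aP u : {aD : V * set B | [/\ A aD.1, bnd (aD.1 - p u) e, F aD.2 & aD.2 (op aD.1)]}.
  apply: cid; have [|S [D FDD DS] Sp] := Fdense (op (p u)) _ _ e0; first by exists (p u).
  have [_ DA _] := FD _ FDD; have [a Aa aS] := DA _ DS.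
  exists (a, D); split=> //=; last by rewrite aS.
  apply: bndBC; apply: (op_lb (phi_inj := phi_inj)).
    by apply: boundedD; [|apply: boundedN]; exact: Ab.
  by rewrite opB; [rewrite aS ltW|exact: Ab|exact: Ab].
exists (fun u => (sval (aP u)).1); split=> [u|u v].
  by have [] := svalP (aP u).
move: (svalP (aP u)) (svalP (aP v)); set a := (sval (aP u)).1; set b := (sval (aP v)).1.
move=> [Aa _ Fu Da] [Ab' _ Fv Db].
have [D3 [FD3 s1 s2]] := Fdir _ _ Fu Fv.
have [[_ _ _ DM _ _] _ fd] := FD _ FD3.
have ba : bounded a := Ab _ Aa; have bb : bounded b := Ab _ Ab'.
have bg : bounded (a * b * a) by apply: boundedM => //; exact: boundedM.
have Dg : D3 (op (a * b * a)).
  rewrite (opM _ (boundedM ba bb) ba) (opM _ ba bb).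
  exact: DM (DM _ _ (s1 _ Da) (s2 _ Db)) (s1 _ Da).
have [N [d [dn0 ds]]] := finite_dim_dependent DM fd Dg.
exists N, d; split=> //; apply: (op_inj (phi_inj := phi_inj)).
- by apply: bounded_sum => j; apply: boundedZ; exact: bounded_exp.
- exact: bounded0.
rewrite op_sum; last by move=> j; apply: boundedZ; exact: bounded_exp.
rewrite op0 -[RHS]ds; apply: eq_bigr => j _.
by rewrite opZ ?opX//; exact: bounded_exp.
Qed.

(** Each [u] selects an element of [D] within 1 / 16 of its projection. A common choice for two
    indices would put the projections within 2 (1 / 16 + 1 / 16) = 1 / 4 of each other, the factor 2
    being that of [opnormD]. *)
Lemma dense_card_ge A (L : Type) (Q : set L) (p : L -> V) (D : set B) :
  fun_alg A -> (forall u, A (p u)) ->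
  (forall u v, Q u -> Q v -> u <> v -> ~ bnd (p u - p v) (1 / 4)) ->
  norm_dense_in (op @` A) D -> Q #<= D.
Proof.
have q : 2 * (1 / 16 + 1 / 16) <= 1 / 4 :> R by lra.
move=> AA Ap sep [DA Dd].
have [Ab A0 AD AZ AM As Ac] := AA.
have e0 : (0 : R) < 1 / 16 by rewrite divr_gt0.
have aP u : {S : B | D S & opnorm (op (p u) - S) < 1 / 16}.
  by apply: cid2; apply: Dd => //; exists (p u).
pose f u := s2val (aP u).
have inj : {in Q &, injective f}.
  move=> u v /set_mem Qu /set_mem Qv uv; apply: contrapT => /(sep _ _ Qu Qv); apply.
  apply: (op_lb (phi_inj := phi_inj)).
    by apply: boundedD; [|apply: boundedN]; exact: Ab.
  rewrite opB; [|exact: Ab|exact: Ab].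
  rewrite -(subrKA (f u)); apply: le_trans (opnormD _ _) _.
  have h1 := s2valP' (aP u); have h2 := s2valP' (aP v).
  rewrite -/(f u) in h1; rewrite -/(f v) -uv in h2.
  have h3 : opnorm (f u - op (p v)) <= 1 / 16.
    apply: opnorm_le => [|g]; first exact: ltW.
    apply: le_trans (_ : opnorm (op (p v) - f u) * l2norm g <= _); last first.
      by apply: ler_wpM2r; [exact: l2norm_ge0|exact: ltW].
    have -> : (f u - op (p v)) g = (-1) *: (op (p v) - f u) g.
      by rewrite -[RHS]/((-1 *: (op (p v) - f u)) g) scaleN1r opprB.
    apply: le_trans (l2normZ_le _ _) _.
    by rewrite normc_sqmod normcN normc1 mul1r opnorm_ub.
  apply: (le_trans (ler_wpM2l (ler0n _ 2) (lerD (ltW h1) h3))).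
  exact: q.
rewrite -(card_le_eql (inj_card_eq inj)).
by apply: subset_card_le => _ [u _ <-]; exact: (s2valP (aP u)).
Qed.

End FunctionAlgebras.

(** * Lifting functions through homomorphisms modulo finite sets *)

Section AlmostAll.
Variable Z : Type.
Implicit Types P Q : set Z.

Definition ae P := finite_set (~` P).

Lemma aeW P : (forall z, P z) -> ae P.
Proof. by move=> h; rewrite /ae (_ : P = setT) ?setCT//; apply/seteqP; split. Qed.

Lemma aeS P Q : (forall z, P z -> Q z) -> ae P -> ae Q.
Proof. by move=> h; apply: sub_finite_set => z /= nQ /h. Qed.

Lemma aeI P Q : ae P -> ae Q -> ae (fun z => P z /\ Q z).
Proof. by rewrite /ae => fP fQ; rewrite setCI finite_setU. Qed.

Lemma ae2 P1 P2 Q : ae P1 -> ae P2 -> (forall z, P1 z -> P2 z -> Q z) -> ae Q.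
Proof. by move=> h1 h2 h; apply: aeS (aeI h1 h2) => z []; exact: h. Qed.

Lemma ae3 P1 P2 P3 Q : ae P1 -> ae P2 -> ae P3 ->
  (forall z, P1 z -> P2 z -> P3 z -> Q z) -> ae Q.
Proof. by move=> h1 h2 h3 h; apply: (ae2 (aeI h1 h2) h3) => z []; exact: h. Qed.

Lemma ae_lt n (P : nat -> set Z) : (forall j, (j < n)%N -> ae (P j)) ->
  ae (fun z => forall j, (j < n)%N -> P j z).
Proof.
elim: n => [|n IH] h; first exact: aeW.
apply: (ae2 (IH (fun j jn => h j (ltnW jn))) (h n (leqnn _))) => z h1 h2 j.
by rewrite ltnS leq_eqVlt => /predU1P[->//|]; exact: h1.
Qed.

Lemma ae_seq (T : eqType) (s : seq T) (P : T -> set Z) :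
  (forall t, t \in s -> ae (P t)) -> ae (fun z => forall t, t \in s -> P t z).
Proof.
elim: s => [|t s IH] h; first exact: aeW.
have h1 : ae (P t) by apply: h; rewrite mem_head.
have h2 : forall t, t \in s -> ae (P t) by move=> t' t's; apply: h; rewrite inE t's orbT.
by apply: (ae2 h1 (IH h2)) => z Pt Ps t'; rewrite inE => /predU1P[->//|]; exact: Ps.
Qed.

Lemma ae_fin (T : finType) (P : T -> set Z) :
  (forall t, ae (P t)) -> ae (fun z => forall t, P t z).
Proof.
move=> h; apply: aeS (ae_seq (s := enum T) (fun t _ => h t)) => z hz t.
by apply: hz; rewrite mem_enum.
Qed.

End AlmostAll.

Section Lifting.
Variables (X Z : choiceType) (E : set X -> set Z).

(** A choice of representatives for a Boolean homomorphism into sets modulo finite sets. The finite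
    error depends on the arguments, so only finitely many relations can be imposed on [z] at a
    time. *)
Record mod_fin_hom : Prop := {
  mfh0 : ae (fun z => ~ E set0 z);
  mfhU : forall A B, ae (fun z => E (A `|` B) z <-> E A z \/ E B z);
  mfhI : forall A B, ae (fun z => E (A `&` B) z <-> E A z /\ E B z);
  mfhC : forall A, ae (fun z => E (~` A) z <-> ~ E A z)
}.

Hypothesis EH : mod_fin_hom.
Let E0 := mfh0 EH.
Let EU := mfhU EH.
Let EI := mfhI EH.
Let EC := mfhC EH.

Lemma mfh_disjoint A B : A `&` B = set0 -> ae (fun z => E A z -> ~ E B z).
Proof. by move=> AB; have := EI A B; rewrite AB => h; apply: (ae2 h E0) => z; tauto. Qed.

Lemma mfh_subset A B : A `<=` B -> ae (fun z => E A z -> E B z).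
Proof. by move=> /setIidl AB; have := EI A B; rewrite AB; apply: aeS => z; tauto. Qed.

Lemma mfh_seq (s : seq X) :
  ae (fun z => E [set` s] z -> exists2 x, x \in s & E [set x] z).
Proof.
elim: s => [|x s IH]; first by rewrite set_nil; apply: aeS E0 => z h /h.
have -> : [set` x :: s] = [set x] `|` [set` s].
  by apply/seteqP; split=> y /=; rewrite inE; [move=> /predU1P[]; [left|right]|
    case=> [->|->]; rewrite ?eqxx ?orbT].
apply: (ae2 IH (EU [set x] [set` s])) => z h1 -> [h|/h1[x' x's h]].
  by exists x; rewrite ?mem_head.
by exists x' => //; rewrite inE x's orbT.
Qed.

(** [E] may fail to respect countable unions, so infinitely many [z] can escape all the sets
    obtained from the fibres of [k]; these get [None], read as the value infinity. The least value
    settles the finite overlaps of these sets. *)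
Definition liftk (k : X -> nat) (z : Z) : option nat :=
  if pselect (exists j, `[< E [set x | k x = j] z >]) is left h
  then Some (ex_minn h) else None.

Lemma liftkP k j : ae (fun z => liftk k z = Some j <-> E [set x | k x = j] z).
Proof.
have h : ae (fun z => forall i, (i < j)%N -> E [set x | k x = i] z -> ~ E [set x | k x = j] z).
  apply: ae_lt => i ij; apply: mfh_disjoint; apply/seteqP; split => // x [/= -> ji].
  by rewrite ji ltnn in ij.
apply: aeS h => z hz; rewrite /liftk; case: pselect => [ex|nex]; last first.
  by split=> // Ej; case: nex; exists j; apply/asboolP.
case: ex_minnP => m /asboolP Em mmin; split=> [[<-]//|Ej]; congr Some.
apply/eqP; rewrite eqn_leq mmin ?andTb; last exact/asboolP.
by rewrite leqNgt; apply/negP => /hz /(_ Em).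
Qed.

(** Merging all values from [M] on with infinity leaves finitely many classes, so that relations up
    to finite sets can be imposed on all of them at once. *)
Definition trunc M (o : option nat) : 'I_M.+1 :=
  inord (if o is Some j then minn j M else M).

Lemma liftk_trunc k M (v : 'I_M.+1) :
  ae (fun z => trunc M (liftk k z) = v <-> E [set x | trunc M (Some (k x)) = v] z).
Proof.
have tr j (w : 'I_M.+1) : trunc M (Some j) = w <-> minn j M = w.
  rewrite /trunc; split=> [<-|jw]; first by rewrite inordK// ltnS geq_minr.
  by apply: val_inj; rewrite /= inordK// ltnS geq_minr.
have [vM|vM] := ltnP v M.
  have -> : [set x | trunc M (Some (k x)) = v] = [set x | k x = v].
    apply/seteqP; split=> x /=; rewrite tr; last by move=> ->; apply/minn_idPl/ltnW.
    by rewrite /minn; case: ltnP => // _ Mv; move: vM; rewrite -{1}Mv ltnn.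
  apply: aeS (liftkP k v) => z <-; case: (liftk k z) => [j|].
    rewrite tr; split=> [|[->]]; last exact/minn_idPl/ltnW.
    by rewrite /minn; case: ltnP => [_ ->//|_ Mv]; move: vM; rewrite -{1}Mv ltnn.
  split=> // /(congr1 val)/=; rewrite inordK// => Mv.
  by move: vM; rewrite -{1}Mv ltnn.
(* The top class is the complement of the finite union of the fibres below [M], and [E] respects
   this description up to a finite set. *)
have {vM}vM : v = M :> nat by apply/eqP; rewrite eqn_leq vM andbT; exact: ltn_ord v.
have h j : (j < M)%N -> ae (fun z => (liftk k z = Some j <-> E [set x | k x = j] z) /\
    (E [set x | k x = j] z -> E [set x | (k x < M)%N] z)).
  by move=> jM; apply: aeI (liftkP k j) _; apply: mfh_subset => x /= ->.
have sub n : (n <= M)%N ->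
   ae (fun z => E [set x | (k x < n)%N] z -> exists2 j, (j < n)%N & E [set x | k x = j] z).
  elim: n => [_|n IH nM]; first by
    rewrite (_ : [set x | _] = set0); [apply: aeS E0 => z h1 /h1|apply/seteqP; split].
  have -> : [set x | (k x < n.+1)%N] = [set x | (k x < n)%N] `|` [set x | k x = n].
    apply/seteqP; split=> x /=; first by rewrite ltnS leq_eqVlt => /predU1P[]; tauto.
    by case=> [/ltnW|->].
  apply: (ae2 (IH (ltnW nM)) (EU _ _)) => z h1 -> [/h1[j jn Ej]|En].
    by exists j => //; exact: ltnW.
  by exists n.
have -> : [set x | trunc M (Some (k x)) = v] = ~` [set x | (k x < M)%N].
  apply/seteqP; split=> x /=; rewrite tr vM.
    by move=> /minn_idPr; rewrite leqNgt => /negP.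
  by move=> /negP; rewrite -leqNgt => /minn_idPr.
apply: (ae3 (ae_lt h) (sub M (leqnn M)) (EC _)) => z h1 h2 ->.
split=> [tv /h2[j jM Ej]|nE].
  have [/iffRL/(_ Ej) E' _] := h1 j jM; move: tv; rewrite E' tr vM /minn jM => jE.
  by rewrite jE ltnn in jM.
case E' : (liftk k z) => [j|].
  rewrite tr vM; apply/minn_idPr; rewrite leqNgt; apply/negP => jM.
  by have [/iffLR/(_ E') h3 h4] := h1 j jM; apply/nE/h4.
by apply: val_inj; rewrite /= inordK.
Qed.

(** A transfer principle. Of the finitely many triples of classes, each one that does not occur on
    [A] corresponds to an empty intersection, which [E] sends to a finite set. Relations between
    three functions on [X] thus reach almost all [z] in [E A], up to truncation. *)
Lemma liftk_trunc3 k1 k2 k3 M (A : set X) :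
  ae (fun z => E A z -> exists x, [/\ A x,
    trunc M (liftk k1 z) = trunc M (Some (k1 x)),
    trunc M (liftk k2 z) = trunc M (Some (k2 x)) &
    trunc M (liftk k3 z) = trunc M (Some (k3 x))]).
Proof.
pose F (k : X -> nat) (v : 'I_M.+1) := [set x | trunc M (Some (k x)) = v].
have h (v : 'I_M.+1 * 'I_M.+1 * 'I_M.+1) :
    ae (fun z => E A z -> trunc M (liftk k1 z) = v.1.1 ->
      trunc M (liftk k2 z) = v.1.2 -> trunc M (liftk k3 z) = v.2 ->
      exists x, [/\ A x, F k1 v.1.1 x, F k2 v.1.2 x & F k3 v.2 x]).
  have [ex|nex] := pselect (exists x, [/\ A x, F k1 v.1.1 x, F k2 v.1.2 x & F k3 v.2 x]).
    exact: aeW.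
  have h0 : A `&` (F k1 v.1.1 `&` (F k2 v.1.2 `&` F k3 v.2)) = set0.
    by apply/seteqP; split => // x [? [? [? ?]]]; case: nex; exists x; split.
  have := EI A (F k1 v.1.1 `&` (F k2 v.1.2 `&` F k3 v.2)); rewrite h0 => i1.
  have i2 := EI (F k1 v.1.1) (F k2 v.1.2 `&` F k3 v.2).
  have i3 := EI (F k2 v.1.2) (F k3 v.2).
  have t1 := liftk_trunc k1 v.1.1; have t2 := liftk_trunc k2 v.1.2.
  have t3 := liftk_trunc k3 v.2.
  have {i1}i1 := aeI i1 E0; have {i2 i3}i2 := aeI i2 i3.
  have {t1 t2}t1 := aeI t1 t2.
  apply: (ae2 (aeI i1 i2) (aeI t1 t3)) => z [[[_ j1] n0] [[_ j2] [_ j3]]].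
  move=> [[[s1 _] [s2 _]] [s3 _]] EA /s1 e1 /s2 e2 /s3 e3; case: n0; apply: j1.
  by split=> //; apply: j2; split=> //; apply: j3.
apply: aeS (ae_fin h) => z hz EAz.
have [//|//|//|x [Ax x1 x2 x3]] :=
  hz (trunc M (liftk k1 z), trunc M (liftk k2 z), trunc M (liftk k3 z)) EAz.
by exists x.
Qed.

Lemma liftk_point k x : ae (fun z => E [set x] z -> liftk k z = Some (k x)).
Proof.
have h : [set x] `<=` [set x' | k x' = k x] by move=> _ ->.
by apply: (ae2 (mfh_subset h) (liftkP k (k x))) => z h1 h2 /h1/h2.
Qed.

Lemma mfh_point_neq x x' : x <> x' -> ae (fun z => E [set x] z -> ~ E [set x'] z).
Proof.
move=> xx'; apply: mfh_disjoint; apply/seteqP; split => // y [-> h]; exact: xx'.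
Qed.

End Lifting.

(** * Closed spans and their quotients *)

Section ClosedSpan.
Variables (R : realType) (Z : Type).
Local Notation C := (R[i])%type.
Local Notation V := (Z -> 'M[C]_2).
Implicit Types (a b p : V) (G J : set V).

Lemma vstarD a b : vstar (a + b) = vstar a + vstar b.
Proof. by apply/funext => z; apply/matrixP => j k; rewrite !mxE rmorphD. Qed.

Lemma vstarZ (c : C) a : vstar (c *: a) = conjc c *: vstar a.
Proof. by apply/funext => z; apply/matrixP => j k; rewrite !mxE rmorphM. Qed.

Lemma vstar0 : vstar (0 : V) = 0.
Proof. by apply/funext => z; apply/matrixP => j k; rewrite !mxE rmorph0. Qed.

Inductive lspan G : V -> Prop :=
| lspan0 : lspan G 0
| lspanS c g a : G g -> lspan G a -> lspan G (c *: g + a).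

Definition clspan G : set V :=
  [set a | forall e : R, 0 < e -> exists2 s, lspan G s & bnd (a - s) e].

Lemma lspan_gen G g : G g -> lspan G g.
Proof.
by move=> Gg; have := lspanS 1 Gg (lspan0 G); rewrite scale1r addr0.
Qed.

Lemma lspanD G a b : lspan G a -> lspan G b -> lspan G (a + b).
Proof.
by elim=> [|c g a' Gg _ IH]; rewrite ?add0r// => /IH h; rewrite -addrA; exact: lspanS.
Qed.

Lemma lspanZ G c a : lspan G a -> lspan G (c *: a).
Proof.
elim=> [|d g a' Gg _ IH]; first by rewrite scaler0; exact: lspan0.
by rewrite scalerDr scalerA; exact: lspanS.
Qed.

Lemma lspan_sum G (T : Type) (s : seq T) (F : T -> V) :
  (forall t, lspan G (F t)) -> lspan G (\sum_(t <- s) F t).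
Proof. by move=> h; elim/big_ind: _ => //; [exact: lspan0|exact: lspanD]. Qed.

Lemma lspan_mono G G' a : G `<=` G' -> lspan G a -> lspan G' a.
Proof.
move=> GG'; elim=> [|c g a' Gg _ IH]; first exact: lspan0.
by apply: lspanS => //; exact: GG'.
Qed.

Lemma lspan_clspan G a : lspan G a -> clspan G a.
Proof. by move=> sa e e0; exists a => //; rewrite subrr; apply: bnd0; exact: ltW. Qed.

Lemma clspan_gen G g : G g -> clspan G g.
Proof. by move=> Gg; apply/lspan_clspan/lspan_gen. Qed.

Lemma clspan_mono G G' : G `<=` G' -> clspan G `<=` clspan G'.
Proof.
by move=> GG' a h e e0; have [s ss as'] := h e e0; exists s => //; exact: lspan_mono ss.
Qed.

Lemma clspan_closed G a :
  (forall e, 0 < e -> exists2 b, clspan G b & bnd (a - b) e) -> clspan G a.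
Proof.
move=> h e e0; have e2 : 0 < e / 2 by rewrite divr_gt0.
have [b cb ab] := h _ e2; have [s ss bs] := cb _ e2.
by exists s => //; rewrite (splitr e); exact: bnd_tri ab bs.
Qed.

Lemma clspanD G a b : clspan G a -> clspan G b -> clspan G (a + b).
Proof.
move=> ca cb e e0; have e2 : 0 < e / 2 by rewrite divr_gt0.
have [s ss as'] := ca _ e2; have [t tt bt] := cb _ e2.
exists (s + t); first exact: lspanD.
by rewrite (splitr e) opprD addrACA; exact: bndD.
Qed.

Lemma clspanZ G c a : clspan G a -> clspan G (c *: a).
Proof.
move=> ca e e0; have n0 : 0 < normc c + 1 by rewrite ltr_wpDl ?normc_ge0.
have [s ss as'] := ca (e / (normc c + 1)) (divr_gt0 e0 n0).
exists (c *: s); first exact: lspanZ.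
rewrite -scalerBr; apply: bnd_le (bndZ c as').
rewrite mulrA ler_pdivrMr// mulrC ler_wpM2l ?(ltW e0)//.
by rewrite lerDl.
Qed.

Lemma clspan0 G : clspan G 0. Proof. exact/lspan_clspan/lspan0. Qed.

Lemma lspan_bounded G a : G `<=` @bounded R Z -> lspan G a -> bounded a.
Proof.
move=> Gb; elim=> [|c g a' Gg _ IH]; first exact: bounded0.
by apply: boundedD => //; apply: boundedZ; exact: Gb.
Qed.

Lemma clspan_bounded G : G `<=` @bounded R Z -> clspan G `<=` @bounded R Z.
Proof.
move=> Gb a ca; have [s ss as'] := ca 1 ltr01.
rewrite -(subrK s a); apply: boundedD; first by exists 1.
exact: lspan_bounded ss.
Qed.

Lemma vmulZl (c : C) a b : (c *: a) * b = c *: (a * b).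
Proof. by apply/funext => z; rewrite !fctE -scalerAl. Qed.

Lemma vmulZr (c : C) a b : a * (c *: b) = c *: (a * b).
Proof. by apply/funext => z; rewrite !fctE -scalerAr. Qed.

Lemma clspanM G : G `<=` @bounded R Z ->
  (forall g h, G g -> G h -> clspan G (g * h)) ->
  forall a b, clspan G a -> clspan G b -> clspan G (a * b).
Proof.
move=> Gb GM a b ca cb.
have M1 g s : G g -> lspan G s -> clspan G (g * s).
  move=> Gg; elim=> [|c h s' Gh _ IH]; first by rewrite mulr0; exact: clspan0.
  rewrite mulrDr vmulZr; apply: clspanD => //; apply: clspanZ; exact: GM.
have M2 s t : lspan G s -> lspan G t -> clspan G (s * t).
  move=> + lt; elim=> [|c h s' Gh _ IH]; first by rewrite mul0r; exact: clspan0.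
  rewrite mulrDl vmulZl; apply: clspanD => //; apply: clspanZ; exact: M1.
have [M M0 bM] := bounded_pos (clspan_bounded Gb cb).
apply: clspan_closed => e e0.
have e1 : 0 < e / 2 / (2 * M) by rewrite !divr_gt0// mulr_gt0.
have [s ss as'] := ca _ e1.
have [N N0 sN] := bounded_pos (lspan_bounded Gb ss).
have e2 : 0 < e / 2 / (2 * N) by rewrite !divr_gt0// mulr_gt0.
have [t tt bt] := cb _ e2.
exists (s * t); first exact: M2.
have -> : a * b - s * t = (a - s) * b + s * (b - t).
  by rewrite mulrBl mulrBr addrA subrK.
rewrite (splitr e); apply: bndD.
  have -> : e / 2 = 2 * (e / 2 / (2 * M) * M).
    by field; rewrite gt_eqF.
  exact: bndM.
have -> : e / 2 = 2 * (N * (e / 2 / (2 * N))) by field; rewrite gt_eqF.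
exact: bndM.
Qed.

Lemma clspan_star G : (forall g, G g -> lspan G (vstar g)) ->
  forall a, clspan G a -> clspan G (vstar a).
Proof.
move=> Gs a ca e e0; have [s ss as'] := ca e e0.
exists (vstar s).
  elim: ss => [|c g s' Gg _ IH]; first by rewrite vstar0; exact: lspan0.
  by rewrite vstarD vstarZ; apply: lspanD => //; apply: lspanZ; exact: Gs.
have -> : vstar a - vstar s = vstar (a - s).
  by apply/funext => z; rewrite !fctE /vstar mstarB.
exact: bnd_star.
Qed.

Lemma clspan_fun_alg G : G `<=` @bounded R Z ->
  (forall g h, G g -> G h -> clspan G (g * h)) ->
  (forall g, G g -> lspan G (vstar g)) -> fun_alg (clspan G).
Proof.
move=> Gb GM Gs; split.
- exact: clspan_bounded.
- exact: clspan0.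
- by move=> a b; exact: clspanD.
- by move=> c a; exact: clspanZ.
- exact: clspanM.
- exact: clspan_star.
- exact: clspan_closed.
Qed.

Lemma clspan_ideal A G J : fun_ideal A J -> clspan G `<=` A -> G `<=` J ->
  clspan G `<=` J.
Proof.
move=> IJ GA GJ a ca; apply: (fi_closed IJ); first exact: GA.
move=> e e0; have [s ss as'] := ca e e0; exists s => //.
elim: ss => [|c g s' Gg _ IH]; first exact: fi0 IJ.
by apply: (fiD IJ) => //; apply: (fiZ IJ); exact: GJ.
Qed.

Lemma fi_N A J a : fun_ideal A J -> J a -> J (- a).
Proof. by move=> IJ Ja; rewrite -scaleN1r; exact: fiZ IJ _ _ Ja. Qed.

(* [J + C p] is closed since [p] has positive distance to [J]. *)
Lemma compression_scalar G J p : fun_alg (clspan G) -> fun_ideal (clspan G) J ->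
  clspan G p -> ~ J p ->
  (forall g, G g -> exists c : C, J (p * g * p - c *: p)) ->
  forall a, clspan G a -> exists c : C, J (p * a * p - c *: p).
Proof.
move=> AA IJ Ap nJp Gc a ca.
(* If no such [d] existed, [p] would be a limit of elements of [J] and hence belong to [J]. *)
have [d d0 dp] : exists2 d : R, 0 < d & forall b, J b -> ~ bnd (p - b) d.
  apply: contrapT => nd; apply: nJp; apply: (fi_closed IJ) => // e e0.
  apply: contrapT => nb; apply: nd; exists e => // b Jb pb; apply: nb.
  by exists b.
have sc s : lspan G s -> exists c : C, J (p * s * p - c *: p).
  elim=> [|c g s' Gg _ [c' h']].
    by exists 0; rewrite mulr0 mul0r scale0r subr0; exact: fi0 IJ.
  have [c1 h1] := Gc _ Gg; exists (c * c1 + c').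
  have -> : p * (c *: g + s') * p - (c * c1 + c') *: p =
    c *: (p * g * p - c1 *: p) + (p * s' * p - c' *: p).
    rewrite mulrDr mulrDl vmulZr vmulZl scalerDl scalerBr scalerA opprD.
    by rewrite addrACA.
  by apply: (fiD IJ) => //; exact: fiZ IJ _ _ h1.
have [B B0 pB] := bounded_pos (fa_bounded AA Ap).
have hn n : (0 : R) < 2^-1 ^+ n by rewrite exprn_gt0// invr_gt0.
have sP n : {sc : V * C | bnd (a - sc.1) (2^-1 ^+ n) & J (p * sc.1 * p - sc.2 *: p)}.
  apply: cid2; have [s ss as'] := ca _ (hn n); have [c Jc] := sc _ ss.
  by exists (s, c).
pose s n := (s2val (sP n)).1; pose u n := (s2val (sP n)).2.
have as' n : bnd (a - s n) (2^-1 ^+ n) := s2valP (sP n).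
have Js n : J (p * s n * p - u n *: p) := s2valP' (sP n).
pose K := 2 * (2 * (B * B)).
have K0 : 0 < K by rewrite !mulr_gt0.
have pxp x e : bnd x e -> bnd (p * x * p) (K * e).
  move=> xe; have -> : K * e = 2 * (2 * (B * e) * B) by rewrite /K; ring.
  exact: bndM (bndM pB xe) pB.
have [|c hc] := @cauchy_limit R u (K / d).
  move=> k l; have [->|ukl] := eqVneq (u k - u l) 0.
    by rewrite normc0 mulr_ge0 ?addr_ge0 ?divr_ge0// ?ltW.
  have n0 : 0 < normc (u k - u l).
    by rewrite lt0r normc_ge0 andbT; apply: contra ukl => /eqP/eq0_normc ->.
  have skl : bnd (s k - s l) (2^-1 ^+ k + 2^-1 ^+ l).
    exact: bnd_tri (bndBC (as' k)) (as' l).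
  pose j := (p * s k * p - u k *: p) - (p * s l * p - u l *: p).
  have Jj : J j by apply: (fiD IJ) => //; exact: fi_N IJ _.
  have jE : (u k - u l) *: p + j = p * (s k - s l) * p.
    by rewrite /j mulrBr mulrBl scalerBl opprB addrCA !subrKA.
  (* Division by [u k - u l] exhibits an element of [J] near [p]; as it cannot come within [d], the
     difference of the scalars is controlled by that of the approximants. *)
  have := bndZ (u k - u l)^-1 (pxp _ _ skl).
  rewrite -jE scalerDr scalerA mulVf// scale1r normcV => h.
  have := dp (- ((u k - u l)^-1 *: j)) (fi_N IJ (fiZ IJ _ Jj)).
  rewrite opprK => nd; rewrite leNgt; apply/negP => lt; apply: nd.
  apply: bnd_le h; rewrite mulrC ler_pdivrMr//.
  rewrite (_ : K * _ = d * (K / d * (2^-1 ^+ k + 2^-1 ^+ l))).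
    by apply: ler_wpM2l; exact: ltW.
  by rewrite mulrA mulrCA divff ?mulr1// gt_eqF.
exists c; apply: (fi_closed IJ).
  apply: (faD AA); first by apply: (faM AA) => //; exact: (faM AA).
  by rewrite -scaleN1r; do 2!apply: (faZ AA).
move=> e e0.
pose K' := K + 2 * (K / d) * B.
have K'0 : 0 < K' by rewrite addr_gt0// !mulr_gt0// invr_gt0.
have [n hn'] := half_lt (divr_gt0 e0 K'0).
exists (p * s n * p - u n *: p) => //.
have -> : p * a * p - c *: p - (p * s n * p - u n *: p) =
    p * (a - s n) * p + (u n - c) *: p.
  rewrite mulrBr mulrBl scalerBl opprB addrACA [RHS]addrACA; congr (_ + _).
  exact: addrC.
apply: (@bnd_le _ _ _ (K * 2^-1 ^+ n + 2 * (K / d) * 2^-1 ^+ n * B)).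
  have -> : K * 2^-1 ^+ n + 2 * (K / d) * 2^-1 ^+ n * B = 2^-1 ^+ n * K'.
    by rewrite /K'; ring.
  by rewrite -ler_pdivlMr// ltW.
apply: bndD; first exact: pxp.
move=> z j k; rewrite fctE mxE normcM; apply: ler_pM; rewrite ?normc_ge0//.
exact: pB.
Qed.

End ClosedSpan.

(** * The algebra of a labelled meet-semilattice of sets *)

Section Codes.

(* The binary number with leading digit 1 followed by the first [n] bits of [i]. *)
Fixpoint code (i : set nat) (n : nat) : nat :=
  if n is m.+1 then (2 * code i m + `[< i m >])%N else 1%N.

Lemma code_gt i n : (n < code i n)%N.
Proof.
elim: n => //= n IH; apply: leq_trans (leq_addr _ _).
by rewrite mul2n -addnn -addn1 leq_add// (leq_ltn_trans _ IH).
Qed.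

(** A code determines the codes of all shorter prefixes, so codes remain different after the first
    bit where the labels differ. *)
Lemma code_neq i j : i <> j -> exists n0, forall n, (n0 <= n)%N -> code i n <> code j n.
Proof.
move=> ij; have inj b b' (m n : nat) :
    (2 * m + (b : bool) = 2 * n + (b' : bool))%N -> m = n /\ b = b'.
  by case: b b' => -[] /=; lia.
have [m im] : exists m, `[< i m >] <> `[< j m >].
  apply: contrapT => nex; apply: ij; apply/funext => m; apply/propext.
  have : `[< i m >] = `[< j m >] by apply: contrapT => h; apply: nex; exists m.
  by move=> h; split=> /asboolP hm; apply/asboolP; rewrite -?h// h.
exists m.+1; elim=> // n IH; rewrite ltnS leq_eqVlt => /predU1P[<- /= /inj[]//|/IH h /= /inj[]//].
Qed.

End Codes.

Section Values.
Variable R : realType.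
Local Notation C := (R[i])%type.

(* [Some 0] stands for a point off the set, and [None] for the limit of the
   values as the code tends to infinity. *)
Definition lproj (o : option nat) : 'M[C]_2 :=
  match o with
  | Some 0%N => 0
  | Some k.+1 => rproj (k.+1%:R^-1)
  | None => rproj 0
  end.

Lemma inv_nat01 k : 0 <= (k.+1%:R^-1 : R) <= 1.
Proof. by rewrite invr_ge0 ler0n/= invf_le1 ?ltr0n// ler1n. Qed.

Lemma lproj_idem o : lproj o * lproj o = lproj o.
Proof. by case: o => [[|k]|] /=; rewrite ?mulr0// rproj_idem. Qed.

Lemma lproj_star o : mstar (lproj o) = lproj o.
Proof.
case: o => [[|k]|] /=; rewrite ?rproj_star//.
by apply/matrixP => i j; rewrite !mxE rmorph0.
Qed.

Lemma lproj_bnd o : mbnd (lproj o) 1.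
Proof. by case: o => [[|k]|] /=; [exact: mbnd0|exact: rproj_bnd1..]. Qed.

Definition lproj_at M (t : 'I_M.+1) : 'M[C]_2 :=
  if (t < M)%N then lproj (Some (t : nat)) else rproj 0.

(** All values with code at least [M] are within 1 / M of [rproj 0], so the truncation class
    determines the projection up to 1 / M. *)
Lemma lproj_trunc M o : (0 < M)%N -> mbnd (lproj o - lproj_at (trunc M o)) M%:R^-1.
Proof.
move=> M0; have Mi : 0 <= (M%:R^-1 : R) by rewrite invr_ge0.
rewrite /lproj_at /trunc; case: o => [j|]; last first.
  by rewrite inordK// ltnn subrr; exact: mbnd0.
rewrite inordK ?ltnS ?geq_minr//; have [jM|Mj] := ltnP j M.
  by rewrite jM subrr; exact: mbnd0.
rewrite ltnn; case: j Mj => [|j] Mj; first by rewrite leqn0 gtn_eqF in Mj.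
apply: mbnd_le (rproj_sub0 (inv_nat01 j)).
by rewrite lef_pV2 ?posrE ?ltr0n// ler_nat.
Qed.

Lemma lproj_code00 i n : 1 / 2 <= normc (lproj (Some (code i n)) 0 0).
Proof.
have := code_gt i n; case: (code i n) => // k _; exact: rproj00 (inv_nat01 k).
Qed.

Lemma delta_sandwich (m : 'M[C]_2) i : delta_mx i i * m * delta_mx i i = m i i *: delta_mx i i.
Proof.
apply/matrixP => j k; rewrite !mulmx2E !mxE.
by move: i j k; do 3!apply: ord2P; rewrite /=; ring.
Qed.

End Values.

(** * The generators, their products and scatteredness *)

Section Core.
Variables (R : realType) (Y Z : choiceType) (L : Type).
Local Notation C := (R[i])%type.
Local Notation X := (Y * nat)%type.
Local Notation V := (Z -> 'M[C]_2).
Variables (S : L -> set Y) (lab : L -> Y -> set nat).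
Variables (meet : L -> L -> L) (lt : L -> L -> Prop).
Variable E : set X -> set Z.
Hypothesis EH : mod_fin_hom E.
(** [E [set x]] is infinite, so a property of almost all of its elements holds somewhere on it. *)
Hypothesis E_inf : forall x, ~ ae (fun z => ~ E [set x] z).
Implicit Types (a b g k : V) (x : X) (u v w : L) (m : 'M[C]_2).

Hypothesis S_meet : forall u v, S (meet u v) = S u `&` S v.
Hypothesis lab_meet : forall u v, finite_set [set y | S (meet u v) y /\
  ~ (lab u y = lab (meet u v) y /\ lab v y = lab (meet u v) y)].
Hypothesis meet_lt : forall u v, meet u v = u \/ lt (meet u v) u.
Hypothesis lt_min : forall Q : set L, Q !=set0 ->
  exists2 u, Q u & forall v, Q v -> ~ lt v u.

Definition point_mass (z : Z) m : V := fun z' => if z' == z then m else 0.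
Definition lift_mass x m : V := fun z => if `[< E [set x] z >] then m else 0.

Definition code_at u x : nat := if `[< S u x.1 >] then code (lab u x.1) x.2 else 0%N.
Definition proj_fun u : V := fun z => lproj R (liftk E (code_at u) z).

(** Below the projections there are two layers of generators: matrix units at a single [z], and
    matrix units spread over the lift of a single point of [X]. [core_scattered] goes through the
    layers in this order. *)
Definition small_gen (t : Z * 'I_2 * 'I_2 + X * 'I_2 * 'I_2) : V :=
  match t with
  | inl (z, i, j) => point_mass z (delta_mx i j)
  | inr (x, i, j) => lift_mass x (delta_mx i j)
  end.
Definition generator (t : Z * 'I_2 * 'I_2 + X * 'I_2 * 'I_2 + L) : V :=
  match t with inl t => small_gen t | inr u => proj_fun u end.

Definition point_gens : set V := [set a | exists z i j, a = point_mass z (delta_mx i j)].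
Definition small_gens : set V := range small_gen.
Definition gens : set V := range generator.

Lemma small_gens_sub : small_gens `<=` gens.
Proof. by move=> _ [t _ <-]; exists (inl t). Qed.

Lemma point_gens_sub : point_gens `<=` small_gens.
Proof. by move=> _ [z [i [j ->]]]; exists (inl (z, i, j)). Qed.

Lemma proj_fun_gens u : gens (proj_fun u). Proof. by exists (inr u). Qed.

Lemma delta_bnd1 i j : mbnd (delta_mx i j : 'M[C]_2) 1.
Proof.
by move=> k l; rewrite mxE; case: (_ && _); rewrite ?normc1 ?normc0.
Qed.

Lemma generator_bnd1 t : bnd (generator t) 1.
Proof.
case: t => [[[[z i] j]|[[x i] j]]|u] z' /=; rewrite /point_mass /lift_mass.
- by case: ifP => _; [exact: delta_bnd1|exact: mbnd0].
- by case: ifP => _; [exact: delta_bnd1|exact: mbnd0].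
- exact: lproj_bnd.
Qed.

Lemma gens_bounded : gens `<=` @bounded R Z.
Proof. by move=> _ [t _ <-]; exists 1; exact: generator_bnd1. Qed.

Lemma mx2_sum m : m = \sum_i \sum_j m i j *: delta_mx i j.
Proof. exact: matrix_sum_delta. Qed.

Lemma point_mass_lspan z m : lspan point_gens (point_mass z m).
Proof.
have -> : point_mass z m = \sum_i \sum_j m i j *: point_mass z (delta_mx i j).
  apply/funext => z'; rewrite fct_sumE; transitivity (\sum_i \sum_j
      m i j *: (if z' == z then delta_mx i j else 0 : 'M[C]_2)).
    rewrite /point_mass; case: ifP => _; first exact: mx2_sum.
    by rewrite big1// => i _; rewrite big1// => j _; rewrite scaler0.
  by apply: eq_bigr => i _; rewrite fct_sumE.
apply: lspan_sum => i; apply: lspan_sum => j; apply/lspanZ/lspan_gen.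
by exists z, i, j.
Qed.

Lemma lift_mass_lspan x m : lspan small_gens (lift_mass x m).
Proof.
have -> : lift_mass x m = \sum_i \sum_j m i j *: lift_mass x (delta_mx i j).
  apply/funext => z'; rewrite fct_sumE; transitivity (\sum_i \sum_j
      m i j *: (if `[< E [set x] z' >] then delta_mx i j else 0 : 'M[C]_2)).
    rewrite /lift_mass; case: ifP => _; first exact: mx2_sum.
    by rewrite big1// => i _; rewrite big1// => j _; rewrite scaler0.
  by apply: eq_bigr => i _; rewrite fct_sumE.
apply: lspan_sum => i; apply: lspan_sum => j; apply/lspanZ/lspan_gen.
by exists (inr (x, i, j)).
Qed.

(** Turns an estimate for almost all [z] into one for all [z], at the cost of finitely many point
    masses. *)
Lemma lspan_finite_correction a (e : R) : 0 <= e -> ae (fun z => mbnd (a z) e) ->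
  exists2 t, lspan point_gens t & bnd (a - t) e.
Proof.
move=> e0 /finite_seqP[q qE].
exists (\sum_(z <- undup q) point_mass z (a z)).
  by apply: lspan_sum => z; exact: point_mass_lspan.
move=> z; rewrite !fctE fct_sumE; have [zq|zq] := boolP (z \in q).
  rewrite (bigD1_seq z) ?mem_undup ?undup_uniq//= {1}/point_mass eqxx big1 ?addr0 ?subrr.
    exact: mbnd0.
  by move=> z' /negbTE z'z; rewrite /point_mass eq_sym z'z.
rewrite big_seq big1 ?subr0; last first.
  move=> z'; rewrite mem_undup => z'q; rewrite /point_mass; case: eqP => // zz'.
  by rewrite zz' z'q in zq.
apply: contrapT => nb; have : [set` q] z by rewrite -qE.
by rewrite /= (negbTE zq).
Qed.

Definition ev_const x a m := ae (fun z => E [set x] z -> a z = m).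

Lemma ev_constD x a b m m' : ev_const x a m -> ev_const x b m' -> ev_const x (a + b) (m + m').
Proof. by move=> h1 h2; apply: (ae2 h1 h2) => z h h' Ez; rewrite fctE h// h'. Qed.

Lemma ev_constN x a m : ev_const x a m -> ev_const x (- a) (- m).
Proof. by apply: aeS => z h Ez; rewrite fctE h. Qed.

Lemma ev_constZ x c a m : ev_const x a m -> ev_const x (c *: a) (c *: m).
Proof. by apply: aeS => z h Ez; rewrite fctE h. Qed.

Lemma ev_constM x a b m m' : ev_const x a m -> ev_const x b m' -> ev_const x (a * b) (m * m').
Proof. by move=> h1 h2; apply: (ae2 h1 h2) => z h h' Ez; rewrite fctE h// h'. Qed.

Lemma ev_const_proj_fun x u : ev_const x (proj_fun u) (lproj R (Some (code_at u x))).
Proof. by apply: aeS (liftk_point EH (code_at u) x) => z h Ez; rewrite /proj_fun h. Qed.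

Lemma ev_const_point_mass x z m : ev_const x (point_mass z m) 0.
Proof.
apply: (@sub_finite_set _ _ [set z]); last exact: finite_set1.
move=> z' /= h; apply: contrapT => zz'; apply: h => _; rewrite /point_mass.
by case: eqP.
Qed.

Lemma ev_const_lift_mass x x' m : ev_const x (lift_mass x' m) (if x == x' then m else 0).
Proof.
case: eqP => [->|xx']; first by apply: aeW => z Ez; rewrite /lift_mass asboolT.
by apply: aeS (mfh_point_neq EH xx') => z h /h Ez; rewrite /lift_mass asboolF.
Qed.

Lemma ev_const_generator x g : gens g -> exists m, ev_const x g m.
Proof.
move=> [[[[[z i] j]|[[x' i] j]]|u] _ <-].
- by exists 0; exact: ev_const_point_mass.
- by eexists; exact: ev_const_lift_mass.
- by eexists; exact: ev_const_proj_fun.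
Qed.

(** The lift of the matrix-valued functions on [X] that vanish at infinity. *)
Definition vanishing : set V := [set k | (forall x, exists m, ev_const x k m) /\
  forall e : R, 0 < e -> exists s : seq X,
    ae (fun z => mbnd (k z) e \/ exists2 x, x \in s & E [set x] z)].

Lemma vanishing_clspan k : vanishing k -> clspan small_gens k.
Proof.
move=> [klim ksm] e e0; have [s0 hs0] := ksm e e0.
pose s := undup s0.
have hs : ae (fun z => mbnd (k z) e \/ exists2 x, x \in s & E [set x] z).
  by apply: aeS hs0 => z [|[x xs Ex]]; [left|right; exists x; rewrite ?mem_undup].
have us : uniq s by exact: undup_uniq.
pose m x := sval (cid (klim x)).
have mP x : ev_const x k (m x) by rewrite /m; case: cid.
pose t := \sum_(x <- s) lift_mass x (m x).
(* The lifts of the points in [s] are disjoint up to finite sets, so for almost all [z] at most one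
   term of [t] is nonzero. *)
have h3 : ae (fun z => forall p, p \in [seq (x, x') | x <- s, x' <- s] ->
    p.1 <> p.2 -> E [set p.1] z -> ~ E [set p.2] z).
  apply: ae_seq => p _; have [pp|pp] := pselect (p.1 = p.2); first exact: aeW.
  by apply: aeS (mfh_point_neq EH pp).
have h2 : ae (fun z => forall x, x \in s -> E [set x] z -> k z = m x).
  by apply: ae_seq => x _; exact: mP.
have kt : ae (fun z => mbnd ((k - t) z) e).
  apply: (ae3 hs h2 h3) => z kz kE dis; rewrite !fctE /t fct_sumE.
  have [[x xs Ex]|nex] := pselect (exists2 x, x \in s & E [set x] z).
    rewrite (bigD1_seq x)//= {1}/lift_mass asboolT// big1_seq ?addr0; last first.
      move=> x' /andP[/eqP x'x x's]; rewrite /lift_mass asboolF//.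
      apply: (dis (x, x')) => //; last exact/nesym.
      by apply/allpairsP; exists (x, x').
    by rewrite (kE x xs Ex) subrr; exact/mbnd0/ltW.
  case: kz => [kz|//]; rewrite big1_seq ?subr0// => x /andP[_ xs].
  by rewrite /lift_mass asboolF// => Ex; apply: nex; exists x.
have [t' lt' ktt'] := lspan_finite_correction (ltW e0) kt.
exists (t + t'); last by rewrite opprD addrA.
apply: lspanD; first by apply: lspan_sum => x; exact: lift_mass_lspan.
by apply: lspan_mono lt'; exact: point_gens_sub.
Qed.

Lemma vanishing_local k (s : seq X) : (forall x, exists m, ev_const x k m) ->
  ae (fun z => k z = 0 \/ exists2 x, x \in s & E [set x] z) -> vanishing k.
Proof.
move=> h hs; split=> // e e0; exists s; apply: aeS hs => z [->|]; last by right.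
by left; exact/mbnd0/ltW.
Qed.

Lemma small_gens_local g : small_gens g ->
  exists s : seq X, ae (fun z => g z = 0 \/ exists2 x, x \in s & E [set x] z).
Proof.
move=> [[[[z i] j]|[[x i] j]] _ <-].
  exists [::]; apply: (@sub_finite_set _ _ [set z]); last exact: finite_set1.
  move=> z' /= h; apply: contrapT => zz'; apply: h; left; rewrite /point_mass.
  by case: eqP.
exists [:: x]; apply: aeW => z; rewrite /= /lift_mass; case: asboolP => Ex; last by left.
by right; exists x; rewrite ?mem_head.
Qed.

(** Truncation determines the projections up to 1 / N, and by transfer the three truncated values at
    [z] are those at a single point [x] of [X]. There the product relation is exact, except over
    label mismatches, where it fails substantially only for small second coordinates. *)
Lemma vanishing_proj_mul u v : vanishing (proj_fun u * proj_fun v - proj_fun (meet u v)).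
Proof.
split=> [x|e e0].
  eexists; apply: ev_constD; first by apply: ev_constM; exact: ev_const_proj_fun.
  by apply: ev_constN; exact: ev_const_proj_fun.
set w := meet u v.
(* With [d = 1 / N] the error is 4 d for truncating the two factors, 5 d for the truncated relation,
   and d for truncating the projection of the meet. *)
pose N := Num.bound (10 / e).
have N0 : 0 < N%:R :> R.
  by apply: le_lt_trans (archi_boundP _); rewrite divr_ge0// ltW.
have N0' : (0 < N)%N by rewrite -(ltr0n R).
have Ne : 10 * N%:R^-1 <= e.
  rewrite ler_pdivrMr// mulrC -ler_pdivrMr//; apply/ltW/archi_boundP.
  by rewrite divr_ge0// ltW.
have [q qE] : exists q : seq Y, [set y | S w y /\
  ~ (lab u y = lab w y /\ lab v y = lab w y)] = [set` q].
  by apply/finite_seqP; exact: lab_meet.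
(* The finitely many points over a label mismatch whose second coordinate is too small to force
   codes above [N]. *)
pose s := [seq (y, n) | y <- q, n <- iota 0 N].
exists s.
have h1 := mfhC EH [set` s]; have h2 := mfh_seq EH s.
have h3 := liftk_trunc3 EH (code_at u) (code_at v) (code_at w) N (~` [set` s]).
apply: (ae3 h1 h2 h3) => z e1 e2 e3.
have [Es|nEs] := pselect (E [set` s] z); first by right; exact: e2.
left; have /e1/e3[x [nsx t1 t2 t3]] := nEs.
rewrite !fctE /proj_fun.
set ou := liftk _ _ _; set ov := liftk _ _ _; set ow := liftk _ _ _.
have v1 := lproj_trunc R ou N0'; have v2 := lproj_trunc R ov N0'; have v3 := lproj_trunc R ow N0'.
have k1 := lproj_trunc R (Some (code_at u x)) N0'.
have k2 := lproj_trunc R (Some (code_at v x)) N0'.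
have k3 := lproj_trunc R (Some (code_at w x)) N0'.
rewrite -/ou in t1; rewrite -/ov in t2; rewrite -/ow in t3.
rewrite -t1 in k1; rewrite -t2 in k2; rewrite -t3 in k3.
set d := N%:R^-1 in v1 v2 v3 k1 k2 k3 Ne.
have vMb t : mbnd (lproj_at R (M := N) t) 1.
  by rewrite /lproj_at; case: ifP => _; [exact: lproj_bnd|exact: rproj_bnd1].
have d0 : 0 <= d by rewrite invr_ge0.
suff h : mbnd (lproj_at R (trunc N ou) * lproj_at R (trunc N ov) - lproj_at R (trunc N ow)) (5 * d).
  have h4 := mbndMB (lproj_bnd R ou) (vMb (trunc N ov)) v1 v2.
  have h5 := mbndD (mbnd_tri h4 h) (mbndN v3).
  apply: mbnd_le (_ : (2 * (1 * (d + d)) + 5 * d) + d <= e) _; first by lra.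
  by move: h5; rewrite opprB addrA subrK.
have exact_case : lproj R (Some (code_at u x)) * lproj R (Some (code_at v x)) =
    lproj R (Some (code_at w x)) ->
    mbnd (lproj_at R (trunc N ou) * lproj_at R (trunc N ov)
          - lproj_at R (trunc N ow)) (5 * d).
  move=> eqv; have h4 := mbndMB (vMb (trunc N ou)) (lproj_bnd R _) (mbndBC k1) (mbndBC k2).
  rewrite eqv in h4; apply: mbnd_le (mbnd_tri h4 k3); lra.
have [Sw|nSw] := pselect (S w x.1); last first.
  apply: exact_case; rewrite /code_at (asboolF nSw).
  move: nSw; rewrite S_meet => /not_andP[nS|nS]; rewrite (asboolF nS)/= ?mul0r//.
  by rewrite mulr0.
have [Su Sv] : S u x.1 /\ S v x.1 by move: Sw; rewrite S_meet.
have [[lu lv]|nl] := pselect (lab u x.1 = lab w x.1 /\ lab v x.1 = lab w x.1).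
  by apply: exact_case; rewrite /code_at !asboolT// lu lv lproj_idem.
(* The remaining points lie over a label mismatch, so being off [s] means a large second coordinate.
   All three truncated values are then [rproj 0]. *)
have xN : (N <= x.2)%N.
  rewrite leqNgt; apply/negP => xN; apply: nsx => /=.
  have : [set` q] x.1 by rewrite -qE.
  case: x xN {t1 t2 t3 k1 k2 k3 exact_case nl Sw Su Sv} => y n /= nN yq.
  have nI : n \in iota 0 N by rewrite mem_iota add0n.
  by apply/allpairsP; exists (y, n); split.
have tN w' : S w' x.1 -> lproj_at R (trunc N (Some (code_at w' x))) = rproj 0.
  move=> Sw'; rewrite /lproj_at /trunc inordK ?ltnS ?geq_minr// /code_at asboolT//.
  have cN := ltn_trans (leq_ltn_trans xN (code_gt (lab w' x.1) x.2)) (ltnSn _).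
  by rewrite (minn_idPr _) ?ltnn// -ltnS.
rewrite t1 t2 t3 !tN// rproj_idem subrr; apply: mbnd0; lra.
Qed.

Lemma gens_mul g h : gens g -> gens h -> clspan gens (g * h).
Proof.
move=> Gg Gh.
have lim x : exists m, ev_const x (g * h) m.
  have [m hm] := ev_const_generator x Gg; have [m' hm'] := ev_const_generator x Gh.
  by exists (m * m'); exact: ev_constM.
have kG k : vanishing k -> clspan gens k.
  by move=> /vanishing_clspan; exact: clspan_mono small_gens_sub _.
case: Gg (Gg) lim => [[t|u] _ <-] Gg lim.
  have [s hs] := small_gens_local (ex_intro2 _ _ t I erefl : small_gens (generator (inl t))).
  apply: kG; apply: (vanishing_local (s := s)) => //.
  by apply: aeS hs => z [h0|]; [left; rewrite fctE h0 mul0r|right].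
case: Gh (Gh) lim => [[t|v] _ <-] Gh lim.
  have [s hs] := small_gens_local (ex_intro2 _ _ t I erefl : small_gens (generator (inl t))).
  apply: kG; apply: (vanishing_local (s := s)) => //.
  by apply: aeS hs => z [h0|]; [left; rewrite fctE h0 mulr0|right].
rewrite /= -(subrK (proj_fun (meet u v)) (proj_fun u * proj_fun v)); apply: clspanD.
  by apply: kG; exact: vanishing_proj_mul.
by apply: clspan_gen; exact: proj_fun_gens.
Qed.

Lemma star_delta i j : mstar (delta_mx i j : 'M[C]_2) = delta_mx j i.
Proof.
apply/matrixP => k l; rewrite !mxE andbC.
by case: (_ && _); rewrite ?rmorph1 ?rmorph0.
Qed.

Lemma mstar0 : mstar (0 : 'M[C]_2) = 0.
Proof. by apply/matrixP => k l; rewrite !mxE rmorph0. Qed.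

Lemma proj_fun_star u : vstar (proj_fun u) = proj_fun u.
Proof. by apply/funext => z; exact: lproj_star. Qed.

Lemma proj_fun_idem u : proj_fun u * proj_fun u = proj_fun u.
Proof. by apply/funext => z; rewrite fctE; exact: lproj_idem. Qed.

Lemma point_mass_star z m : vstar (point_mass z m) = point_mass z (mstar m).
Proof. by apply/funext => z'; rewrite /vstar /point_mass; case: ifP => _ //; exact: mstar0. Qed.

Lemma lift_mass_star x m : vstar (lift_mass x m) = lift_mass x (mstar m).
Proof. by apply/funext => z'; rewrite /vstar /lift_mass; case: ifP => _ //; exact: mstar0. Qed.

Lemma gens_star g : gens g -> lspan gens (vstar g).
Proof.
move=> [[[[[z i] j]|[[x i] j]]|u] _ <-] /=; apply: lspan_gen.
- by exists (inl (inl (z, j, i))) => //; rewrite point_mass_star star_delta.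
- by exists (inl (inr (x, j, i))) => //; rewrite lift_mass_star star_delta.
- by rewrite proj_fun_star; exact: proj_fun_gens.
Qed.

Lemma core_fun_alg : fun_alg (clspan gens).
Proof. exact: clspan_fun_alg gens_bounded gens_mul gens_star. Qed.

(** [J] is compared with the layers in turn, and the first layer not contained in [J] supplies the
    projection. In the two layers of matrix units this is a diagonal unit, since an off-diagonal
    unit outside [J] factors through it. Compressions become scalar because the lower layers already
    lie in [J]. *)
Lemma core_scattered J : fun_ideal (clspan gens) J ->
  (exists2 a, clspan gens a & ~ J a) ->
  exists p, [/\ clspan gens p, p * p = p, vstar p = p, ~ J p &
    forall a, clspan gens a -> exists c : C, J (p * a * p - c *: p)].
Proof.
move=> IJ [a0 Ga0 nJa0].
have AA := core_fun_alg.
have subG Q : Q `<=` gens -> clspan Q `<=` clspan gens := @clspan_mono _ _ Q gens.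
have [[z [i [j nJ]]]|Jd] := pselect (exists z i j, ~ J (point_mass z (delta_mx i j))).
  have Gz i1 j1 : gens (point_mass z (delta_mx i1 j1)) by exists (inl (inl (z, i1, j1))).
  exists (point_mass z (delta_mx i i)); split.
  - exact: clspan_gen.
  - apply/funext => z'; rewrite fctE /point_mass; case: ifP => _; last exact: mulr0.
    by rewrite -[_ * _]/(_ *m _) mul_delta_mx.
  - by rewrite point_mass_star star_delta.
  - move=> Jii; apply: nJ.
    have -> : point_mass z (delta_mx i j) =
        point_mass z (delta_mx i i) * point_mass z (delta_mx i j).
      apply/funext => z'; rewrite fctE /point_mass; case: ifP => _; last by rewrite mulr0.
      by rewrite -[_ * _]/(_ *m _) mul_delta_mx.
    by apply: (fiMr IJ) => //; exact: clspan_gen.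
  - move=> a Aa; exists (a z i i); rewrite [X in J X](_ : _ = 0); first exact: fi0 IJ.
    apply/funext => z'; rewrite !fctE /point_mass; case: eqP => [->|_].
      by rewrite delta_sandwich subrr.
    by rewrite !mul0r scaler0 subrr.
have {}Jd z i j : J (point_mass z (delta_mx i j)).
  by apply: contrapT => nJ; apply: Jd; exists z, i, j.
(* From here on, elements of the algebra that agree for almost all [z] agree modulo [J]. *)
have Gd_J : clspan point_gens `<=` J.
  apply: (clspan_ideal IJ) => [|_ [z [i [j ->]]]//].
  by apply: subG => g /point_gens_sub/small_gens_sub.
have [[x [i [j nJ]]]|Jc] := pselect (exists x i j, ~ J (lift_mass x (delta_mx i j))).
  have Gx i1 j1 : gens (lift_mass x (delta_mx i1 j1)) by exists (inl (inr (x, i1, j1))).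
  have nJp : ~ J (lift_mass x (delta_mx i i)).
    move=> Jii; apply: nJ.
    have -> : lift_mass x (delta_mx i j) = lift_mass x (delta_mx i i) * lift_mass x (delta_mx i j).
      apply/funext => z'; rewrite fctE /lift_mass; case: ifP => _; last by rewrite mulr0.
      by rewrite -[_ * _]/(_ *m _) mul_delta_mx.
    by apply: (fiMr IJ) => //; exact: clspan_gen.
  exists (lift_mass x (delta_mx i i)); split=> //.
  - exact: clspan_gen.
  - apply/funext => z'; rewrite fctE /lift_mass; case: ifP => _; last exact: mulr0.
    by rewrite -[_ * _]/(_ *m _) mul_delta_mx.
  - by rewrite lift_mass_star star_delta.
  - apply: (compression_scalar AA IJ) => //; first exact: clspan_gen.
    move=> g Gg; have [m hm] := ev_const_generator x Gg; exists (m i i); apply: Gd_J.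
    move=> e e0; apply: lspan_finite_correction; first exact: ltW.
    apply: aeS hm => z hz; rewrite !fctE /lift_mass; case: asboolP => [Ez|_].
      by rewrite hz// delta_sandwich subrr; exact/mbnd0/ltW.
    by rewrite !mul0r scaler0 subrr; exact/mbnd0/ltW.
have {}Jc x i j : J (lift_mass x (delta_mx i j)).
  by apply: contrapT => nJ; apply: Jc; exists x, i, j.
have GK_J : clspan small_gens `<=` J.
  apply: (clspan_ideal IJ); first by apply: subG; exact: small_gens_sub.
  by move=> _ [[[[z i] j]|[[x i] j]] _ <-]; [exact: Jd|exact: Jc].
have [|u nJu umin] := lt_min (Q := [set u | ~ J (proj_fun u)]).
  apply: contrapT => h; apply: nJa0; apply: (clspan_ideal IJ) Ga0 => // _ [[t|u] _ <-].
    by apply: GK_J; apply: clspan_gen; exists t.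
  by apply: contrapT => nJ; apply: h; exists u.
exists (proj_fun u); split=> //.
- by apply: clspan_gen; exact: proj_fun_gens.
- exact: proj_fun_idem.
- exact: proj_fun_star.
have Au : clspan gens (proj_fun u) by apply: clspan_gen; exact: proj_fun_gens.
apply: (compression_scalar AA IJ) => // _ [[t|v] _ <-].
  exists 0; rewrite scale0r subr0; apply: (fiMr IJ) => //; apply: (fiMl IJ) => //.
  by apply: GK_J; apply: clspan_gen; exists t.
have Jd' : J (proj_fun u * proj_fun v - proj_fun (meet u v)).
  by apply/GK_J/vanishing_clspan/vanishing_proj_mul.
have E1 : proj_fun u * proj_fun v * proj_fun u =
    (proj_fun u * proj_fun v - proj_fun (meet u v)) * proj_fun u +
    proj_fun (meet u v) * proj_fun u.
  by rewrite mulrBl subrK.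
have [muv|muv] := meet_lt u v.
  exists 1; rewrite /= E1 scale1r muv proj_fun_idem addrK -{2}muv.
  exact: (fiMr IJ).
exists 0; rewrite /= E1 scale0r subr0; apply: (fiD IJ); first exact: (fiMr IJ).
apply: (fiMr IJ) => //; apply: contrapT => nJ; exact: umin nJ muv.
Qed.

(** * Separation, limits along a point, and failure of AF *)

Lemma proj_fun_separated u v : (exists2 y, S u y & ~ S v y) ->
  ~ bnd (proj_fun u - proj_fun v) (1 / 4).
Proof.
move=> [y Suy nSvy] h; apply: (E_inf (x := (y, 0%N))).
apply: (ae2 (ev_const_proj_fun (y, 0%N) u) (ev_const_proj_fun (y, 0%N) v)) => z e1 e2 Ez.
have := h z 0 0; rewrite !fctE e1// e2// /code_at asboolT// (asboolF nSvy) subr0.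
by have := lproj_code00 R (lab u y) 0; lra.
Qed.

(** [ev_const] is lost under norm limits because the finite exceptional sets accumulate; here the
    exceptional set may depend on [e]. *)
Definition lim_at x a m := forall e : R, 0 < e ->
  ae (fun z => E [set x] z -> mbnd (a z - m) e).

Lemma ev_const_lim_at x a m : ev_const x a m -> lim_at x a m.
Proof.
by move=> h e e0; apply: aeS h => z h Ez; rewrite h// subrr; exact/mbnd0/ltW.
Qed.

Lemma lim_at_unique x a m m' : lim_at x a m -> lim_at x a m' -> m = m'.
Proof.
move=> h h'; apply/eqP; rewrite -subr_eq0; apply/eqP/mbnd_small_eq0 => e e0.
have e2 : 0 < e / 2 by rewrite divr_gt0.
apply: contrapT => nb; apply: (E_inf (x := x)).
apply: (ae2 (h _ e2) (h' _ e2)) => z hz hz' Ez; apply: nb.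
by rewrite (splitr e); apply: mbnd_tri (mbndBC (hz Ez)) (hz' Ez).
Qed.

Lemma lim_atD x a b m m' : lim_at x a m -> lim_at x b m' -> lim_at x (a + b) (m + m').
Proof.
move=> h h' e e0; have e2 : 0 < e / 2 by rewrite divr_gt0.
apply: (ae2 (h _ e2) (h' _ e2)) => z hz hz' Ez.
by rewrite (splitr e) fctE opprD addrACA; exact: mbndD (hz Ez) (hz' Ez).
Qed.

Lemma lim_atZ x c a m : lim_at x a m -> lim_at x (c *: a) (c *: m).
Proof.
move=> h e e0; have n0 : 0 < normc c + 1 by rewrite ltr_wpDl ?normc_ge0.
apply: aeS (h _ (divr_gt0 e0 n0)) => z hz Ez; rewrite fctE -scalerBr.
apply: mbnd_le (mbndZ c (hz Ez)).
by rewrite mulrA ler_pdivrMr// mulrC ler_wpM2l ?(ltW e0)// lerDl.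
Qed.

Lemma lim_at_sum x N (a : 'I_N -> V) (m : 'I_N -> 'M[C]_2) :
  (forall j, lim_at x (a j) (m j)) -> lim_at x (\sum_j a j) (\sum_j m j).
Proof.
move=> h; elim/big_ind2: _ => [|a1 m1 a2 m2 h1 h2|j _]; last exact: h.
  by apply: ev_const_lim_at; exact: aeW.
exact: lim_atD.
Qed.

Lemma mx_bounded m : exists2 M : R, 0 < M & mbnd m M.
Proof.
have [|M M0 h] := @bounded_pos R unit (fun=> m).
  exists (\sum_i \sum_j normc (m i j)) => _ i j.
  rewrite (bigD1 i)//= (bigD1 j)//= -addrA lerDl addr_ge0//.
    by rewrite sumr_ge0// => *; exact: normc_ge0.
  by rewrite sumr_ge0// => *; rewrite sumr_ge0// => *; exact: normc_ge0.
by exists M => //; exact: (h tt).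
Qed.

Lemma lim_atM x a b m m' : bounded a -> lim_at x a m -> lim_at x b m' ->
  lim_at x (a * b) (m * m').
Proof.
move=> /bounded_pos[M M0 aM] h h' e e0.
have [M' M'0 mM'] := mx_bounded m'.
pose K := M + M'; have K0 : 0 < K by rewrite addr_gt0.
have e4 : 0 < e / (4 * K) by rewrite divr_gt0// mulr_gt0.
apply: (ae2 (h _ e4) (h' _ e4)) => z hz hz' Ez; rewrite fctE.
have -> : e = 2 * (K * (e / (4 * K) + e / (4 * K))) by field; rewrite gt_eqF.
apply: mbndMB (hz Ez) (hz' Ez).
  by apply: mbnd_le (aM z); rewrite lerDl ltW.
by apply: mbnd_le mM'; rewrite lerDr ltW.
Qed.

Lemma lim_atX x a (c : C) m n : bounded a -> m * m = m -> lim_at x a (c *: m) ->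
  lim_at x (a ^+ n.+1) (c ^+ n.+1 *: m).
Proof.
move=> ba mm h; elim: n => [|n IH]; first by rewrite !expr1.
rewrite exprS [c ^+ _]exprS; have := lim_atM ba h IH.
by rewrite -scalerAl -scalerAr mm scalerA.
Qed.

(* [y] avoids the points and the smaller sets met by the approximants of an
   element close to [proj_fun u]. *)
Definition generic u (W : set L) (D : set Y) y :=
  [/\ S u y, ~ D y & forall w, W w -> ~ S w y].

Lemma generic_sub u W D W' D' y : W `<=` W' -> D `<=` D' ->
  generic u W' D' y -> generic u W D y.
Proof.
by move=> WW' DD' [Su nD nW]; split=> // [/DD'//|w /WW'/nW].
Qed.

(** Only three things happen at a generic point. A matrix unit has value 0 there. A projection whose
    meet with [u] is [u] has the value of [proj_fun u], the finitely many label mismatches having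
    gone into [D]. Any other projection has value 0, its meet with [u] having gone into [W]. *)
Lemma lspan_generic u s : lspan gens s -> exists (c : C) W D,
  [/\ countable W, countable D, forall w, W w -> lt w u &
    forall y n, generic u W D y ->
      ev_const (y, n) s (c *: lproj R (Some (code_at u (y, n))))].
Proof.
elim=> [|c g s' Gg _ [c' [W [D [cW cD Wlt h]]]]].
  exists 0, set0, set0; split=> //; try exact: countable0.
  by move=> y n _; rewrite scale0r; exact: aeW.
have add c1 W1 D1 : countable W1 -> countable D1 -> (forall w, W1 w -> lt w u) ->
    (forall y n, generic u W1 D1 y ->
      ev_const (y, n) g (c1 *: lproj R (Some (code_at u (y, n))))) ->
    exists (c0 : C) W0 D0, [/\ countable W0, countable D0, forall w, W0 w -> lt w u &
    forall y n, generic u W0 D0 y ->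
      ev_const (y, n) (c *: g + s') (c0 *: lproj R (Some (code_at u (y, n))))].
  move=> cW1 cD1 W1lt h1; exists (c * c1 + c'), (W1 `|` W), (D1 `|` D); split.
  - by rewrite -bigcup2E; apply: bigcup_countable => // -[|[|k]] _.
  - by rewrite -bigcup2E; apply: bigcup_countable => // -[|[|k]] _.
  - by move=> w [/W1lt|/Wlt].
  - move=> y n gy; rewrite scalerDl -scalerA; apply: ev_constD.
      by apply/ev_constZ/h1; apply: generic_sub gy => t; left.
    by apply: h; apply: generic_sub gy => t; right.
case: Gg => [[[[[z i] j]|[[x i] j]]|v] _ gE].
- apply: (add 0 set0 set0) => //; try exact: countable0.
  by move=> y n _; rewrite scale0r -gE; exact: ev_const_point_mass.
- apply: (add 0 set0 [set x.1]) => //; try exact: countable0; try exact: countable1.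
  move=> y n [_ nx _]; rewrite scale0r -gE /=; have := @ev_const_lift_mass (y, n) x (delta_mx i j).
  by case: eqP => // yx; case: nx; rewrite -yx.
- have [muv|muv] := meet_lt u v.
    apply: (add 1 set0 _ _ (finite_set_countable (lab_meet u v))) => //; try exact: countable0.
    move=> y n [Su nD _]; rewrite scale1r -gE /=.
    have Sv : S v y by move: (Su); rewrite -{1}muv S_meet => -[].
    suff -> : code_at u (y, n) = code_at v (y, n) by exact: ev_const_proj_fun.
    rewrite /code_at/= !asboolT//; congr code; apply: contrapT => luv.
    by apply: nD; rewrite muv; split=> // -[_ lv]; exact: luv.
  apply: (add 0 [set meet u v] set0) => //; try exact: countable0; try exact: countable1.
    by move=> _ ->.
  move=> y n [Su _ nW]; rewrite scale0r -gE /=.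
  have nSv : ~ S v y by move=> Sv; apply: (nW _ erefl); rewrite S_meet.
  by have := ev_const_proj_fun (y, n) v; rewrite /code_at/= (asboolF nSv).
Qed.

(** The exceptions of a sequence of approximants are collected, which is why they are countable. One
    generic point shows that the scalars converge, and the limit then serves at all generic
    points. *)
Lemma near_proj_fun_generic u a : clspan gens a -> bnd (a - proj_fun u) (1 / 4) ->
  exists (c : C) W D, [/\ c != 0, countable W, countable D, forall w, W w -> lt w u &
    forall y n, generic u W D y -> lim_at (y, n) a (c *: lproj R (Some (code_at u (y, n))))].
Proof.
move=> Ga au.
have hn n : (0 : R) < 2^-1 ^+ n by rewrite exprn_gt0// invr_gt0.
pose s n := s2val (cid2 (Ga _ (hn n))).
have ss n : lspan gens (s n) := s2valP (cid2 (Ga _ (hn n))).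
have as' n : bnd (a - s n) (2^-1 ^+ n) := s2valP' (cid2 (Ga _ (hn n))).
have tP n : {t : C * set L * set Y | [/\ countable t.1.2, countable t.2,
    forall w, t.1.2 w -> lt w u & forall y i, generic u t.1.2 t.2 y ->
      ev_const (y, i) (s n) (t.1.1 *: lproj R (Some (code_at u (y, i))))]}.
  by apply: cid; have [c [W [D h]]] := lspan_generic u (ss n); exists (c, W, D).
pose c n := (sval (tP n)).1.1.
pose W := \bigcup_n (sval (tP n)).1.2; pose D := \bigcup_n (sval (tP n)).2.
have cW : countable W.
  by apply: bigcup_countable => // n _; have [] := svalP (tP n).
have cD : countable D.
  by apply: bigcup_countable => // n _; have [] := svalP (tP n).
have Wlt w : W w -> lt w u.
  by move=> [n _ Ww]; have [_ _ h _] := svalP (tP n); exact: h.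
have sE n y i : generic u W D y -> ev_const (y, i) (s n) (c n *: lproj R (Some (code_at u (y, i)))).
  move=> gy; have [_ _ _ h] := svalP (tP n); apply: h.
  by apply: generic_sub gy => t ht; exists n.
have [[y gy]|ng] := pselect (exists y, generic u W D y); last first.
  (* Without generic points the claim about limits is empty, and any nonzero scalar serves. *)
  exists 1, W, D; split=> //.
  by move=> y n gy; case: ng; exists y.
pose x0 := (y, 0%N); pose v0 := lproj R (Some (code_at u x0)).
have v00 : 1 / 2 <= normc (v0 0 0).
  by rewrite /v0 /code_at; case: gy => Su _ _; rewrite asboolT//; exact: lproj_code00.
have pos P : ae (fun z => E [set x0] z -> P z) -> exists2 z, E [set x0] z & P z.
  move=> h; apply: contrapT => nex; apply: (E_inf (x := x0)); apply: aeS h => z h Ez.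
  by apply: nex; exists z => //; exact: h.
have scal (d : C) e : mbnd (d *: v0) e -> normc d <= 2 * e.
  move=> /(_ 0 0); rewrite mxE normcM => h; have := normc_ge0 d; nra.
(* The corner entry of [v0] is at least 1 / 2, so a scalar is at most twice any bound on its
   multiple of [v0]. *)
have [|c0 hc] := @cauchy_limit R c 2.
  move=> k l; apply: scal.
  have [|z Ez [e1 e2]] := pos (fun z => s k z = c k *: v0 /\ s l z = c l *: v0).
    by apply: (ae2 (sE k y 0%N gy) (sE l y 0%N gy)) => z h1 h2 Ez; rewrite h1// h2.
  rewrite scalerBl -e1 -e2; exact: mbnd_tri (mbndBC (as' k z)) (as' l z).
have lim y' n : generic u W D y' -> lim_at (y', n) a (c0 *: lproj R (Some (code_at u (y', n)))).
  move=> gy' e e0; have [k hk] := half_lt (divr_gt0 e0 (ltr0n R 5)).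
  apply: aeS (sE k y' n gy') => z h Ez.
  (* The distance from [a] to [s k], plus the rate given by [cauchy_limit] with constant 2: together
     5 / 2 ^ k. *)
  apply: (@mbnd_le _ _ (2^-1 ^+ k + 2 * 2 * 2^-1 ^+ k * 1)).
    by move: hk; rewrite ltr_pdivlMr//; lra.
  apply: mbnd_tri (as' k z) _; rewrite h// -scalerBl => i j.
  rewrite mxE normcM; apply: ler_pM; rewrite ?normc_ge0//; exact: lproj_bnd.
exists c0, W, D; split=> //; apply/eqP => c00.
(* With scalar 0 the function [a] would be nearly 0 where [proj_fun u] equals [v0], although 1 / 16
   + 1 / 4 is less than the corner entry of [v0]. *)
have [|z Ez [e1 e2]] := pos (fun z => mbnd (a z) (1 / 16) /\ proj_fun u z = v0).
  have e16 : (0 : R) < 1 / 16 by rewrite divr_gt0.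
  apply: (ae2 (lim y 0%N gy _ e16) (ev_const_proj_fun x0 u)) => z h1 h2 Ez; split; last exact: h2.
  by move: (h1 Ez); rewrite c00 scale0r subr0.
have := mbndB e1 (au z); rewrite !fctE opprB addrC subrK e2 => /(_ 0 0).
by move: v00; lra.
Qed.

(** Different labels produce overlaps that are eventually below 1 but converge to 1, so no finite
    list of numbers below 1 contains all the values below 1. *)
Lemma overlap_unbounded (i j : set nat) : i <> j -> forall q : seq R,
  (forall t, t \in q -> t < 1) -> exists n,
    overlap (code i n)%:R^-1 (code j n)%:R^-1 \notin q /\
    overlap (code i n)%:R^-1 (code j n)%:R^-1 < 1 :> R.
Proof.
move=> ij q q1; have [n0 hn0] := code_neq ij.
pose M := \big[Num.max/0]_(t <- q) t.
have M1 : M < 1.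
  by rewrite /M big_seq; elim/big_ind: _ => [//|x y x1 y1|t /q1//]; rewrite gt_max x1.
have qM t : t \in q -> t <= M.
  by rewrite /M; elim: q {q1 M M1} => // t' q IH; rewrite inE big_cons le_max =>
    /predU1P[->|/IH ->]; rewrite ?lexx ?orbT.
(* The first summand makes the codes differ; the second makes both inverse codes smaller than 1 - M,
   which pushes the overlap above M. *)
pose n := (n0 + Num.bound (1 - M)^-1)%N; exists n.
have M1' : 0 < 1 - M by rewrite subr_gt0.
have inv01 i' : 0 <= ((code i' n)%:R^-1 : R) <= 1.
  have := code_gt i' n; case: (code i' n) => // k _. exact: inv_nat01.
have small i' : (code i' n)%:R^-1 < 1 - M.
  have B : (1 - M)^-1 < (code i' n)%:R.
    apply: lt_trans (archi_boundP _) _; first by rewrite invr_ge0 ltW.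
    by rewrite ltr_nat (leq_ltn_trans _ (code_gt i' n))// leq_addl.
  rewrite -[ltRHS]invrK ltf_pV2 ?posrE ?invr_gt0//.
  by apply: lt_trans B; rewrite invr_gt0.
set x := (code i n)%:R^-1; set y := (code j n)%:R^-1.
have xy : x != y.
  apply/eqP => /invr_inj/eqP; rewrite eqr_nat => /eqP; apply: hn0; exact: leq_addr.
split; last exact: overlap_lt1.
apply/negP => /qM; apply/negP; rewrite -ltNge.
apply: lt_le_trans (overlap_ge (inv01 i) (inv01 j)).
exact: sqr_sub_lt.
Qed.

Lemma overlap_uniq_seq (i j : set nat) : i <> j -> forall N, exists q : seq R,
  [/\ size q = N, uniq q & forall t, t \in q -> t < 1 /\
    exists n, t = overlap (code i n)%:R^-1 (code j n)%:R^-1].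
Proof.
move=> ij; elim=> [|N [q [sq uq hq]]]; first by exists [::].
have [n [nq n1]] := overlap_unbounded ij (fun t tq => (hq t tq).1).
exists (overlap (code i n)%:R^-1 (code j n)%:R^-1 :: q); split=> /=.
- by rewrite sq.
- by rewrite nq.
- by move=> t; rewrite inE => /predU1P[->|/hq//]; split=> //; exists n.
Qed.

(** The combinatorial input to the failure of AF: countable exceptions, chosen arbitrarily for every
    index, leave a clash of labels at a point generic for both sets. *)
Hypothesis generic_clash : forall (W : L -> set L) (D : L -> set Y),
  (forall u, [/\ countable (W u), countable (D u) & forall w, W u w -> lt w u]) ->
  exists u v y, [/\ generic u (W u) (D u) y, generic v (W v) (D v) y
    & lab u y <> lab v y].

(** At the clash the sandwich of the two approximants has, for each [n], a limit that is a scalar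
    times a rank one projection. A relation between its powers becomes a polynomial with a root for
    every overlap value, of which there are more than the degree allows. *)
Lemma core_independent (a : L -> V) :
  (forall u, clspan gens (a u) /\ bnd (a u - proj_fun u) (1 / 4)) ->
  exists u v, forall N (d : 'I_N -> C),
    \sum_j d j *: (a u * a v * a u) ^+ j.+1 = 0 -> forall j, d j = 0.
Proof.
move=> ha.
have tP u : {t : C * set L * set Y | [/\ t.1.1 != 0, countable t.1.2, countable t.2,
    forall w, t.1.2 w -> lt w u & forall y n, generic u t.1.2 t.2 y ->
      lim_at (y, n) (a u) (t.1.1 *: lproj R (Some (code_at u (y, n))))]}.
  apply: cid; have [Ga au] := ha u.
  by have [c [W [D h]]] := near_proj_fun_generic Ga au; exists (c, W, D).
have [|u [v [y [gu gv luv]]]] := @generic_clash (fun u => (sval (tP u)).1.2)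
    (fun u => (sval (tP u)).2).
  by move=> u; have [] := svalP (tP u).
exists u, v => N d sum0.
have [cu0 _ _ _ lu] := svalP (tP u); have [cv0 _ _ _ lv] := svalP (tP v).
set cu := (sval (tP u)).1.1 in cu0 lu; set cv := (sval (tP v)).1.1 in cv0 lv.
pose g := cu * cv * cu; have g0 : g != 0 by rewrite !mulf_neq0.
pose r n : 'M[C]_2 := rproj (code (lab u y) n)%:R^-1.
pose tau n : R := overlap (code (lab u y) n)%:R^-1 (code (lab v y) n)%:R^-1.
have ba w : bounded (a w) by apply: (clspan_bounded gens_bounded); have [] := ha w.
have vE w n : S w y -> lproj R (Some (code_at w (y, n))) = rproj (code (lab w y) n)%:R^-1.
  by move=> Sw; rewrite /code_at/= asboolT//; have := code_gt (lab w y) n; case: code.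
have Su : S u y by case: gu. have Sv : S v y by case: gv.
have lim n : lim_at (y, n) (a u * a v * a u) ((g * (tau n)%:C%C) *: r n).
  have := lim_atM (boundedM (ba u) (ba v)) (lim_atM (ba u) (lu y n gu) (lv y n gv)) (lu y n gu).
  by rewrite !vE// rproj_sandwichZ.
have pn n : \sum_j d j * (g * (tau n)%:C%C) ^+ j.+1 = 0.
  have h : lim_at (y, n) (\sum_j d j *: (a u * a v * a u) ^+ j.+1)
      (\sum_j d j *: ((g * (tau n)%:C%C) ^+ j.+1 *: r n)).
    apply: lim_at_sum => j; apply: lim_atZ; apply: lim_atX => //; last exact: rproj_idem.
    by apply: boundedM => //; exact: boundedM.
  have z0 : lim_at (y, n) 0 (0 : 'M[C]_2) by apply: ev_const_lim_at; exact: aeW.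
  rewrite sum0 in h; have hz := lim_at_unique h z0.
  have : (\sum_j d j *: ((g * (tau n)%:C%C) ^+ j.+1 *: r n)) 0 0 = 0.
    by rewrite hz mxE.
  under eq_bigr do rewrite scalerA; rewrite -scaler_suml mxE => /eqP.
  rewrite mulf_eq0 => /orP[/eqP//|/eqP r0].
  have := lproj_code00 R (lab u y) n; rewrite [lproj _ _](_ : _ = r n).
    by rewrite r0 normc0 leNgt divr_gt0.
  by rewrite /r -(vE u n Su) /code_at/= asboolT.
pose p : {poly C} := \poly_(k < N) (if insub k is Some j then d j else 0).
have pE (j : 'I_N) : p`_j = d j.
  by rewrite coef_poly ltn_ord insubT//= => jN; congr d; exact: val_inj.
have gt0 n : g * (tau n)%:C%C != 0.
  rewrite mulf_neq0//; apply/eqP => /(congr1 (@complex.Re R))/= /eqP.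
  by rewrite gt_eqF// overlap_gt0// invr_ge0.
have proot n : p.[g * (tau n)%:C%C] = 0.
  (* The relation starts with the first power, so one factor is cancelled; it is nonzero because
     overlaps are positive. *)
  apply: (mulIf (gt0 n)); rewrite mul0r -[RHS](pn n) horner_poly mulr_suml.
  by apply: eq_bigr => j _; rewrite valK exprSr mulrA.
have p0 : p = 0.
  have [q [sq uq hq]] := overlap_uniq_seq luv N.+1.
  apply: contrapT => /eqP p0.
  have := max_poly_roots p0 (rs := [seq g * (t%:C)%C | t <- q]).
  rewrite size_map sq => h; have : (N.+1 < size p)%N.
    apply: h; last first.
      rewrite map_inj_uniq// => t t' /(mulfI g0)/(congr1 (@complex.Re R)).
      by [].
    by apply/allP => _ /mapP[t tq ->]; have [_ [n ->]] := hq t tq; exact/eqP/proot.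
  by rewrite ltnNge (leq_trans (size_poly _ _))// leqnSn.
by move=> j; rewrite -pE p0 coef0.
Qed.

End Core.

(** * The operator algebra and bounds for its density *)

Section CoreTheorem.
Variables (R : realType) (I Y Z : choiceType) (L : Type).
Local Notation C := (R[i])%type.
Local Notation X := (Y * nat)%type.
Local Notation V := (Z -> 'M[C]_2).
Variables (S : L -> set Y) (lab : L -> Y -> set nat) (E : set X -> set Z).
Let gidx := (Z * 'I_2 * 'I_2 + X * 'I_2 * 'I_2 + L)%type.
Local Notation generator := (@generator R Y Z L S lab E).
Local Notation gens := (@gens R Y Z L S lab E).

Definition rat_comb (s : seq (rat * rat * gidx)) : V :=
  \sum_(t <- s) (ratr t.1.1 +i* ratr t.1.2)%C *: generator t.2.

Lemma quarter_sum_lt (e : R) : 0 < e -> 2 * (e / 8 + e / 8) < e.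
Proof. by move=> e0; lra. Qed.

Lemma rat_approx (c : C) (e : R) : 0 < e ->
  exists q : rat * rat, normc (c - (ratr q.1 +i* ratr q.2)%C) <= e.
Proof.
case: c => a b e0; have e2 : 0 < e / 2 by rewrite divr_gt0.
have real_approx (x : R) : exists q : rat, `|x - ratr q| <= e / 2.
  have [|q] := @rat_in_itvoo R (x - e / 2) x; first by rewrite ltrBlDr ltrDl.
  rewrite in_itv/= => /andP[q1 q2]; exists q; rewrite ger0_norm ?subr_ge0 ?(ltW q2)//.
  by rewrite lerBlDr -lerBlDl ltW.
have [p hp] := real_approx a; have [q hq] := real_approx b.
exists (p, q); apply: le_trans (normc_le_ReIm _) _ => /=.
by rewrite (splitr e) lerD.
Qed.

Lemma lspan_rat_approx (a : V) (e : R) : lspan gens a -> 0 < e ->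
  exists s, bnd (a - rat_comb s) e.
Proof.
move=> sa; elim: sa e => [|c _ a' [t _ <-] _ IH] e e0.
  by exists [::]; rewrite /rat_comb big_nil subr0; exact/bnd0/ltW.
have e2 : 0 < e / 2 by rewrite divr_gt0.
have [s hs] := IH _ e2; have [q hq] := rat_approx c e2.
exists ((q, t) :: s); rewrite /rat_comb big_cons/= -/(rat_comb s).
rewrite opprD addrACA -scalerBl (splitr e); apply: bndD => //.
rewrite -[e / 2]mulr1 => z j k; rewrite fctE mxE normcM.
by apply: ler_pM; rewrite ?normc_ge0//; exact: (generator_bnd1 R S lab E t z j k).
Qed.

Variables (meet : L -> L -> L) (lt : L -> L -> Prop).
Hypothesis EH : mod_fin_hom E.
Hypothesis E_inf : forall x, ~ ae (fun z => ~ E [set x] z).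
Hypothesis S_meet : forall u v, S (meet u v) = S u `&` S v.
Hypothesis lab_meet : forall u v, finite_set [set y | S (meet u v) y /\
  ~ (lab u y = lab (meet u v) y /\ lab v y = lab (meet u v) y)].
Hypothesis meet_lt : forall u v, meet u v = u \/ lt (meet u v) u.
Hypothesis lt_min : forall Q : set L, Q !=set0 ->
  exists2 u, Q u & forall v, Q v -> ~ lt v u.
Hypothesis generic_clash : forall (W : L -> set L) (D : L -> set Y),
  (forall u, [/\ countable (W u), countable (D u) & forall w, W u w -> lt w u]) ->
  exists u v y, [/\ generic S u (W u) (D u) y, generic S v (W v) (D v) y
    & lab u y <> lab v y].
Variables (phi : Z * 'I_2 -> I).
Hypothesis phi_inj : injective phi.

(** The lower bound for the density takes a family [Q] as parameter because not all indices are
    pairwise separated: it is applied to the columns of the grid and to the full branches of the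
    tree. *)
Theorem core_algebra : exists A : set (bop R I),
  [/\ Cstar_subalgebra A, scattered A, ~ AF A,
    forall (Q : set L) D,
      (forall u v, Q u -> Q v -> u <> v -> exists2 y, S u y & ~ S v y) ->
      norm_dense_in A D -> Q #<= D &
    exists2 D, norm_dense_in A D & D #<= [set: seq (rat * rat * gidx)]].
Proof.
have AA := core_fun_alg R EH S_meet lab_meet.
have [Ab A0 AD AZ AM As Ac] := AA.
have Ap u : clspan gens (proj_fun R S lab E u) by apply: clspan_gen; exact: proj_fun_gens.
exists (op phi_inj @` clspan gens); split.
- exact: fun_alg_Cstar.
- apply: fun_alg_scattered => // J IJ nJ.
  exact: (core_scattered EH S_meet lab_meet meet_lt lt_min IJ nJ).
- have e0 : (0 : R) < 1 / 4 by rewrite divr_gt0.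
  move=> /(AF_dependent (phi_inj := phi_inj) AA Ap e0)[a [ha dep]].
  have [u [v indep]] := core_independent EH E_inf S_meet lab_meet meet_lt generic_clash ha.
  have [N [d [[j dj] sum0]]] := dep u v.
  by rewrite (indep N d sum0) eqxx in dj.
- move=> Q D sep dD; apply: (dense_card_ge (phi_inj := phi_inj) AA Ap _ dD).
  move=> u v Qu Qv uv; apply: proj_fun_separated => //; exact: sep.
exists (range (fun s => op phi_inj (rat_comb s))); last exact: card_image_le.
have Gs s : clspan gens (rat_comb s).
  apply: lspan_clspan; apply: lspan_sum => t; apply/lspanZ/lspan_gen.
  by exists t.2.
split=> [_ [s _ <-]|_ [a Aa <-] e e0]; first by exists (rat_comb s).
have e8 : 0 < e / 8 by rewrite divr_gt0.
have [b sb ab] := Aa _ e8; have [s bs] := lspan_rat_approx sb e8.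
exists (op phi_inj (rat_comb s)); first by exists s.
rewrite -opB; [|exact: Ab|exact/Ab/Gs].
have h := bnd_tri ab bs.
apply: le_lt_trans (op_norm phi_inj h _) _; first by rewrite addr_ge0// ltW.
exact: quarter_sum_lt.
Qed.

End CoreTheorem.

(** * Cardinal arithmetic *)

Section Cardinals.

Lemma card_le_inj T U (A : set T) (B : set U) (f : T -> U) :
  (forall x, A x -> B (f x)) ->
  (forall x y, A x -> A y -> f x = f y -> x = y) -> A #<= B.
Proof.
move=> fB fI.
have inj : {in A &, injective f} by move=> x y /set_mem Ax /set_mem Ay; exact: fI.
rewrite -(card_le_eql (inj_card_eq inj)).
by apply: subset_card_le => _ [x Ax <-]; exact: fB.
Qed.

Lemma inj_card_leT T U (f : T -> U) : injective f -> [set: T] #<= [set: U].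
Proof. by move=> fI; apply: (@card_le_inj _ _ _ _ f) => // x y _ _; exact: fI. Qed.

Lemma card_le_fun T U (A : set T) : A #<= [set: U] ->
  U -> exists f : T -> U, forall x y, A x -> A y -> f x = f y -> x = y.
Proof.
move=> /card_leP[f] u0.
exists (fun x => if pselect (A x) is left Ax
  then \val (f (SigSub (mem_set Ax))) else u0).
move=> x y Ax Ay; case: pselect => // Ax'; case: pselect => // Ay' /val_inj fxy.
have : SigSub (mem_set Ax') = SigSub (mem_set Ay') :> A.
  by apply: (@inj _ _ setT f); rewrite ?inE.
by move=> /(congr1 \val).
Qed.

Lemma card_leT_fun T U : [set: T] #<= [set: U] -> exists f : T -> U, injective f.
Proof.
move=> h; have [[t]|nT] := pselect (inhabited T).
  have /card_leP[f] := h.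
  have [g gI] := card_le_fun h (\val (f (SigSub (mem_set (I : [set: T] t))))).
  by exists g => x y; exact: gI.
exists (fun x => False_rect _ (nT (inhabits x))) => x; by case: nT.
Qed.

Lemma card_eqT_bij T U : [set: T] #= [set: U] ->
  exists2 h : T -> U, injective h & forall u, exists t, h t = u.
Proof.
move=> /card_bijP[f [g fK gK]].
exists (fun t => \val (f (SigSub (mem_set (I : [set: T] t))))) => [x y /val_inj|u].
  by move=> /(can_inj fK)/(congr1 \val).
exists (\val (g (SigSub (mem_set (I : [set: U] u))))).
rewrite [SigSub _](_ : _ = g (SigSub (mem_set (I : [set: U] u)))) ?gK//.
exact: val_inj.
Qed.

Lemma wf_of_min T (lt : T -> T -> Prop) :
  (forall Q : set T, Q !=set0 -> exists2 m, Q m & forall x, Q x -> ~ lt x m) ->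
  well_founded lt.
Proof.
move=> h a; apply: contrapT => na.
have [|m nm mmin] := h [set x | ~ Acc lt x]; first by exists a.
apply: nm; constructor => x xm; apply: contrapT => nx; exact: mmin nx xm.
Qed.

Lemma wo_min T (lt : T -> T -> Prop) : well_ordered lt setT ->
  forall Q : set T, Q !=set0 -> exists2 m, Q m & forall x, Q x -> ~ lt x m.
Proof.
move=> [ir tr tri mi] Q Q0; have [//|m Qm mmin] := mi Q _ Q0.
exists m => // x Qx xm; case: (mmin x Qx) => [xE|mx].
  by apply: (ir m) => //; rewrite -{1}xE.
by apply: (ir m) => //; exact: tr mx xm.
Qed.

Lemma small_segments_le (P W X : Type) (lt : P -> P -> Prop) :
  (forall Q : set P, Q !=set0 -> exists2 m, Q m & forall x, Q x -> ~ lt x m) ->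
  (forall p q, [\/ lt p q, p = q | lt q p]) ->
  (forall p, [set q | lt q p] #<= [set: X]) -> ~ ([set: W] #<= [set: X]) ->
  [set: P] #<= [set: W].
Proof.
move=> /wf_of_min wf tri seg WX.
have [w0] : inhabited W.
  apply: contrapT => nW; apply: WX.
  apply: (@card_le_inj _ _ _ _ (fun w => False_rect X (nW (inhabits w)))) => // x.
  by case: nW.
pose F p (rec : forall q, lt q p -> W) : W :=
  if pselect (exists w, forall q (h : lt q p), w <> rec q h) is left h
  then projT1 (cid h) else w0.
pose g := Fix wf (fun=> W) F.
have gE p : g p = F p (fun q _ => g q).
  apply: Fix_eq => x f f' ff'; congr (F x).
  by apply: functional_extensionality_dep => q; apply: functional_extensionality_dep.
have gn p q : lt q p -> g p <> g q.
  move=> qp; rewrite gE /F; case: pselect => [h|nh].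
    by case: (cid h) => w /= hw; exact: hw.
  (* If no fresh value is left, the values of the predecessors of [p] cover [W], which would then be
     no larger than [X]. *)
  exfalso; apply: WX.
  have cov w : exists q', lt q' p /\ w = g q'.
    apply: contrapT => nq; apply: nh; exists w => q' q'p wE; apply: nq.
    by exists q'.
  have /card_leP[f] := seg p; have x0 := \val (f (SigSub (mem_set (qp : [set q | lt q p] q)))).
  have [h hI] := card_le_fun (seg p) x0.
  pose c w := projT1 (cid (cov w)).
  have cP w : lt (c w) p /\ w = g (c w) by rewrite /c; case: cid.
  apply: (@card_le_inj _ _ _ _ (h \o c)) => // w w' _ _ /= hc.
  rewrite (cP w).2 (cP w').2; congr g; apply: hI hc; [exact: (cP w).1|exact: (cP w').1].
apply: (@inj_card_leT _ _ g) => p q gpq; case: (tri p q) => // [/gn|/gn].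
  by rewrite gpq.
by [].
Qed.

(* Order by [m] first and break ties by any well-order: the initial segments are small. *)
Lemma small_fibers_le (P M W X : Type) (ltM : M -> M -> Prop) (m : P -> M) :
  well_ordered ltM setT ->
  (forall c, [set p | m p = c \/ ltM (m p) c] #<= [set: X]) ->
  ~ ([set: W] #<= [set: X]) -> [set: P] #<= [set: W].
Proof.
move=> woM seg; have [irM trM triM miM] := woM.
pose pl (p q : P) := pow_lt [set p] [set q].
have [ir tr tri mi] := @pow_lt_wo P setT.
pose lt p q := ltM (m p) (m q) \/ m p = m q /\ pl p q.
apply: (@small_segments_le _ _ _ lt).
- move=> Q [q0 Qq0].
  have [|_ [q1 Qq1 <-] cmin] := wo_min woM (Q := m @` Q); first by exists (m q0), q0.
  have [|_ [q [Qq mq] <-] qmin] := wo_min (@pow_lt_wo P setT)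
      (Q := (fun p => [set p]) @` [set p | Q p /\ m p = m q1]).
    by exists [set q1], q1.
  exists q => // x Qx [xq|[xq pxq]].
    by apply: (cmin (m x)); [exists x|rewrite -mq].
  apply: (qmin [set x]) => //; exists x => //; split=> //; exact: etrans xq mq.
- move=> p q; case: (triM (m p) (m q)) => // [h|mpq|h].
  + by constructor 1; left.
  + case: (tri [set p] [set q]) => // [h|h|h].
    * by constructor 1; right.
    * by constructor 2; have : [set q] p by rewrite -h.
    * by constructor 3; right.
  + by constructor 3; left.
- move=> p; apply: card_le_trans (seg (m p)); apply: subset_card_le => q [h|[h _]].
    by right.
  by left.
Qed.

(** Comparability of cardinals: [X] is well-ordered through its singletons, and its segments are no
    larger than [X]. *)
Lemma card_not_le W X : ~ ([set: W] #<= [set: X]) -> [set: X] #<= [set: W].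
Proof.
move=> WX.
apply: (@small_fibers_le X _ W X _ (fun x => [set x]) (@pow_lt_wo X setT)) => // c.
exact: subset_card_le.
Qed.

(** A working form of infinity: with two distinct points, an injection of pairs yields injections
    for sums, options, finite sequences and the natural numbers. *)
Definition squarable X := exists (f : X * X -> X) (x0 x1 : X), injective f /\ x0 <> x1.

Lemma option_le X : squarable X -> exists g : option X -> X, injective g.
Proof.
move=> [f [x0 [x1 [fI x01]]]].
exists (fun o => f (if o is Some x then (x, x) else (x0, x1))).
by move=> [x|] [y|] /fI // [] // => [->//|xx0 xx1|xx0 xx1]; case: x01; congruence.
Qed.

Lemma succ_closed_segment X (c : card_succ X) : squarable X ->
  [set b | b = c \/ succ_lt b c] #<= [set: X].
Proof.
move=> sX; have [g gI] := option_le sX; have [_ [x0 _]] := sX.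
have [f fI] := card_le_fun (card_succ_segment c) x0.
have ir : ~ succ_lt c c by have [ir _ _ _] := succ_lt_wo X; exact: ir.
apply: (@card_le_inj _ _ _ _ (fun b => g (if pselect (b = c) then None else Some (f b)))) => //.
move=> x y Ax Ay /gI; case: pselect => xc; case: pselect => yc //.
  by move=> _; exact: etrans xc (esym yc).
by move=> [] /fI; apply; [case: Ax|case: Ay].
Qed.

Lemma succ_two X : squarable X -> exists a b : card_succ X, a <> b.
Proof.
move=> [_ [x0 _]]; apply: contrapT => h; apply: (@card_succ_gt X).
apply: (@card_le_inj _ _ _ _ (fun=> x0)) => // a b _ _ _.
by apply: contrapT => ab; apply: h; exists a, b.
Qed.

(** Hessenberg's argument: order pairs by their maximum. The pairs with maximum at most [c] lie in
    the square of a closed segment, which is no larger than [X]. *)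
Lemma succ_squarable X : squarable X -> squarable (card_succ X).
Proof.
move=> sX; have [f [x0 [x1 [fI x01]]]] := sX.
have wo := succ_lt_wo X; have [ir tr tri mi] := wo.
pose mx (p : card_succ X * card_succ X) := if pselect (succ_lt p.1 p.2) then p.2 else p.1.
have mxP p : (p.1 = mx p \/ succ_lt p.1 (mx p)) /\ (p.2 = mx p \/ succ_lt p.2 (mx p)).
  rewrite /mx; case: pselect => h; split; [by right|by left|by left|].
  by case: (tri p.1 p.2) => // h'; [left|right].
have le_trans (a b c : card_succ X) :
    a = b \/ succ_lt a b -> b = c \/ succ_lt b c -> a = c \/ succ_lt a c.
  move=> [->//|ab] [<-|bc]; right => //; exact: tr ab bc.
have sq : [set: card_succ X * card_succ X] #<= [set: card_succ X].
  apply: (@small_fibers_le _ _ _ X _ mx wo); last exact: card_succ_gt.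
  move=> c; have [g gI] := card_le_fun (succ_closed_segment c sX) x0.
  apply: (@card_le_inj _ _ _ _ (fun p => f (g p.1, g p.2))) => // p q pc qc /fI[].
  have [p1 p2] := mxP p; have [q1 q2] := mxP q.
  move=> /gI g1 /gI g2; rewrite (surjective_pairing p) (surjective_pairing q).
  congr pair; [apply: g1|apply: g2]; by apply: le_trans; [eassumption|].
have [h hI] := card_leT_fun sq; have [a [b ab]] := succ_two sX.
by exists h, a, b.
Qed.

Lemma squarable_nat : squarable nat.
Proof.
by exists (fun p => pickle p), 0%N, 1%N; split.
Qed.

Lemma squarable_omega1 : squarable omega1.
Proof. exact/succ_squarable/squarable_nat. Qed.

Lemma squarable_omega2 : squarable omega2.
Proof. exact/succ_squarable/squarable_omega1. Qed.

Lemma squarable_setnat : squarable (set nat).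
Proof.
exists (fun p n => if odd n then p.1 n./2 else p.2 n./2), set0, setT; split.
  move=> [A B] [A' B'] /= h; congr pair; apply/funext => n.
    by have := congr1 (fun F => F n.*2.+1) h; rewrite /= odd_double/= uphalf_double.
  by have := congr1 (fun F => F n.*2) h; rewrite odd_double doubleK.
by move=> /(congr1 (fun A : set nat => A 0%N)) h; have : [set: nat] 0%N by []; rewrite -h.
Qed.

Lemma sequence_setnat : exists f : (nat -> set nat) -> set nat, injective f.
Proof.
exists (fun u k => if unpickle k is Some p then u (p : nat * nat).1 p.2 else False).
move=> u v h; apply/funext => n; apply/funext => m.
by have := congr1 (fun F => F (pickle (n, m))) h; rewrite !pickleK.
Qed.

Lemma squarable_inj_nat X : squarable X -> exists f : nat -> X, injective f.
Proof.
move=> [f [x0 [x1 [fI x01]]]].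
pose g := fix g n := if n is m.+1 then f (x1, g m) else f (x0, x0).
exists g; elim=> [|n IH] [|m] //= /fI[].
- by move=> /x01.
- by move=> /esym/x01.
- by move=> /IH ->.
Qed.

(** The length is stored next to the nested pairs, since the code alone does not show where the
    nesting stops. *)
Lemma squarable_seq X : squarable X -> exists f : seq X -> X, injective f.
Proof.
move=> sX; have [f [x0 [x1 [fI x01]]]] := sX; have [n nI] := squarable_inj_nat sX.
pose e := fix e (s : seq X) := if s is x :: t then f (x, e t) else x0.
exists (fun s => f (n (size s), e s)) => s t /fI[/nI].
by elim: s t => [|x s IH] [|y t] //= [st] /fI[-> /(IH _ st) ->].
Qed.

Lemma squarable_prod X A B : squarable X -> (exists a : A -> X, injective a) ->
  (exists b : B -> X, injective b) -> exists c : A * B -> X, injective c.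
Proof.
move=> [f [_ [_ [fI _]]]] [a aI] [b bI]; exists (fun p => f (a p.1, b p.2)).
by move=> [x y] [x' y'] /fI[/aI/= -> /bI/= ->].
Qed.

Lemma squarable_sum X A B : squarable X -> (exists a : A -> X, injective a) ->
  (exists b : B -> X, injective b) -> exists c : A + B -> X, injective c.
Proof.
move=> [f [x0 [x1 [fI x01]]]] [a aI] [b bI].
exists (fun s => match s with inl y => f (x0, a y) | inr y => f (x1, b y) end).
move=> [y|y] [z|z] /fI[].
- by move=> /aI ->.
- by move=> /x01.
- by move=> /esym/x01.
- by move=> /bI ->.
Qed.

Lemma squarable_option X A : squarable X -> (exists a : A -> X, injective a) ->
  exists c : option A -> X, injective c.
Proof.
move=> /option_le[g gI] [a aI]; exists (g \o omap a).
by move=> [x|] [y|] /gI //= [/aI ->].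
Qed.

Lemma squarable_count X (T : countType) : squarable X -> exists f : T -> X, injective f.
Proof.
move=> /squarable_inj_nat[n nI]; exists (n \o pickle) => x y /nI.
exact: pcan_inj pickleK x y.
Qed.

Lemma countable_le X : squarable X -> forall T (A : set T), countable A -> A #<= [set: X].
Proof.
move=> sX T A cA; have [n nI] := squarable_inj_nat sX.
exact: card_le_trans cA (inj_card_leT nI).
Qed.

(** Otherwise [omega1] would be a countable union of closed segments, which are countable. *)
Lemma omega1_bounded (A : set omega1) : countable A ->
  exists w, forall v, A v -> omega1_lt v w.
Proof.
move=> cA; apply: contrapT => nw; apply: (@card_succ_gt nat).
have [ir tr tri mi] := succ_lt_wo nat.
have -> : [set: omega1] = \bigcup_(v in A) [set b | b = v \/ succ_lt b v].
  apply/seteqP; split => // w _; apply: contrapT => h; apply: nw; exists w => v Av.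
  case: (tri v w) => // [vw|wv]; exfalso; apply: h; exists v => //=; first by left.
  by right.
apply: bigcup_countable => // v _; exact: succ_closed_segment squarable_nat.
Qed.

End Cardinals.

(** * The grid omega1 x omega2 *)

Section Blowup.
Variable X : choiceType.

(** Infinitely many copies of each point make the point visible to statements that hold up to finite
    sets. *)
Definition blowup (A : set X) : set (X * nat) := [set z | A z.1].

Lemma blowup_hom : mod_fin_hom blowup.
Proof. by split=> *; apply: aeW => z; rewrite /blowup/=; tauto. Qed.

Lemma blowup_inf x : ~ ae (fun z => ~ blowup [set x] z).
Proof.
move=> /(finite_image snd) h; apply: infinite_nat; apply: sub_finite_set h => n _.
by exists (x, n) => //=; apply.
Qed.

End Blowup.

Section Grid.
Variables A B : choiceType.
Local Notation Y := (A * B)%type.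

Variant grid := GPoint of option Y | GRow of A | GCol of B.

Definition grid_set (u : grid) : set Y :=
  match u with
  | GPoint None => set0
  | GPoint (Some p) => [set p]
  | GRow a => [set p | p.1 = a]
  | GCol b => [set p | p.2 = b]
  end.

(** A row and a column share a single point, so their labels may differ everywhere and still agree
    up to a finite set on the intersection. *)
Definition grid_lab (u : grid) : Y -> set nat :=
  fun=> if u is GCol _ then setT else set0.

Definition grid_rank (u : grid) : nat :=
  match u with GPoint None => 0 | GPoint (Some _) => 1 | _ => 2 end.

Definition grid_lt u v := (grid_rank u < grid_rank v)%N.

Definition grid_point p v : grid :=
  if pselect (grid_set v p) then GPoint (Some p) else GPoint None.

Definition grid_meet (u v : grid) : grid :=
  match u, v with
  | GPoint None, _ | _, GPoint None => GPoint None
  | GPoint (Some p), _ => grid_point p v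
  | _, GPoint (Some p) => grid_point p u
  | GRow a, GRow a' => if a == a' then u else GPoint None
  | GCol b, GCol b' => if b == b' then u else GPoint None
  | GRow a, GCol b | GCol b, GRow a => GPoint (Some (a, b))
  end.

Lemma grid_point_set p v : grid_set (grid_point p v) = [set p] `&` grid_set v.
Proof.
rewrite /grid_point; case: pselect => vp; apply/seteqP; split=> q //=.
  by move=> ->.
  by case.
by case=> ->.
Qed.

Lemma grid_meet_set u v : grid_set (grid_meet u v) = grid_set u `&` grid_set v.
Proof.
have set2 (p q : Y) : [set p] q = (q = p) by [].
case: u v => [[p|]|a|b] [[q|]|a'|b'];
  rewrite /grid_meet ?grid_point_set ?set0I ?setI0//; try by rewrite setIC.
- case: eqP => [->|aa'] /=; apply/seteqP; split=> r //=; first by case.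
  by case=> -> aa; apply: aa'.
- apply/seteqP; split=> -[r1 r2] /=; first by case=> -> ->.
  by case=> -> ->.
- apply/seteqP; split=> -[r1 r2] /=; first by case=> -> ->.
  by case=> -> ->.
- case: eqP => [->|aa'] /=; apply/seteqP; split=> r //=; first by case.
  by case=> -> aa; apply: aa'.
Qed.

Lemma grid_meet_lt u v : grid_meet u v = u \/ grid_lt (grid_meet u v) u.
Proof.
case: u v => [[p|]|a|b] [[q|]|a'|b']; rewrite /grid_lt/= /grid_point;
  do ?[case: pselect => ?|case: eqP => ?] => /=; by [left|right].
Qed.

Lemma grid_lt_min (Q : set grid) : Q !=set0 ->
  exists2 u, Q u & forall v, Q v -> ~ grid_lt v u.
Proof.
move=> [u Qu]; have ex : exists n, `[< exists2 v, Q v & grid_rank v = n >].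
  by exists (grid_rank u); apply/asboolP; exists u.
case: (ex_minnP ex) => n /asboolP[v Qv vn] nmin; exists v => // w Qw.
apply/negP; rewrite /grid_lt vn -leqNgt; apply: nmin; apply/asboolP.
by exists w.
Qed.

Lemma grid_lab_meet u v : finite_set [set p | grid_set (grid_meet u v) p /\
  ~ (grid_lab u p = grid_lab (grid_meet u v) p /\
     grid_lab v p = grid_lab (grid_meet u v) p)].
Proof.
have fin w P : (grid_rank w < 2)%N -> finite_set [set p | grid_set w p /\ P p].
  case: w => [[p|]|//|//] _; last by apply: sub_finite_set (finite_set0 Y) => q [].
  by apply: sub_finite_set (finite_set1 p) => q [].
have [muv|] := grid_meet_lt u v; last first.
  by move=> h; apply: fin; apply: leq_trans h _; case: u => [[]|a|b].
have [|r2] := ltnP (grid_rank (grid_meet u v)) 2; first exact: fin.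
have -> : [set p | grid_set (grid_meet u v) p /\
  ~ (grid_lab u p = grid_lab (grid_meet u v) p /\
     grid_lab v p = grid_lab (grid_meet u v) p)] = set0; last exact: finite_set0.
apply/seteqP; split => // p [_]; apply; rewrite muv; split=> //.
move: muv r2; case: u v => [[q|]|a|b] [[q'|]|a'|b'] //=;
  by rewrite /grid_point; case: pselect.
Qed.

Hypothesis A_unc : ~ countable [set: A].
Hypothesis B_big : forall T : A -> set B, (forall a, countable (T a)) ->
  exists b, forall a, ~ T a b.

(** The column [b] is chosen first, outside the exceptions of all rows at once, which is where
    [B_big] enters. Then [a] has to avoid only the countably many exceptions of that one column. *)
Lemma grid_clash (W : grid -> set grid) (D : grid -> set Y) :
  (forall u, [/\ countable (W u), countable (D u) & forall w, W u w -> grid_lt w u]) ->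
  exists u v y, [/\ generic grid_set u (W u) (D u) y, generic grid_set v (W v) (D v) y
    & grid_lab u y <> grid_lab v y].
Proof.
move=> h; pose T u := D u `|` \bigcup_(w in W u) grid_set w.
have cT u : countable (T u).
  have [cW cD Wlt] := h u.
  rewrite /T -bigcup2E; apply: bigcup_countable => // -[|[|k]] _ //=.
  apply: bigcup_countable => // w /Wlt; rewrite /grid_lt => wu.
  have : (grid_rank w < 2)%N by apply: leq_trans wu _; case: u {cW cD Wlt} => [[]|a|b].
  by case: w {wu} => [[p|]|//|//] _ /=; [exact: countable1|exact: countable0].
have cim (U V : Type) (g : U -> V) (K : set U) : countable K -> countable (g @` K).
  by move=> cK; apply: card_le_trans cK; exact: card_image_le.
have [b hb] := B_big (fun a => cim _ _ snd _ (cT (GRow a))).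
have [a ha] : exists a, ~ (fst @` T (GCol b)) a.
  apply: contrapT => na; apply: A_unc; apply: card_le_trans (cim _ _ fst _ (cT (GCol b))).
  by apply: subset_card_le => a _; apply: contrapT => ha; apply: na; exists a.
exists (GRow a), (GCol b), (a, b); split.
- split=> // [Dp|w Ww wp]; apply: (hb a); exists (a, b) => //; first by left.
  by right; exists w.
- split=> // [Dp|w Ww wp]; apply: ha; exists (a, b) => //; first by left.
  by right; exists w.
- by move=> /(congr1 (fun F => F 0%N)) /= E; rewrite E.
Qed.

Lemma grid_col_separated (a0 : A) b b' : b <> b' ->
  exists2 y, grid_set (GCol b) y & ~ grid_set (GCol b') y.
Proof. by exists (a0, b). Qed.

End Grid.

Lemma omega1_uncountable : ~ countable [set: omega1].
Proof. exact: card_succ_gt. Qed.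

Lemma omega1_le_omega2 : exists f : omega1 -> omega2, injective f.
Proof. by apply: card_leT_fun; apply: card_not_le; exact: card_succ_gt. Qed.

(** An element of the union is coded by the index of a set containing it and its code there, a pair
    from [omega1]. *)
Lemma omega2_not_small_union (T : omega1 -> set omega2) :
  (forall a, countable (T a)) -> exists b, forall a, ~ T a b.
Proof.
move=> cT; apply: contrapT => nb; apply: (@card_succ_gt omega1).
have cov b : exists a, T a b.
  by apply: contrapT => na; apply: nb; exists b => a Tab; apply: na; exists a.
have sq := squarable_omega1; have [f [x0 [_ [fI _]]]] := sq.
have gP a : {g : omega2 -> omega1 | forall x y, T a x -> T a y -> g x = g y -> x = y}.
  by apply: cid; exact: card_le_fun (countable_le sq (cT a)) x0.
pose c b := sval (cid (cov b)); have cP b : T (c b) b by rewrite /c; case: cid.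
apply: (@inj_card_leT _ _ (fun b => f (c b, sval (gP (c b)) b))) => b b' /fI[cc].
move: (cP b) (cP b'); rewrite -cc => Tb Tb'; exact: (svalP (gP (c b))).
Qed.

Theorem grid_algebra (R : realType) : exists A : set (bop R omega2),
  [/\ Cstar_subalgebra A, scattered A, has_density A omega2 & ~ AF A].
Proof.
have sq := squarable_omega2.
have i1 := omega1_le_omega2.
have i2 : exists f : omega2 -> omega2, injective f by exists id.
have iN (T : countType) := squarable_count T sq.
have iX := squarable_prod sq (squarable_prod sq i1 i2) (iN nat).
have iZ := squarable_prod sq iX (iN nat).
have [phi phi_inj] := squarable_prod sq iZ (iN 'I_2).
have [A [A1 A2 A3 A4 [D dD cD]]] := core_algebra R (@blowup_hom (omega1 * omega2 * nat)%type)
  (@blowup_inf _) (@grid_meet_set _ _) (@grid_lab_meet _ _) (@grid_meet_lt _ _)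
  (@grid_lt_min _ _) (grid_clash omega1_uncountable omega2_not_small_union) phi_inj.
have lower D' : norm_dense_in A D' -> [set: omega2] #<= D'.
  move=> dD'; have [a0 _] := succ_two squarable_nat.
  apply: card_le_trans (A4 (range (@GCol omega1 omega2)) D' _ dD'); last first.
    move=> _ _ [b _ <-] [b' _ <-] bb'; apply: grid_col_separated => // E.
    by apply: bb'; rewrite E.
  by apply: (@card_le_inj _ _ _ _ (@GCol omega1 omega2)) => [b _|b b' _ _ []//]; exists b.
exists A; split=> //; split=> //; exists D => //.
rewrite card_eq_le (lower D dD) andbT; apply: card_le_trans cD _.
have iL : exists f : grid omega1 omega2 -> omega2, injective f.
  have [g gI] := squarable_sum sq (squarable_option sq (squarable_prod sq i1 i2))
    (squarable_sum sq i1 i2).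
  exists (fun u => g (match u with
    | GPoint o => inl o | GRow a => inr (inl a) | GCol b => inr (inr b) end)).
  by move=> [o|a|b] [o'|a'|b'] /gI // [->].
have iG := squarable_sum sq (squarable_sum sq
  (squarable_prod sq (squarable_prod sq iZ (iN 'I_2)) (iN 'I_2))
  (squarable_prod sq (squarable_prod sq iX (iN 'I_2)) (iN 'I_2))) iL.
have [h hI] := squarable_prod sq (iN (rat * rat)%type) iG.
have [s sI] := squarable_seq sq.
apply: (@inj_card_leT _ _ (s \o map h)); apply: inj_comp => //; exact: inj_map.
Qed.

(** * Trees *)

Section Tree.
Variables (W K : choiceType) (ltW : W -> W -> Prop) (Bi : Type).
Variables (f : Bi -> W -> set nat) (key : Bi -> W -> K).
Hypothesis woW : well_ordered ltW setT.
Hypothesis W_bounded : forall Q : set W, countable Q -> exists w, forall v, Q v -> ltW v w.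
Hypothesis f_inj : injective f.
Hypothesis keyP : forall b b' w, key b w = key b' w -> forall v, ltW v w -> f b v = f b' v.
Local Notation Y := (W * option K)%type.
Hypothesis Bi_big : ~ ([set: Bi] #<= [set: Y]).

Let ir w : ~ ltW w w. Proof. by have [h _ _ _] := woW; exact: h. Qed.
Let tr u v w : ltW u v -> ltW v w -> ltW u w.
Proof. by have [_ h _ _] := woW; exact: h. Qed.
Let tri u v : [\/ ltW u v, u = v | ltW v u].
Proof. by have [_ _ h _] := woW; exact: h. Qed.

Definition agree b b' w := forall v, ltW v w -> f b v = f b' v.

Definition hist b w : W -> set nat := fun v => if pselect (ltW v w) then f b v else set0.

Lemma histP b b' w : hist b w = hist b' w <-> agree b b' w.
Proof.
split=> [h v vw|h]; first by have := congr1 (fun g => g v) h; rewrite /hist; case: pselect.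
by apply/funext => v; rewrite /hist; case: pselect => // vw; exact: h.
Qed.

(** Equal keys force equal histories, but branches with the same history may have different keys.
    Fixing a representative branch for each history makes the node depend on the history alone. *)
Definition keyh (h : W -> set nat) (w : W) : option K :=
  if pselect (exists b, hist b w = h) is left e then Some (key (projT1 (cid e)) w) else None.

Definition node b w : Y := (w, keyh (hist b w) w).

Lemma node_eq b b' w w' : node b w = node b' w' <-> w = w' /\ agree b b' w.
Proof.
split=> [[<-]|[<- /histP h]]; last by rewrite /node h.
rewrite /keyh; case: pselect => [e|[]]; last by exists b.
case: pselect => [e'|[]]; last by exists b'.
case: (cid e) => r /= hr; case: (cid e') => r' /= hr' [/keyP h]; split=> //.
apply/histP; rewrite -hr -hr'; exact/histP.
Qed.

(* [None] stands for a point above all of [W]. *)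
Definition ole (v : W) (o : option W) : Prop :=
  if o is Some w then v = w \/ ltW v w else True.
Definition olt (o o' : option W) : Prop :=
  match o, o' with
  | Some w, Some w' => ltW w w'
  | Some _, None => True
  | None, _ => False
  end.
Definition omin (o o' : option W) := if pselect (olt o' o) then o' else o.

Lemma ole_omin v o o' : ole v (omin o o') <-> ole v o /\ ole v o'.
Proof.
rewrite /omin; case: pselect => h.
  split=> [vo'|[]//]; split=> //; case: o o' h vo' => [w|] [w'|] //= h [->|vw']; right => //.
  exact: tr vw' h.
split=> [vo|[]//]; split=> //; case: o o' h vo => [w|] [w'|] //= h vo.
case: (tri w' w) => // [w'w|ww']; first by rewrite w'w.
by case: vo => [->|vw]; right=> //; exact: tr vw ww'.
Qed.

Lemma omin_lt o o' : omin o o' = o \/ olt (omin o o') o.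
Proof. by rewrite /omin; case: pselect => h; [right|left]. Qed.

(** A node depends on the values strictly below its level. At the split level two branches therefore
    still share their node while their labels differ: this is their only clash. *)
Definition split_point b b' : option W :=
  if pselect (exists w, f b w <> f b' w /\ agree b b' w) is left e
  then Some (projT1 (cid e)) else None.

Lemma agree_split b b' w : agree b b' w <-> ole w (split_point b b').
Proof.
rewrite /split_point; case: pselect => [e|ne].
  case: (cid e) => d /= [fd ad]; split=> [aw|[->//|wd] v vw]; last exact: ad (tr vw wd).
  by case: (tri w d) => [|->|dw]; [right|left|case: fd; exact: aw].
split=> // _ v _; apply: contrapT => fv.
have [|m fm mmin] := wo_min woW (Q := [set w | f b w <> f b' w]); first by exists v.
apply: ne; exists m; split=> // u um; apply: contrapT => fu; exact: mmin fu um.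
Qed.

Lemma split_point_neq b b' : b <> b' -> exists d, split_point b b' = Some d /\ f b d <> f b' d.
Proof.
move=> bb'; rewrite /split_point; case: pselect => [e|ne].
  by case: (cid e) => d /= [fd _]; exists d.
exfalso; apply: bb'; apply: f_inj; apply/funext => v; apply: contrapT => fv.
have [|m fm mmin] := wo_min woW (Q := [set w | f b w <> f b' w]); first by exists v.
apply: ne; exists m; split=> // u um; apply: contrapT => fu; exact: mmin fu um.
Qed.

Local Notation L := (Bi * option W)%type.

Definition tree_set (u : L) : set Y := [set y | exists2 v, y = node u.1 v & ole v u.2].
Definition tree_lab (u : L) (y : Y) : set nat := f u.1 y.1.
Definition tree_meet (u v : L) : L := (u.1, omin u.2 (omin v.2 (split_point u.1 v.1))).
Definition tree_lt (u v : L) := olt u.2 v.2.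

Lemma tree_meet_set u v : tree_set (tree_meet u v) = tree_set u `&` tree_set v.
Proof.
apply/seteqP; split=> y.
  move=> [w ->]; rewrite !ole_omin -agree_split => -[w1 [w2 a]].
  split; exists w => //; exact/node_eq.
move=> [[w -> w1] [w' /node_eq[<- a] w2]]; exists w => //.
by rewrite !ole_omin -agree_split.
Qed.

Lemma tree_lab_meet u v : finite_set [set y | tree_set (tree_meet u v) y /\
  ~ (tree_lab u y = tree_lab (tree_meet u v) y /\
     tree_lab v y = tree_lab (tree_meet u v) y)].
Proof.
have [d hd] : exists d, split_point u.1 v.1 = d by eexists.
apply: (@sub_finite_set _ _ (if d is Some w then [set node u.1 w] else set0)); last first.
  by case: d {hd} => [w|]; [exact: finite_set1|exact: finite_set0].
move=> y [[w -> ]]; rewrite !ole_omin hd => -[_ [_ wd]] nl.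
have fuv : f u.1 w <> f v.1 w by move=> E; apply: nl; rewrite /tree_lab/=.
have aw : agree u.1 v.1 w by apply/agree_split; rewrite hd.
case: d hd wd => [d|] hd /=.
  case=> [->//|wd]; have /agree_split ad : ole d (split_point u.1 v.1).
    by rewrite hd; left.
  by case: fuv; exact: ad.
(* Branches that never split agree below every level; [W] has no largest element, so a level above
   [w] gives agreement at [w] itself. *)
move=> _; apply: fuv; have [|w' ww'] := W_bounded (Q := [set w]); first exact: countable1.
have /agree_split aw' : ole w' (split_point u.1 v.1) by rewrite hd.
by apply: aw'; exact: ww'.
Qed.

Lemma tree_meet_lt u v : tree_meet u v = u \/ tree_lt (tree_meet u v) u.
Proof.
case: u => b o; rewrite /tree_lt /tree_meet /=.
by case: (omin_lt o (omin v.2 (split_point b v.1))) => [->|h]; [left|right].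
Qed.

Lemma tree_lt_min (Q : set L) : Q !=set0 -> exists2 u, Q u & forall v, Q v -> ~ tree_lt v u.
Proof.
move=> [u Qu]; have [[b [w Qw]]|ns] := pselect (exists b w, Q (b, Some w)).
  have [|m [c Qc] mmin] := wo_min woW (Q := [set w | exists b, Q (b, Some w)]).
    by exists w, b.
  exists (c, Some m) => // -[b' [w'|]] Qv //=; apply: mmin; by exists b'.
exists u => // -[b [w|]] Qv //; by case: ns; exists b, w.
Qed.

(** For a full branch, smaller indices are proper initial segments. The countable set of exceptional
    levels is bounded by some [w b], and everything on the branch from there on is generic. *)
Lemma tree_clash (D1 : L -> set L) (D2 : L -> set Y) :
  (forall u, [/\ countable (D1 u), countable (D2 u) & forall w, D1 u w -> tree_lt w u]) ->
  exists u v y, [/\ generic tree_set u (D1 u) (D2 u) y, generic tree_set v (D1 v) (D2 v) y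
    & tree_lab u y <> tree_lab v y].
Proof.
move=> h.
have bP b : exists w, (forall c v, D1 (b, None) (c, Some v) -> ltW v w) /\
    (forall y, D2 (b, None) y -> ltW y.1 w).
  have [c1 c2 _] := h (b, None).
  pose Q1 := \bigcup_(u in D1 (b, None)) (if u.2 is Some w then [set w] else set0).
  have cQ1 : countable Q1.
    by apply: bigcup_countable => // -[c [w|]] _ /=; [exact: countable1|exact: countable0].
  have cQ2 : countable (fst @` D2 (b, None)).
    by apply: card_le_trans c2; exact: card_image_le.
  have [|w hw] := W_bounded (Q := Q1 `|` fst @` D2 (b, None)).
    by rewrite -bigcup2E; apply: bigcup_countable => // -[|[|k]] _ //=.
  exists w; split=> [c v Dv|y Dy]; apply: hw; first by left; exists (c, Some v).
  by right; exists y.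
pose w b := sval (cid (bP b)).
(* Pigeonhole: there are more branches than nodes, so two branches pass through the same node at
   their bounds and split only at or above it. *)
have [b [b' [bb' nE]]] : exists b b', b <> b' /\ node b (w b) = node b' (w b').
  apply: contrapT => nex; apply: Bi_big.
  apply: (@inj_card_leT _ _ (fun b => node b (w b))) => b b' nE.
  by apply: contrapT => bb'; apply: nex; exists b, b'.
have /node_eq[ww /agree_split] := nE; have [d [hd fd]] := split_point_neq bb'.
rewrite hd => wd.
have /agree_split ad : ole d (split_point b b') by rewrite hd; left.
have good c : ole (w c) (Some d) ->
    generic tree_set (c, None) (D1 (c, None)) (D2 (c, None)) (node c d).
  move=> wcd; have [h1 h2] := svalP (cid (bP c)); rewrite -/(w c) in h1 h2.
  have lt_wcd v : ltW v (w c) -> ltW v d.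
    by move=> vw; case: wcd => [<-//|]; exact: tr.
  split; first by exists d.
    by move=> /h2/lt_wcd /= /ir.
  move=> [c' [v|]] Dv; last by have [_ _ /(_ _ Dv)] := h (c, None).
  move=> [v' /node_eq[<- _] /= [dv|dv]]; have := lt_wcd _ (h1 _ _ Dv).
    by rewrite dv => /ir.
  by move=> /(tr dv)/ir.
exists (b, None), (b', None), (node b d); split; first exact: good.
  have -> : node b d = node b' d by apply/node_eq.
  by apply: good; rewrite -ww.
exact: fd.
Qed.

Lemma tree_tops_separated b b' : b <> b' ->
  exists2 y, tree_set (b, None) y & ~ tree_set (b', None) y.
Proof.
move=> /split_point_neq[d [hd _]].
have [|w dw] := W_bounded (Q := [set d]); first exact: countable1.
exists (node b w); first by exists w.
move=> [w' /node_eq[_ /agree_split]]; rewrite hd /=.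
by case=> [wd|wd] _; [apply: (ir (w := d)); rewrite -{2}wd|apply: (ir (w := d));
  apply: tr wd]; exact: dw.
Qed.

Theorem tree_algebra (R : realType) (I Z : choiceType) (E : set (Y * nat) -> set Z)
    (phi : Z * 'I_2 -> I) : mod_fin_hom E -> (forall x, ~ ae (fun z => ~ E [set x] z)) ->
  injective phi -> exists A : set (bop R I),
  [/\ Cstar_subalgebra A, scattered A, ~ AF A &
    forall D, norm_dense_in A D -> [set: Bi] #<= D].
Proof.
move=> EH E_inf phi_inj.
have [A [A1 A2 A3 A4 _]] := core_algebra R EH E_inf tree_meet_set tree_lab_meet
  tree_meet_lt tree_lt_min tree_clash phi_inj.
exists A; split=> // D dD.
apply: card_le_trans (A4 (range (fun b => (b, None))) D _ dD).
  apply: (@card_le_inj _ _ _ _ (fun b : Bi => (b, None : option W))) => [b _|b b' _ _ []//].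
  by exists b.
move=> _ _ [b _ <-] [b' _ <-] bb'; apply: tree_tops_separated => bE.
by apply: bb'; rewrite bE.
Qed.

End Tree.

(** * The tree of subsets of a segment, for the continuum *)

Lemma well_ordered_val T (A : set T) (lt : T -> T -> Prop) : well_ordered lt A ->
  @well_ordered A (fun x y => lt (\val x) (\val y)) setT.
Proof.
move=> [ir tr tri mi]; have mem (x : A) : A (\val x) := set_mem (valP x).
split=> [x _|x y z _ _ _|x y _ _|B _ [b Bb]].
- exact: ir (mem x).
- exact: tr (mem x) (mem y) (mem z).
- case: (tri _ _ (mem x) (mem y)) => [xy|/val_inj xy|yx].
  + by constructor 1.
  + by constructor 2.
  + by constructor 3.
- have [||_ [m Bm <-] mB] := mi (\val @` B).
  + by move=> _ [x _ <-].
  + by exists (\val b), b.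
  exists m => // x Bx; have [/val_inj ->|h] := mB (\val x) (ex_intro2 _ _ x Bx erefl).
    by left.
  by right.
Qed.

Lemma blowup_injection (I Y : choiceType) : squarable I -> (exists f : Y -> I, injective f) ->
  exists phi : Y * nat * nat * 'I_2 -> I, injective phi.
Proof.
move=> sq iY; have iN (T : countType) := squarable_count T sq.
exact: squarable_prod sq (squarable_prod sq (squarable_prod sq iY (iN nat)) (iN nat)) (iN 'I_2).
Qed.

(* The shortest initial segment, of a well-order of P(nat), with more than
   continuum many subsets. *)
Lemma continuum_segment : exists A : set (set nat),
  ~ ([set B | B `<=` A] #<= [set: set nat]) /\
  forall a, A a -> [set B | B `<=` [set b | pow_lt b a]] #<= [set: set nat].
Proof.
pose Q := [set a : set nat | ~ ([set B | B `<=` [set b | pow_lt b a]] #<= [set: set nat])].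
have [[a0 Qa0]|nQ] := pselect (Q !=set0); last first.
  exists setT; split=> [h|a _]; last first.
    by apply: contrapT => na; apply: nQ; exists a.
  have [g gI] := card_le_fun h (set0 : set nat).
  pose D : set (set nat) := [set x | exists2 B, g B = x & ~ B x].
  have gI' B B' : g B = g B' -> B = B' by apply: gI => // x.
  have nD : ~ D (g D) by move=> Dg; case: (Dg) => B /gI' BD nB; apply: nB; rewrite BD.
  by apply: (nD); exists D.
have [a Qa amin] := wo_min (@pow_lt_wo nat setT) (ex_intro _ a0 Qa0 : Q !=set0).
exists [set b | pow_lt b a]; split=> // b ba.
by apply: contrapT => nb; apply: (amin b).
Qed.

(** Branches are all subsets of the segment. Its minimality makes the traces below any level codable
    by sets of natural numbers, so there are only continuum many nodes. *)
Theorem continuum_algebra (R : realType) : exists A : set (bop R (set nat)),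
  [/\ Cstar_subalgebra A, scattered A, density_gt A (set nat) & ~ AF A].
Proof.
have [Wset [big small]] := continuum_segment.
have sq := squarable_setnat; have [f2 [_ [_ [f2I _]]]] := sq.
pose W : choiceType := Wset.
pose ltW (x y : W) := pow_lt (\val x) (\val y).
have woW : well_ordered ltW setT := well_ordered_val (@pow_lt_wo nat Wset).
have [irW trW triW miW] := woW.
pose f (b : set W) (w : W) : set nat := if pselect (b w) then setT else set0.
have fE b b' w : f b w = f b' w -> (b w <-> b' w).
  rewrite /f; case: pselect => h; case: pselect => h' // /(congr1 (fun F => F 0%N)) /= E.
    by exfalso; rewrite -E.
  by exfalso; rewrite E.
have fI : injective f.
  move=> b b' h; apply/funext => w; apply/propext; apply: fE.
  by rewrite h.
have gP (w : W) : {g : set (set nat) -> set nat | forall B B',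
    B `<=` [set b | pow_lt b (\val w)] -> B' `<=` [set b | pow_lt b (\val w)] ->
    g B = g B' -> B = B'}.
  apply: cid; exact: card_le_fun (small _ (set_mem (valP w))) (set0 : set nat).
pose below (b : set W) (w : W) : set (set nat) := \val @` [set v | b v /\ ltW v w].
pose key b w := sval (gP w) (below b w).
have keyE b b' w : key b w = key b' w -> forall v, ltW v w -> (b v <-> b' v).
  have sub c : below c w `<=` [set x | pow_lt x (\val w)] by move=> _ [v [_ vw] <-].
  move=> /(svalP (gP w) _ _ (sub b) (sub b')) E v vw; split=> bv.
    have : below b w (\val v) by exists v.
    by rewrite E => -[v' [bv' _] /val_inj <-].
  have : below b' w (\val v) by exists v.
  by rewrite -E => -[v' [bv' _] /val_inj <-].
have keyP b b' w : key b w = key b' w -> forall v, ltW v w -> f b v = f b' v.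
  move=> E v vw; have bb' := keyE _ _ _ E v vw.
  rewrite /f; case: pselect => bv; case: pselect => bv' //.
    by case: bv'; apply/bb'.
  by case: bv; apply/bb'.
have bigW : ~ ([set: set W] #<= [set: set nat]).
  move=> h; apply: big; apply: card_le_trans h.
  apply: (@card_le_inj _ _ _ _ (fun B : set (set nat) => [set w : W | B (\val w)])) => //.
  move=> B B' BW BW' E; apply/seteqP; split=> x Bx.
    by have : [set w : W | B (\val w)] (SigSub (mem_set (BW x Bx))) by []; rewrite E.
  by have : [set w : W | B' (\val w)] (SigSub (mem_set (BW' x Bx))) by []; rewrite -E.
(* If [Q] were cofinal, a subset would be determined by its keys and values at the levels in [Q], a
   sequence of sets of natural numbers; there would then be at most continuum many subsets. *)
have bounded Q : countable Q -> exists w, forall v, Q v -> ltW v w.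
  move=> cQ; apply: contrapT => nw; apply: bigW.
  have [e eI] := card_le_fun cQ 0%N.
  have [s sI] := sequence_setnat.
  pose code b n := if pselect (exists v, Q v /\ e v = n) is left h
    then f2 (key b (projT1 (cid h)), f b (projT1 (cid h))) else set0.
  apply: (@inj_card_leT _ _ (s \o code)) => b b' /sI E.
  apply/funext => w; apply/propext.
  have [v Qv vw] : exists2 v, Q v & w = v \/ ltW w v.
    apply: contrapT => nv; apply: nw; exists w => v Qv; apply: contrapT => vw; apply: nv.
    by exists v => //; case: (triW w v) => //; [right|left].
  have := congr1 (fun F => F (e v)) E; rewrite /code; case: pselect => [h|[]]; last by exists v.
  case: (cid h) => v' /= [Qv' /(eI _ _ Qv' Qv) ->] /f2I[kk fv].
  by case: vw => [->|wv]; [apply: fE; rewrite fv|exact: keyE kk w wv].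
have iW : exists h : W -> set nat, injective h by exists \val; exact: val_inj.
have iP : exists h : set nat -> set nat, injective h by exists id.
have iY := squarable_prod sq iW (squarable_option sq iP).
have bigY : ~ ([set: set W] #<= [set: W * option (set nat)]).
  move=> h; apply: bigW; apply: card_le_trans h _.
  by have [h hI] := iY; exact: inj_card_leT hI.
have [phi phi_inj] := blowup_injection sq iY.
have [A [A1 A2 A3 A4]] := tree_algebra woW bounded fI keyP bigY R
  (@blowup_hom _) (@blowup_inf _) phi_inj.
exists A; split=> // D dD; split=> [|DX].
  by apply: card_le_trans (A4 D dD); exact: card_not_le.
by apply: bigW; apply: card_le_trans (A4 D dD) DX.
Qed.

(** * Canadian trees *)

Section Canadian.
Variables (T : Type) (prec : T -> T -> Prop).
Hypothesis CT : is_Canadian_tree prec.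

Let treeT : is_tree prec. Proof. by case: CT. Qed.
Let wo1 : well_ordered omega1_lt setT. Proof. exact: succ_lt_wo. Qed.
Let ir a : ~ omega1_lt a a. Proof. by have [h _ _ _] := wo1; exact: h. Qed.
Let tr a b c : omega1_lt a b -> omega1_lt b c -> omega1_lt a c.
Proof. by have [_ h _ _] := wo1; exact: h. Qed.
Let tri a b : [\/ omega1_lt a b, a = b | omega1_lt b a].
Proof. by have [_ _ h _] := wo1; exact: h. Qed.
Let ptrans s t u : prec s t -> prec t u -> prec s u.
Proof. by have [_ h _] := treeT; exact: h. Qed.

(** Rigidity of well-orders: at a least value with [g t] below [f t], the element that [f] sends to
    [g t] precedes [t] and is again lowered by [g], at a smaller value. *)
Lemma has_ht_le s a b : has_ht prec s a -> has_ht prec s b -> ~ omega1_lt b a.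
Proof.
move=> [f [f1 f2 f3] fo] [g [g1 g2 g3] go] ba.
have [|x [t [ts [fx gx]]] xmin] := wo_min wo1
    (Q := [set x | exists t, prec t s /\ f t = x /\ omega1_lt (g t) x]).
  have [t ts ft] := f3 _ ba; exists b, t; split=> //; split=> //.
  exact: g1.
have fta : omega1_lt (f t) a by exact: f1.
have [t' t's ft'] := f3 (g t) (tr (eq_ind_r (omega1_lt (g t)) gx fx) fta).
have t't : prec t' t by apply/(fo _ _ t's ts); rewrite ft' fx.
apply: (xmin (g t)); last by [].
by exists t'; split=> //; split=> //; apply/(go _ _ t's ts).
Qed.

Lemma has_ht_unique s a b : has_ht prec s a -> has_ht prec s b -> a = b.
Proof.
by move=> sa sb; case: (tri a b) => // /has_ht_le; [move/(_ _ sb sa)|move/(_ _ sa sb)].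
Qed.

Lemma has_ht_restrict s s' a f : set_bij [set t | prec t s'] [set b | omega1_lt b a] f ->
  (forall t u, prec t s' -> prec u s' -> (prec t u <-> omega1_lt (f t) (f u))) ->
  prec s s' -> has_ht prec s (f s).
Proof.
move=> [f1 f2 f3] fo ss'; exists f; last first.
  by move=> t u ts us; apply: fo; apply: ptrans ss'.
split=> [t ts|t u /set_mem ts /set_mem us|b /= bs].
- by apply/fo => //; exact: ptrans ts ss'.
- by apply: f2; apply/mem_set; apply: ptrans ss'.
- have [t ts' ft] := f3 b (tr bs (f1 _ ss')); exists t => //=.
  by apply/fo => //; rewrite ft.
Qed.

Lemma has_ht_prec s s' a : has_ht prec s' a -> prec s s' ->
  exists2 b, omega1_lt b a & has_ht prec s b.
Proof.
move=> [f fb fo] ss'; exists (f s); last exact: has_ht_restrict fb fo ss'.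
by have [f1 _ _] := fb; exact: f1.
Qed.

Lemma has_ht_onto s a b : has_ht prec s a -> omega1_lt b a ->
  exists2 t, prec t s & has_ht prec t b.
Proof.
move=> [f fb fo] ba; have [_ _ f3] := fb; have [t ts <-] := f3 b ba.
by exists t => //; exact: has_ht_restrict fb fo ts.
Qed.

Lemma branch_down S s t : is_branch prec S -> S s -> prec t s -> S t.
Proof.
move=> [lin mx] Ss ts; have cmp u : S u -> [\/ prec t u, t = u | prec u t].
  move=> Su; case: (lin u s Su Ss) => [us|->|su].
  - by have [_ _ /(_ s)[_ _ h _]] := treeT; exact: h.
  - by constructor 1.
  - by constructor 1; exact: ptrans ts su.
have <- : S `|` [set t] = S; last by right.
apply: mx => // [u v [Su|->] [Sv|->]]; [exact: lin| |exact: cmp|by constructor 2].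
by case: (cmp u Su); [constructor 3|constructor 2|constructor 1].
Qed.

Lemma branch_level_unique S s t a : is_branch prec S -> S s -> S t ->
  has_ht prec s a -> has_ht prec t a -> s = t.
Proof.
move=> [lin _] Ss St sa ta; case: (lin s t Ss St) => // st.
  by have [b ba sb] := has_ht_prec ta st; move: ba; rewrite (has_ht_unique sb sa) => /ir.
by have [b ba tb] := has_ht_prec sa st; move: ba; rewrite (has_ht_unique tb ta) => /ir.
Qed.

(** A branch that misses level [a] has all its heights below [a]; these form a countable set and
    determine the elements of the branch. *)
Lemma branch_level S a : is_branch prec S -> ~ countable S ->
  exists2 s, S s & has_ht prec s a.
Proof.
move=> bS uS; apply: contrapT => na; apply: uS.
have [_ [htT _] _ _] := CT.
pose h s := sval (cid (htT s)); have hP s : has_ht prec s (h s) by rewrite /h; case: cid.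
apply: card_le_trans (card_succ_segment a).
apply: (@card_le_inj _ _ _ _ h) => [s Ss|s t Ss St st].
  case: (tri (h s) a) => // [sa|sa].
    by case: na; exists s => //; rewrite -sa.
  have [t ts ta] := has_ht_onto (hP s) sa; case: na; exists t => //.
  exact: branch_down bS Ss ts.
by apply: (branch_level_unique bS Ss St (hP s)); rewrite st.
Qed.

(** An uncountable branch becomes the sequence of codes of its elements within their levels. The
    code at one level fixes the element there, hence the branch below it. *)
Lemma Canadian_functions : exists (Bi : Type) (f : Bi -> omega1 -> set nat)
    (key : Bi -> omega1 -> omega1),
  [/\ injective f,
    forall b b' w, key b w = key b' w -> forall v, omega1_lt v w -> f b v = f b' v &
    card_lt [set: omega1] [set: Bi]].
Proof.
have [_ [htT _] lev [le1 nle1]] := CT.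
pose Bset := [set S | is_branch prec S /\ ~ countable S].
have mem (S : Bset) : Bset (\val S) := set_mem (valP S).
have eP (S : Bset) a : {s | \val S s & has_ht prec s a}.
  by apply: cid2; have [bS uS] := mem S; exact: branch_level.
pose elt S a := s2val (eP S a).
have eltS S a : \val S (elt S a) := s2valP (eP S a).
have eltH S a : has_ht prec (elt S a) a := s2valP' (eP S a).
have [x0 _] := succ_two squarable_nat.
have cP a : {c : T -> omega1 |
    forall s t, has_ht prec s a -> has_ht prec t a -> c s = c t -> s = t}.
  by apply: cid; exact: card_le_fun (lev a) x0.
pose key S a := sval (cP a) (elt S a).
have keyE S S' a : key S a = key S' a -> elt S a = elt S' a.
  by move/(svalP (cP a) _ _ (eltH S a) (eltH S' a)).
have in_elt (S : Bset) s a : \val S s -> has_ht prec s a -> s = elt S a.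
  by move=> Ss sa; have [bS _] := mem S; exact: branch_level_unique bS Ss (eltS S a) sa (eltH S a).
(* An element of [omega1] is by construction a set of natural numbers, so the key doubles as a
   label. *)
exists Bset, (fun S a => \val (key S a)), key; split.
- move=> S S' E; apply: val_inj.
  have elE a : elt S a = elt S' a.
    by apply: keyE; apply: val_inj; have := congr1 (fun F => F a) E.
  apply/seteqP; split=> s Ss; have [a sa] := htT s.
    by rewrite (in_elt S s a Ss sa) elE; exact: eltS.
  by rewrite (in_elt S' s a Ss sa) -elE; exact: eltS.
- move=> S S' w /keyE E v vw; congr (\val _); rewrite /key; congr (sval _ _).
  apply: in_elt (eltH S v); have [bS _] := mem S; have [bS' _] := mem S'.
  have vw' : prec (elt S v) (elt S w).
    have [lin _] := bS; case: (lin _ _ (eltS S v) (eltS S w)) => // [E'|wv].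
      have := eltH S v; rewrite E' => /has_ht_unique/(_ (eltH S w)) vE.
      by move: vw; rewrite vE => /ir.
    have [b bv wb] := has_ht_prec (eltH S v) wv.
    by move: bv; rewrite (has_ht_unique wb (eltH S w)) => /(tr vw)/ir.
  by apply: branch_down bS' (eltS S' w) _; rewrite -E.
- split; first by rewrite (card_le_eqr (card_setT Bset)).
  by move=> h; apply: nle1; rewrite -(card_le_eql (card_setT Bset)).
Qed.

Lemma tree_index_omega1 : exists f : omega1 * option omega1 -> omega1, injective f.
Proof.
have sq := squarable_omega1; have i1 : exists f : omega1 -> omega1, injective f by exists id.
exact: squarable_prod sq i1 (squarable_option sq i1).
Qed.

Lemma Canadian_algebra (R : realType) (I Z : choiceType)
    (E : set (omega1 * option omega1 * nat) -> set Z) (phi : Z * 'I_2 -> I) :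
  mod_fin_hom E -> (forall x, ~ ae (fun z => ~ E [set x] z)) -> injective phi ->
  exists A : set (bop R I),
    [/\ Cstar_subalgebra A, scattered A, density_gt A omega1 & ~ AF A].
Proof.
move=> EH E_inf phi_inj; have [Bi [f [key [fI keyP [le1 nle1]]]]] := Canadian_functions.
have big : ~ ([set: Bi] #<= [set: omega1 * option omega1]).
  move=> h; apply: nle1; apply: card_le_trans h _.
  by have [g gI] := tree_index_omega1; exact: inj_card_leT gI.
have [A [A1 A2 A3 A4]] := tree_algebra wo1 omega1_bounded fI keyP big R EH E_inf phi_inj.
exists A; split=> // D dD; split; first exact: card_le_trans le1 (A4 D dD).
by move=> DX; apply: nle1; exact: card_le_trans (A4 D dD) DX.
Qed.

End Canadian.

(** * Representatives of an embedding into P(nat)/Fin *)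

Section EmbeddedBooleanAlgebra.
Variables (X : choiceType) (h : X -> omega1) (E : set omega1 -> PN_mod_Fin).
Hypotheses (h_inj : injective h) (h_surj : forall w, exists x, h x = w).
Hypothesis EB : Boolean_embedding E.

Definition lift_sets (A : set X) : set nat := repr (E (h @` A)).

Lemma eq_mod_fin_ae (A B : set nat) : finite_set (A `+` B) -> ae (fun n => A n <-> B n).
Proof.
apply: sub_finite_set => n /= h'; rewrite /setY /setD /=.
by have [An|An] := pselect (A n); have [Bn|Bn] := pselect (B n); tauto.
Qed.

Lemma repr_pi_ae (A : set nat) : ae (fun n => repr (\pi_PN_mod_Fin A)%qT n <-> A n).
Proof. exact/eq_mod_fin_ae/repr_pi_fin. Qed.

Lemma lift_sets_hom : mod_fin_hom lift_sets.
Proof.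
have [EI [E0 E1] EU En EC] := EB; split; rewrite /lift_sets.
- by rewrite image_set0 E0; apply: aeS (repr_pi_ae set0) => n /= ->.
- by move=> A B; rewrite image_setU EU; exact: repr_pi_ae.
- move=> A B; have -> : h @` (A `&` B) = h @` A `&` h @` B.
    apply/seteqP; split=> w; first by move=> [x [Ax Bx] <-]; split; exists x.
    by move=> [[x Ax <-] [y By /h_inj yx]]; exists x => //; split=> //; rewrite -yx.
  by rewrite En; exact: repr_pi_ae.
- move=> A; have -> : h @` (~` A) = ~` (h @` A).
    apply/seteqP; split=> w; first by move=> [x nA <-] [y Ay /h_inj yx]; apply: nA; rewrite -yx.
    by have [x <-] := h_surj w => nA; exists x => // Ax; apply: nA; exists x.
  by rewrite EC; exact: repr_pi_ae.
Qed.

(** Injectivity keeps the image of a singleton different from the bottom element, which means that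
    its representative is infinite. *)
Lemma lift_sets_inf x : ~ ae (fun n => ~ lift_sets [set x] n).
Proof.
have [EI [E0 _] _ _ _] := EB; rewrite /lift_sets image_set1 => fin.
have : E [set h x] = E set0.
  rewrite E0 -[LHS]reprK; apply/pi_eqE; apply: sub_finite_set fin => n /=.
  by rewrite /setY /setD /=; tauto.
by move=> /EI h0; have : [set h x] (h x) by []; rewrite h0.
Qed.

End EmbeddedBooleanAlgebra.

Theorem theorem1p10 (R : realType) :
  [/\ (exists A : set (bop R omega2),
         [/\ Cstar_subalgebra A, scattered A, has_density A omega2 & ~ AF A]),
      (exists A : set (bop R (set nat)),
         [/\ Cstar_subalgebra A, scattered A, density_gt A (set nat) & ~ AF A]),
      ((exists (T : Type) (prec : T -> T -> Prop), is_Canadian_tree prec) ->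
       exists A : set (bop R omega1),
         [/\ Cstar_subalgebra A, scattered A, density_gt A omega1 & ~ AF A])
    & ((exists (T : Type) (prec : T -> T -> Prop), is_Canadian_tree prec) ->
       (exists E : set omega1 -> PN_mod_Fin, Boolean_embedding E) ->
       exists A : set (bop R nat),
         [/\ Cstar_subalgebra A, scattered A, density_gt A omega1 & ~ AF A])].
Proof.
split; [exact: grid_algebra|exact: continuum_algebra| |].
  move=> [T [prec CT]].
  have [phi phi_inj] := blowup_injection squarable_omega1 tree_index_omega1.
  exact (Canadian_algebra CT R (@blowup_hom _) (@blowup_inf _) phi_inj).
move=> [T [prec CT]] [E EB].
have sq := squarable_omega1.
have [g gI] := squarable_prod sq tree_index_omega1 (squarable_count nat sq).
(* A bijection rather than an injection, since the direct image must commute with complements for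
   [lift_sets_hom]. *)
have : [set: omega1 * option omega1 * nat] #= [set: omega1].
  rewrite card_eq_le (inj_card_leT gI); apply: (@inj_card_leT _ _ (fun w => (w, None, 0%N))).
  by move=> w w' [].
move=> /card_eqT_bij[h h_inj h_surj].
have [phi phi_inj] : exists phi : nat * 'I_2 -> nat, injective phi.
  by exists pickle; exact: pcan_inj pickleK.
apply: (@Canadian_algebra _ _ CT R nat nat (lift_sets h E) phi) => //.
  exact: lift_sets_hom.
by move=> x; apply: lift_sets_inf.
Qed.
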